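(* Let $g$ be a totally positive function of finite type $m\ge 2$. Let $M\in\mathbb{N}$, $\alpha=M$, $\beta=1/M$, and let $K\in\mathbb{N}$ with $K/M\in\mathbb{N}$. (i) If $K/M$ is odd, then $\mathcal{G}(P_Kg,\alpha,\beta)$ is a Gabor frame for $L^2(\mathbb{T}_K)$. (ii) If $K/M$ is odd, then $\mathcal{G}(P_KSg,\alpha,\beta)$ is a Gabor frame for $\mathbb{C}^K$. Assume in addition that $g$ is even. Then: (iii) If $M$ is odd, then $\mathcal{G}(Sg,\alpha,\beta)$ is a Gabor frame for $\ell^2(\mathbb{Z})$. (iv) If $M$ is odd, then $\mathcal{G}(P_KSg,\alpha,\beta)$ is a Gabor frame for $\mathbb{C}^K$.
   Context: $j$ is the imaginary unit, $\hat g(\xi)=\int g(x)e^{-2\pi jx\xi}dx$. $g\in L^1(\mathbb{R})$ is totally positive of finite type $m$ if $\hat g(\xi)=C\prod_{k=1}^m(1+2\pi j\delta_k\xi)^{-1}$ with $C>0$ and nonzero real $\delta_k$. $Sg=(g(k))_{k\in\mathbb{Z}}$; $P_Kg(x)=\sum_{k\in\mathbb{Z}}g(x-kK)$ for $x\in[0,K]$; $P_KSg=(\sum_{k}g(n-kK))_{n=0}^{K-1}\in\mathbb{C}^K$. Time-frequency shifts: on $\ell^2(\mathbb{Z})$, $M_\xi T_kf(l)=f(l-k)e^{2\pi j\xi l}$; on $L^2(\mathbb{T}_K)$ ($\mathbb{T}_K=[0,K]$ periodic), $M_\xi T_xf(t)=f((t-x)\bmod K)e^{2\pi j\xi t}$;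 on $\mathbb{C}^K$, $M_\xi T_kf(n)=f((n-k)\bmod K)e^{2\pi j\xi n}$. Gabor families: $\mathcal{G}(Sg,M,1/M)=\{M_{l/M}T_{kM}Sg:k\in\mathbb{Z},l=0,\ldots,M-1\}$; $\mathcal{G}(P_Kg,M,1/M)=\{M_{l/M}T_{kM}P_Kg:k=0,\ldots,K/M-1,l\in\mathbb{Z}\}$; $\mathcal{G}(P_KSg,M,1/M)=\{M_{l/M}T_{kM}P_KSg:k=0,\ldots,K/M-1,l=0,\ldots,M-1\}$. A family $(e_i)$ is a frame for $H$ if $A\|f\|^2\le\sum|\langle f,e_i\rangle|^2\le B\|f\|^2$ for all $f\in H$ with constants $A,B>0$. *)

(* Defs.v *)
From mathcomp Require Import all_boot all_order all_algebra.
From mathcomp Require Import all_classical all_reals all_analysis.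
From mathcomp Require Import complex.
Set Implicit Arguments. Unset Strict Implicit. Unset Printing Implicit Defensive.
Import Order.TTheory GRing.Theory Num.Theory.
Import numFieldNormedType.Exports.
Local Open Scope classical_set_scope.
Local Open Scope ring_scope.

Section GaborDefs.
Variable R : realType.
Local Notation C := R[i].

Definition cconj (z : C) : C := Complex (complex.Re z) (- complex.Im z).
Definition cabs2 (z : C) : R := complex.Re z ^+ 2 + complex.Im z ^+ 2.
Definition cexpi (t : R) : C :=
  Complex (cos (2 * pi * t)) (sin (2 * pi * t)).

Definition cmeasurable (D : set R) (f : R -> C) : Prop :=
  measurable_fun D (fun x => complex.Re (f x)) /\ measurable_fun D (fun x => complex.Im (f x)).
Definition cintegrable (D : set R) (f : R -> C) : Prop :=
  (lebesgue_measure).-integrable D (fun x => (complex.Re (f x))%:E) /\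
  (lebesgue_measure).-integrable D (fun x => (complex.Im (f x))%:E).
Definition cint (D : set R) (f : R -> C) : C :=
  Complex (Rintegral lebesgue_measure D (fun x => complex.Re (f x)))
          (Rintegral lebesgue_measure D (fun x => complex.Im (f x))).

Definition fourier (g : R -> C) (xi : R) : C :=
  cint setT (fun x => g x * cexpi (- (x * xi))).

Definition totally_positive_finite_type (g : R -> C) (m : nat) : Prop :=
  cintegrable setT g /\
  exists (c : R) (delta : 'I_m -> R),
    0 < c /\ (forall k, delta k != 0) /\
    forall xi : R, fourier g xi =
      c%:C%C * \prod_(k < m) (1 + 'i%C * (2 * pi * delta k * xi)%:C%C)^-1.

(** bilateral sum over Z, as the limit of the symmetric partial sums
    (componentwise); all sums used below converge absolutely *)
Definition zsum (u : int -> C) : C :=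
  Complex (limn (fun N : nat => \sum_(i < (2 * N).+1) complex.Re (u (i%:Z - N%:Z))))
          (limn (fun N : nat => \sum_(i < (2 * N).+1) complex.Im (u (i%:Z - N%:Z)))).

Definition rmod (t K : R) : R := t - K * (Num.floor (t / K))%:~R.

Definition periodize (K : R) (g : R -> C) (x : R) : C :=
  zsum (fun k => g (x - k%:~R * K)).

Definition sample (g : R -> C) (n : int) : C := g n%:~R.

Definition periodize_sample (K : nat) (g : R -> C) (n : int) : C :=
  zsum (fun k => g (n - k * K%:Z)%:~R).

Definition is_frame (V : Type) (I : choiceType) (H : set V) (ip : V -> V -> C)
    (nrm2 : V -> R) (e : I -> V) : Prop :=
  (forall i, H (e i)) /\
  exists A B : R, 0 < A /\ 0 < B /\
    forall f, H f ->
      ((A * nrm2 f)%:E <= \esum_(i in [set: I]) (cabs2 (ip f (e i)))%:E)%E /\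
      (\esum_(i in [set: I]) (cabs2 (ip f (e i)))%:E <= (B * nrm2 f)%:E)%E.

Definition L2T (K : R) : set (R -> C) :=
  fun f => cmeasurable `[0, K] f /\
           (lebesgue_measure).-integrable `[0, K] (fun t => (cabs2 (f t))%:E).
Definition ipL2T (K : R) (f h : R -> C) : C := cint `[0, K] (fun t => f t * cconj (h t)).
Definition nrm2L2T (K : R) (f : R -> C) : R := Rintegral lebesgue_measure `[0, K] (fun t => cabs2 (f t)).
Definition tfT (K xi x : R) (f : R -> C) : R -> C :=
  fun t => f (rmod (t - x) K) * cexpi (xi * t).

Definition l2Z : set (int -> C) :=
  fun f => (\esum_(n in [set: int]) (cabs2 (f n))%:E < +oo)%E.
Definition ipl2Z (f h : int -> C) : C := zsum (fun n => f n * cconj (h n)).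
Definition nrm2l2Z (f : int -> C) : R := fine (\esum_(n in [set: int]) (cabs2 (f n))%:E).
Definition tfZ (xi : R) (k : int) (f : int -> C) : int -> C :=
  fun l => f (l - k) * cexpi (xi * l%:~R).

Definition CK (K : nat) : set ('I_K -> C) := setT.
Definition ipCK (K : nat) (f h : 'I_K -> C) : C := \sum_(n < K) f n * cconj (h n).
Definition nrm2CK (K : nat) (f : 'I_K -> C) : R := \sum_(n < K) cabs2 (f n).
(** M_xi T_k f (n) = f((n - k) mod K) e^{2 pi j xi n}, f given on Z/KZ via its
    values on the representatives 0..K-1 *)
Definition tfCK (K : nat) (xi : R) (k : int) (f : int -> C) : 'I_K -> C :=
  fun n => f ((n%:Z - k) %% K%:Z)%Z * cexpi (xi * n%:R).

Definition gabor_Sg (g : R -> C) (M : nat) : int * 'I_M -> (int -> C) :=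
  fun kl => tfZ (kl.2%:R / M%:R) (kl.1 * M%:Z) (sample g).
Definition gabor_PKg (g : R -> C) (M K : nat) : 'I_(K %/ M) * int -> (R -> C) :=
  fun kl => tfT K%:R (kl.2%:~R / M%:R) (kl.1 * M)%N%:R (periodize K%:R g).
Definition gabor_PKSg (g : R -> C) (M K : nat) : 'I_(K %/ M) * 'I_M -> ('I_K -> C) :=
  fun kl => @tfCK K (kl.2%:R / M%:R) (kl.1 * M)%N%:Z (periodize_sample K g).

End GaborDefs.

(* Main.v *)
Require Import Defs.
From mathcomp Require Import all_boot all_order all_algebra.
From mathcomp Require Import all_classical all_reals all_analysis.
From mathcomp Require Import complex.
From mathcomp Require Import measurable_realfun ring lra zify.
Import Order.TTheory GRing.Theory Num.Theory.
Import numFieldNormedType.Exports.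
Local Open Scope classical_set_scope.
Local Open Scope ring_scope.


(* Up to a positive factor g is the kernel h of the product of the resolvents
   (1 + delta_k D)^-1, because both have the same Fourier transform. All four Gabor
   systems have lattice M Z x (1/M) Z, so a finite Fourier transform (or Parseval on
   an interval of length M) in the modulation variable, followed by one in the
   translation variable, reduces the frame inequality to upper and lower bounds for
   the Zak transform Z h (x, phi) = sum_k h (x - k M) e^(i k phi): on the torus and on
   C^K only the phases phi = 2 pi j M / K occur.
   The Zak transform has no zero with e^(i phi) <> -1. This is proved by induction on
   the number of resolvents: as x runs over one period the curve Z h (x, phi) turns
   in a fixed direction by at most the angle phi < pi, and convolution with a one-sided
   exponential preserves this; phases in ]pi, 2 pi[ follow by conjugation, and at
   phase 0 the transform is positive. When e^(i phi) = -1 the transform is real and changes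
   sign exactly once per period; for even h this happens at M / 2 + M Z, which
   contains no integer if M is odd. If K / M is odd, the phase pi does not occur.
   The bounds on C^K hold uniformly in K, and K -> oo gives the frame for l^2(Z). *)

(** * Lebesgue integration on the line *)

(** The samples of g are pointwise values, whereas its Fourier transform determines g only almost
    everywhere; continuity of g and, for m >= 2, of h turns equality of transforms into g = c h at
    every point. The kernel of a single resolvent jumps at 0, so the equation d v' + v = u is mostly
    used in the integrated form e^(y/d) v(y) - e^(x/d) v(x) = (1/d) int_x^y e^(t/d) u(t) dt. It
    needs no derivative, and summing it over the translates by k M with weights e^(i k phi) gives
    the same equation for the Zak transforms. The invariants of the induction are inequalities that
    survive integration over one period, for either sign of d. Nonvanishing becomes a pair of frame
    bounds by compactness: finitely many phases and x in [0, M] for the torus, finitely many phases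
    and points for C^K, phi in [0, 2 pi] and finitely many integers x for l^2(Z). All kernels decay
    exponentially, so every series has a geometric majorant and the error made by periodizing is
    explicit. *)

Section Integration.
Variable R : realType.
Notation mu := (@lebesgue_measure R).
Implicit Types (f g : R -> R) (D : set R).

Lemma Rintegral_dominated_cvg (D : set R) (f_ : nat -> R -> R) (f g : R -> R) :
  measurable D -> (forall n, measurable_fun D (f_ n)) -> measurable_fun D f ->
  {ae mu, forall x, D x -> f_ n x @[n --> \oo] --> f x} ->
  mu.-integrable D (EFin \o g) ->
  (forall n x, D x -> `|f_ n x| <= g x) ->
  mu.-integrable D (EFin \o f) /\
  \int[mu]_(x in D) f_ n x @[n --> \oo] --> \int[mu]_(x in D) f x.
Proof.
move=> mD mf_ mf cvf ig fg.
have [|||| If _ cv] := @dominated_convergence _ _ R mu D mD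
    (fun n => EFin \o f_ n) (EFin \o f) (EFin \o g) _ _ _ ig.
- by move=> n; apply/measurable_EFinP; exact: mf_.
- exact/measurable_EFinP.
- move: cvf; apply: filterS; first exact: (ae_filter_ringOfSetsType mu).
  by move=> x H Dx; apply: cvg_EFin; [exact: nearW|exact: H].
- by apply: aeW => x n Dx /=; rewrite lee_fin fg.
split=> //.
apply: fine_cvg; rewrite fineK //; exact: integrable_fin_num.
Qed.

Lemma Rintegral_dominated_cvg_pt (D : set R) (f_ : nat -> R -> R) (f g : R -> R) :
  measurable D -> (forall n, measurable_fun D (f_ n)) ->
  (forall x, D x -> f_ n x @[n --> \oo] --> f x) ->
  mu.-integrable D (EFin \o g) ->
  (forall n x, D x -> `|f_ n x| <= g x) ->
  mu.-integrable D (EFin \o f) /\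
  \int[mu]_(x in D) f_ n x @[n --> \oo] --> \int[mu]_(x in D) f x.
Proof.
move=> mD mf_ cvf ig fg; apply: (@Rintegral_dominated_cvg _ _ _ g) => //.
  exact: (@measurable_fun_cvg _ _ _ _ f_).
exact: aeW.
Qed.

Definition affR (s a : R) (x : R) := s * x + a.

Lemma measurable_affR s a : measurable_fun setT (affR s a).
Proof. by apply: measurable_funD => //; exact: measurable_funM. Qed.

(** The preimage measure agrees with Lebesgue measure on half-open intervals, hence everywhere. It
    serves for translations and for the reflection. *)
Lemma lebesgue_affR s a : (forall x y, mu (affR s a @^-1` `]x, y]) = mu `]x, y]%classic) ->
  forall A, measurable A -> mu A = mu (affR s a @^-1` A).
Proof.
move=> H A mA.
have mf : measurable_fun [set: measurableTypeR R]
  (affR s a : measurableTypeR R -> measurableTypeR R) by exact: measurable_affR.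
pose nu : {measure set (measurableTypeR R) -> \bar R} :=
  measure_function_pushforward__canonical__measure_function_Measure mu mf.
by apply: (@lebesgue_measure_unique R nu _ A mA) => _ [[x y] _ <-]; rewrite /= -H.
Qed.

Lemma lebesgue_translate a (A : set R) : measurable A ->
  mu A = mu (affR 1 a @^-1` A).
Proof.
apply: lebesgue_affR => x y.
have -> : affR 1 a @^-1` `]x, y] = `]x - a, y - a]%classic.
  by apply/seteqP; split=> t /=; rewrite !in_itv /= /affR mul1r ltrBlDr lerBrDr.
rewrite !lebesgue_measure_itv /= !lte_fin ltrD2r; case: ifP => // _.
by rewrite -!EFinB; congr (_%:E); lra.
Qed.

Lemma lebesgue_reflect (A : set R) : measurable A ->
  mu A = mu (affR (-1) 0 @^-1` A).
Proof.
apply: lebesgue_affR => x y.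
have -> : affR (-1) 0 @^-1` `]x, y] = `[- y, - x[%classic.
  apply/seteqP; split=> t /=; rewrite !in_itv /= /affR; lra.
rewrite !lebesgue_measure_itv /= !lte_fin ltrN2; case: ifP => // _.
by rewrite -!EFinB; congr (_%:E); lra.
Qed.

Lemma Rintegral_affR (s a : R) D f :
  (forall A, measurable A -> mu A = mu (affR s a @^-1` A)) ->
  measurable D -> measurable_fun D f ->
  mu.-integrable (affR s a @^-1` D) (EFin \o (f \o affR s a)) ->
  mu.-integrable D (EFin \o f) /\
  \int[mu]_(x in D) f x = \int[mu]_(x in affR s a @^-1` D) f (affR s a x).
Proof.
move=> Hm mD mf fi.
(* Extension by zero reduces the claim to integrals over the whole line, where the pushforward
   formula applies. *)
pose h := f \_ D.
have mh : measurable_fun setT (EFin \o h).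
  by apply/measurable_EFinP; exact: (measurable_restrictT f mD).1.
have mpre : measurable (affR s a @^-1` D).
  by rewrite -[X in measurable X]setTI; apply: measurable_affR.
have E1 : EFin \o (h \o affR s a) = (EFin \o (f \o affR s a)) \_ (affR s a @^-1` D).
  apply/funext => x; rewrite /= /h !patchE.
  by rewrite (_ : (x \in _ @^-1` D) = (affR s a x \in D)) //; case: ifP.
have hi : mu.-integrable (affR s a @^-1` setT) (EFin \o (h \o affR s a)).
  rewrite preimage_setT E1; apply/integrable_restrict => //.
  by rewrite setTI.
have maff : measurable_fun [set: measurableTypeR R]
  (affR s a : measurableTypeR R -> measurableTypeR R) by exact: measurable_affR.
pose nu : {measure set (measurableTypeR R) -> \bar R} :=
  measure_function_pushforward__canonical__measure_function_Measure mu maff.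
have Ip : nu.-integrable setT (EFin \o h).
  exact: (@integrable_pushforward _ _ (measurableTypeR R) (measurableTypeR R)).
have Ep := @integral_pushforward _ _ (measurableTypeR R) (measurableTypeR R) R
  _ maff mu setT (EFin \o h) mh hi measurableT.
have Eh : (\int[mu]_x (EFin \o h) x = \int[mu]_x (EFin \o (h \o affR s a)) x)%E.
  rewrite preimage_setT in Ep; rewrite -[RHS]Ep.
  by apply: (eq_measure_integral nu) => A mA _; first [exact: Hm|exact/esym/Hm].
have Ih : mu.-integrable setT (EFin \o h).
  apply/integrableP; split=> //.
  move/integrableP: Ip => [_].
  by rewrite (eq_measure_integral mu) // => A mA _; first [exact: Hm|exact/esym/Hm].
split.
  have -> : D = setT `&` D by rewrite setTI.
  apply/integrable_restrict => //.
  by rewrite restrict_EFin.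
rewrite Rintegral_mkcond /Rintegral Eh E1 -integral_mkcond //.
Qed.

Lemma Rintegral_translate (a : R) D f :
  measurable D -> measurable_fun D f ->
  mu.-integrable (affR 1 a @^-1` D) (EFin \o (f \o affR 1 a)) ->
  mu.-integrable D (EFin \o f) /\
  \int[mu]_(x in D) f x = \int[mu]_(x in affR 1 a @^-1` D) f (affR 1 a x).
Proof. by apply: Rintegral_affR => A; exact: lebesgue_translate. Qed.

Lemma Rintegral_reflect D f :
  measurable D -> measurable_fun D f ->
  mu.-integrable (affR (-1) 0 @^-1` D) (EFin \o (f \o affR (-1) 0)) ->
  mu.-integrable D (EFin \o f) /\
  \int[mu]_(x in D) f x = \int[mu]_(x in affR (-1) 0 @^-1` D) f (affR (-1) 0 x).
Proof. by apply: Rintegral_affR => A; exact: lebesgue_reflect. Qed.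

(** A zero integral would force f = 0 almost everywhere on D, so that D would lie in a null set. *)
Lemma Rintegral_gt0 (D : set R) f : measurable D -> (0 < mu D)%E ->
  mu.-integrable D (EFin \o f) -> (forall x, D x -> 0 < f x) ->
  0 < \int[mu]_(x in D) f x.
Proof.
move=> mD D0 fi f0.
rewrite lt_neqAle Rintegral_ge0 ?andbT; last by move=> x Dx; exact/ltW/f0.
apply/negP => /eqP E.
have fin : (\int[mu]_(x in D) (f x)%:E \is a fin_num)%E by exact: integrable_fin_num.
have E0 : (\int[mu]_(x in D) `|(EFin \o f) x| = 0)%E.
  transitivity (\int[mu]_(x in D) (f x)%:E)%E.
    by apply: eq_integral => x /set_mem Dx /=; rewrite ger0_norm // ltW // f0.
  by rewrite -(fineK fin); congr (_%:E); exact/esym/E.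
have mf := measurable_int _ fi.
have [N [mN N0 sub]] : ae_eq mu D (EFin \o f) (cst 0%E) by exact/ae_eq_integral_abs.
suff : (mu D <= 0)%E by rewrite leNgt D0.
rewrite -N0; apply: le_measure; rewrite ?inE //.
by move=> x Dx; apply: sub => /= /(_ Dx) [] /eqP; rewrite gt_eqF // f0.
Qed.

Lemma integrable_le (D : set R) f g : measurable D -> measurable_fun D f ->
  (forall x, D x -> `|f x| <= g x) -> mu.-integrable D (EFin \o g) ->
  mu.-integrable D (EFin \o f).
Proof.
move=> mD mf fg; apply: le_integrable => //; first exact/measurable_EFinP.
by move=> x Dx /=; rewrite lee_fin (le_trans (fg _ Dx)) // ler_norm.
Qed.

Lemma integrable_measurable (D : set R) f :
  mu.-integrable D (EFin \o f) -> measurable_fun D f.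
Proof. by move=> fi; apply/measurable_EFinP; exact: measurable_int fi. Qed.

Lemma integrable_scale (D : set R) c f : measurable D ->
  mu.-integrable D (EFin \o f) -> mu.-integrable D (EFin \o (fun x => c * f x)).
Proof. by move=> mD fi; exact: (@integrableZl _ _ _ mu D _ c (EFin \o f)). Qed.

Lemma integrable_add (D : set R) f g : measurable D ->
  mu.-integrable D (EFin \o f) -> mu.-integrable D (EFin \o g) ->
  mu.-integrable D (EFin \o (fun x => f x + g x)).
Proof. by move=> mD fi gi; exact: (@integrableD _ _ _ mu D _ (EFin \o f) (EFin \o g)). Qed.

Lemma integrable_sub (D : set R) f g : measurable D ->
  mu.-integrable D (EFin \o f) -> mu.-integrable D (EFin \o g) ->
  mu.-integrable D (EFin \o (fun x => f x - g x)).
Proof. by move=> mD fi gi; exact: (@integrableB _ _ _ mu D _ (EFin \o f) (EFin \o g)). Qed.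

Lemma integrable_mul_bounded (D : set R) f g (B : R) : measurable D ->
  mu.-integrable D (EFin \o f) -> measurable_fun D g -> (forall x, D x -> `|g x| <= B) ->
  mu.-integrable D (EFin \o (fun x => f x * g x)).
Proof.
move=> mD fi mg gB; apply: (integrable_le _ _ (fun x => B * `|f x|)) => //.
- by apply: measurable_funM => //; exact: integrable_measurable.
- by move=> x Dx; rewrite normrM mulrC ler_wpM2r // gB.
- by apply: integrable_scale => //; exact: integrable_norm.
Qed.

Lemma measurable_continuous (D : set R) f : measurable D -> continuous f -> measurable_fun D f.
Proof. by move=> mD /continuous_measurable_fun H; exact: measurable_funTS. Qed.

Lemma Rintegral_indic (D A : set R) f : measurable A ->
  \int[mu]_(x in D) (f x * \1_A x) = \int[mu]_(x in D `&` A) f x.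
Proof.
move=> mA; rewrite Rintegral_mkcondr; apply: eq_Rintegral => x _.
by rewrite patchE indicE; case: ifP; rewrite ?mulr1 ?mulr0.
Qed.

End Integration.

(** * Bilateral sums of exponentially decaying sequences *)

Section ZSum.
Variable R : realType.
Implicit Types (u v : int -> R) (A r : R).

Definition zpart u (N : nat) : R := \sum_(i < (2 * N).+1) u (i%:Z - N%:Z).
Definition zs u : R := limn (zpart u).
(** One geometric majorant serves convergence, tail estimates and the interchange of sums with
    integrals. *)
Definition expb A r u := forall k : int, `|u k| <= A * r ^+ `|k|%N.

Lemma cvg_norm_le (w : nat -> R) l M : w n @[n --> \oo] --> l ->
  (forall n, `|w n| <= M) -> `|l| <= M.
Proof.
move=> Hw H; have Hc : cvgn w by apply/cvg_ex; exists l.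
rewrite -(cvg_lim _ Hw) // ler_norml; apply/andP; split.
  by apply: limr_ge => //; apply: nearW => N; have := H N; rewrite ler_norml => /andP[].
by apply: limr_le => //; apply: nearW => N; have := H N; rewrite ler_norml => /andP[].
Qed.

Lemma zpart0 u : zpart u 0 = u 0.
Proof. by rewrite /zpart big_ord_recl big_ord0 addr0. Qed.

Lemma zpartS u N : zpart u N.+1 = zpart u N + (u N.+1%:Z + u (- N.+1%:Z)).
Proof.
rewrite /zpart (_ : (2 * N.+1).+1 = (2 * N).+3)%N; last by lia.
rewrite big_ord_recr big_ord_recl /=.
have -> : ((2 * N).+2%:Z - N.+1%:Z = N.+1%:Z)%R by lia.
rewrite (eq_bigr (fun i : 'I_(2 * N).+1 => u (i%:Z - N%:Z))); last first.
  by move=> i _; congr u; rewrite /bump /=; lia.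
have -> : (0%:Z - N.+1%:Z = - N.+1%:Z)%R by lia.
ring.
Qed.

Lemma expb_ge0 A r u : expb A r u -> 0 <= A.
Proof. by move/(_ 0); rewrite absz0 expr0 mulr1; apply: le_trans. Qed.

Lemma zpart_series u : zpart u = fun N => u 0 + series (fun n => u n.+1%:Z + u (- n.+1%:Z)) N.
Proof.
apply/funext; elim=> [|N IH]; first by rewrite zpart0 seriesEnat /= big_geq // addr0.
by rewrite zpartS IH !seriesEnat /= big_nat_recr /= ?addrA.
Qed.

Lemma expb_cvg A r u : 0 <= r < 1 -> expb A r u -> cvgn (zpart u).
Proof.
move=> /andP[r0 r1] Hu; rewrite zpart_series.
apply: is_cvgD; first exact: is_cvg_cst.
apply: normed_cvg.
apply: (@series_le_cvg _ _ (fun n => geometric (2 * A * r) r n)).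
- by move=> n; exact: normr_ge0.
- move=> n; rewrite /geometric /= mulr_ge0 ?exprn_ge0 ?mulr_ge0 //.
  exact: (expb_ge0 _ _ _ Hu).
- move=> n; rewrite /geometric /= (le_trans (ler_normD _ _)) //.
  have := Hu n.+1%:Z; have := Hu (- n.+1%:Z); rewrite abszN absz_nat exprS.
  lra.
- by apply: is_cvg_geometric_series; rewrite ger0_norm.
Qed.

Lemma zs_cvg A r u : 0 <= r < 1 -> expb A r u -> zpart u N @[N --> \oo] --> zs u.
Proof. by move=> Hr /(expb_cvg _ _ _ Hr). Qed.

(** Each new pair of terms is at most 2 A r^(N + p). The factor 1 - r^p makes the induction on p
    close; bounding it by 1 gives [zs_tail]. *)
Lemma zpart_tail A r u N p : 0 <= r < 1 -> expb A r u ->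
  `|zpart u (N + p) - zpart u N| <= 2 * A * r ^+ N * (1 - r ^+ p) / (1 - r).
Proof.
move=> /andP[r0 r1] Hu; have A0 := expb_ge0 _ _ _ Hu.
have r1' : 1 - r != 0 by lra.
elim: p => [|p IH]; first by rewrite addn0 subrr normr0 expr0 subrr mulr0 mul0r.
rewrite addnS zpartS addrAC (le_trans (ler_normD _ _)) //.
rewrite (_ : 2 * A * r ^+ N * (1 - r ^+ p.+1) / (1 - r) =
   2 * A * r ^+ N * (1 - r ^+ p) / (1 - r) + 2 * A * r ^+ (N + p)); last first.
  by rewrite exprS exprD; field.
apply: lerD => //; rewrite (le_trans (ler_normD _ _)) //.
have := Hu (N + p).+1%:Z; have := Hu (- (N + p).+1%:Z).
rewrite abszN absz_nat => H1 H2.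
have : A * r ^+ (N + p).+1 <= A * r ^+ (N + p).
  by rewrite ler_wpM2l // exprS ler_piMl ?exprn_ge0 // ltW.
lra.
Qed.

Lemma zpart_bound A r u N : 0 <= r < 1 -> expb A r u -> `|zpart u N| <= 3 * A / (1 - r).
Proof.
move=> Hr Hu; have A0 := expb_ge0 _ _ _ Hu; have /andP[r0 r1] := Hr.
have := @zpart_tail _ _ _ 0 N Hr Hu; rewrite add0n zpart0 expr0 mulr1 => H.
have H0 := Hu 0; rewrite absz0 expr0 mulr1 in H0.
rewrite (_ : zpart u N = (zpart u N - u 0) + u 0); last by ring.
(* The central term contributes A and the two-sided tail from 0 at most 2 A / (1 - r), whence the
   constant 3. *)
rewrite (le_trans (ler_normD _ _)) // (le_trans (lerD H H0)) //.
rewrite ler_pdivlMr ?subr_gt0 // mulrDl divfK; last by lra.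
have := @exprn_ge0 _ N _ r0; nra.
Qed.

Lemma zs_bound A r u : 0 <= r < 1 -> expb A r u -> `|zs u| <= 3 * A / (1 - r).
Proof.
move=> Hr Hu; apply: cvg_norm_le (zs_cvg _ _ _ Hr Hu) _ => N.
exact: zpart_bound.
Qed.

Lemma zs_tail A r u N : 0 <= r < 1 -> expb A r u ->
  `|zs u - zpart u N| <= 2 * A * r ^+ N / (1 - r).
Proof.
move=> Hr Hu; have /andP[r0 r1] := Hr.
have A0 := expb_ge0 _ _ _ Hu.
have H p : `|zpart u (N + p) - zpart u N| <= 2 * A * r ^+ N / (1 - r).
  apply: le_trans (zpart_tail _ _ _ _ _ Hr Hu) _.
  rewrite ler_pM2r ?invr_gt0 ?subr_gt0 // ler_piMr ?mulr_ge0 ?exprn_ge0 //.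
  by rewrite gerBl exprn_ge0.
have Hc : zpart u (N + p) - zpart u N @[p --> \oo] --> zs u - zpart u N.
  apply: cvgB; last exact: cvg_cst.
  under eq_fun do rewrite addnC.
  by have := zs_cvg _ _ _ Hr Hu; rewrite -(cvg_shiftn N).
exact: cvg_norm_le Hc H.
Qed.

Lemma expb_cvg0 A r u : 0 <= r < 1 -> expb A r u ->
  forall (f : nat -> int), (forall n, (n <= `|f n|)%N) -> u (f n) @[n --> \oo] --> (0 : R).
Proof.
move=> /andP[r0 r1] Hu f Hf; have A0 := expb_ge0 _ _ _ Hu.
apply: norm_cvg0.
apply: (@squeeze_cvgr _ _ _ _ (fun=> 0) (fun n => A * r ^+ n)).
- apply: nearW => n; rewrite normr_ge0 /= (le_trans (Hu _)) //.
  by rewrite ler_wpM2l // ler_wiXn2l // ltW.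
- exact: cvg_cst.
- rewrite -[X in _ --> X](mulr0 A); apply: cvgM; first exact: cvg_cst.
  by apply: cvg_expr; rewrite ger0_norm.
Qed.

Lemma expbZ A r u c : expb A r u -> expb (`|c| * A) r (fun k => c * u k).
Proof. by move=> Hu k; rewrite normrM -mulrA ler_wpM2l. Qed.

Lemma expbM A r u v : expb A r u -> (forall k, `|v k| <= 1) -> expb A r (fun k => u k * v k).
Proof. by move=> Hu Hv k; rewrite normrM (le_trans _ (Hu k)) // ler_piMr. Qed.

Lemma zsD A B r u v : 0 <= r < 1 -> expb A r u -> expb B r v ->
  zs (u \+ v) = zs u + zs v.
Proof.
move=> Hr Hu Hv; apply/cvg_lim => //.
have -> : zpart (u \+ v) = zpart u \+ zpart v.
  by apply/funext => N; rewrite /zpart big_split.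
by apply: cvgD; [exact: zs_cvg Hr Hu|exact: zs_cvg Hr Hv].
Qed.

Lemma zsZ A r u c : 0 <= r < 1 -> expb A r u -> zs (fun k => c * u k) = c * zs u.
Proof.
move=> Hr Hu; apply/cvg_lim => //.
have -> : zpart (fun k => c * u k) = (fun N => c * zpart u N).
  by apply/funext => N; rewrite /zpart mulr_sumr.
by apply: cvgM; [exact: cvg_cst|exact: zs_cvg Hr Hu].
Qed.

Lemma eq_zs u v : u =1 v -> zs u = zs v.
Proof. by move=> /funext ->. Qed.

Lemma zs_single (j : int) c : zs (fun k => if k == j then c else 0) = c.
Proof.
apply/cvg_lim => //.
suff H N : (`|j| <= N)%N -> zpart (fun k => if k == j then c else 0) N = c.
  by apply: cvg_near_cst; exists `|j|%N => // N /= /H.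
move=> jN; rewrite /zpart.
have Hi : (`|(j + N%:Z)%R| < (2 * N).+1)%N by lia.
rewrite (bigD1 (Ordinal Hi)) //= big1 ?addr0 ?ifT //; first by apply/eqP; lia.
move=> i; rewrite -val_eqE /= => Hne; rewrite ifF //.
by apply/negbTE; move: Hne; apply: contra => /eqP <-; apply/eqP; lia.
Qed.

Lemma zpart_shift u N : zpart (fun k => u (k + 1)) N = zpart u N + u (N%:Z + 1) - u (- N%:Z).
Proof.
elim: N => [|N IH]; first by rewrite !zpart0 !add0r oppr0 addrAC subrr add0r.
rewrite !zpartS IH.
have -> : (N.+1%:Z = N%:Z + 1)%R by lia.
have -> : (- (N%:Z + 1) + 1 = - N%:Z)%R by lia.
ring.
Qed.

(** A shift changes the symmetric partial sum only by two end terms, which tend to 0. *)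
Lemma zs_shift1 A r u : 0 <= r < 1 -> expb A r u -> zs (fun k => u (k + 1)) = zs u.
Proof.
move=> Hr Hu; apply/cvg_lim => //.
rewrite -[X in _ --> X]addr0 -[X in _ --> X]subr0.
rewrite (funext (zpart_shift u)).
apply: cvgB; last by apply: expb_cvg0 Hr Hu _ _ => n; rewrite abszN absz_nat.
apply: cvgD; first exact: zs_cvg Hr Hu.
by apply: expb_cvg0 Hr Hu _ _ => n; lia.
Qed.

Lemma zs_reflect u : zs (fun k => u (- k)) = zs u.
Proof.
congr (limn _); apply/funext; elim=> [|N IH]; first by rewrite !zpart0 oppr0.
by rewrite !zpartS IH opprK [X in _ + X]addrC.
Qed.

Lemma cvg_bigsum (I : Type) (s : seq I) (F : I -> nat -> R) (l : I -> R) :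
  (forall i, F i n @[n --> \oo] --> l i) ->
  \sum_(i <- s) F i n @[n --> \oo] --> \sum_(i <- s) l i.
Proof.
move=> H; elim: s => [|i s IH].
  by rewrite big_nil; under eq_fun do rewrite big_nil; exact: cvg_cst.
by rewrite big_cons; under eq_fun do rewrite big_cons; exact: cvgD.
Qed.

Lemma sum_nat_shift (a b : nat) (F : nat -> R) :
  \sum_(a <= i < a + b) F i = \sum_(j < b) F (a + j)%N.
Proof.
by rewrite -{1}[a]add0n big_addn addKn big_mkord; apply: eq_bigr => j _; rewrite addnC.
Qed.

Lemma zs_regroup A r u n : (0 < n)%N -> 0 <= r < 1 -> expb A r u ->
  zs (fun k => \sum_(j < n) u (k * n%:Z + j%:Z)) = zs u.
Proof.
move=> n0 Hr Hu; apply/cvg_lim => //.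
(* The blocks -N, ..., N cover the indices from -N n to N n + n - 1: the symmetric window of radius
   N n and n - 1 further terms, which vanish in the limit. *)
have E N : zpart (fun k => \sum_(j < n) u (k * n%:Z + j%:Z)) N =
   zpart u (N * n) + \sum_(j < n.-1) u ((N * n)%:Z + j.+1%:Z).
  rewrite /zpart.
  transitivity (\sum_(0 <= i < (2 * N).+1 * n) u (i%:Z - (N * n)%:Z)).
    rewrite big_nat_mul big_mkord; apply: eq_bigr => i _.
    rewrite [(i.+1 * n)%N]mulSn [(n + _)%N]addnC sum_nat_shift.
    by apply: eq_bigr => j _; congr u; lia.
  have -> : ((2 * N).+1 * n = (2 * (N * n)).+1 + n.-1)%N by nia.
  rewrite (@big_cat_nat _ _ _ (2 * (N * n)).+1) //= ?leq_addr //.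
  rewrite big_mkord; congr (_ + _).
  by rewrite sum_nat_shift; apply: eq_bigr => j _; congr u; lia.
rewrite (funext E).
rewrite -[X in _ --> X]addr0; apply: cvgD.
  have H : (N * n)%N @[N --> \oo] --> \oo.
    apply/cvgnyPge => M; exists M => // N /= MN.
    by rewrite (leq_trans MN) // leq_pmulr.
  exact: (cvg_comp _ _ H (zs_cvg _ _ _ Hr Hu)).
rewrite [X in _ --> X](_ : _ = \sum_(j < n.-1) 0); last by rewrite big1.
apply: cvg_bigsum => j; apply: expb_cvg0 Hr Hu _ _ => N.
nia.
Qed.

Lemma expb_shift A r u j : 0 < r < 1 -> expb A r u -> expb (A * r ^- `|j|) r (fun k => u (k + j)).
Proof.
move=> /andP[r0 r1] Hu k; have A0 := expb_ge0 _ _ _ Hu.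
apply: le_trans (Hu _) _; rewrite -mulrA ler_wpM2l //.
rewrite [leRHS]mulrC ler_pdivlMr ?exprn_gt0 // -exprD ler_wiXn2l ?ltW //.
lia.
Qed.

Lemma zs_shift A r u (j : int) : 0 < r < 1 -> expb A r u -> zs (fun k => u (k + j)) = zs u.
Proof.
move=> Hr Hu; have Hr' : 0 <= r < 1 by lra.
have H (n : nat) B v : expb B r v -> zs (fun k => v (k + n%:Z)) = zs v.
  elim: n B v => [|n IH] B v Hv; first by apply: eq_zs => k; rewrite addr0.
  rewrite -(IH _ _ Hv) -(@zs_shift1 _ _ (fun k => v (k + n%:Z)) Hr' (expb_shift _ _ _ _ Hr Hv)).
  by apply: eq_zs => k; congr v; lia.
case: (intP j) => [|n|n]; first by apply: eq_zs => k; rewrite addr0.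
  exact: H Hu.
rewrite -[RHS](_ : zs (fun k => u ((k + n.+1%:Z) + - n.+1%:Z)) = _); last first.
  by apply: eq_zs => k; congr u; lia.
by rewrite (H _ _ (fun k => u (k - n.+1%:Z)) (expb_shift _ _ _ _ Hr Hu)).
Qed.

End ZSum.
Arguments zpart {R}. Arguments zs {R}. Arguments expb {R}.

(** * Uniqueness of the Fourier transform *)

Section Cutoff.
Variable R : realType.

(* These polynomials converge pointwise on [0, 1] to the indicator of [0, 1/2[; the
   factor n in the exponent makes the value at 1/2, about e^-n, tend to 0. *)
Definition cutoff (n : nat) (t : R) : R := (1 - t ^+ n) ^+ (n * 2 ^ n).

Lemma cutoff_itv n t : 0 <= t <= 1 -> 0 <= cutoff n t <= 1.
Proof.
move=> /andP[t0 t1].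
have H : 0 <= 1 - t ^+ n <= 1.
  have := exprn_ge0 n t0; have := exprn_ile1 n t0 t1; lra.
by rewrite /cutoff exprn_ge0 ?exprn_ile1 //; case/andP: H.
Qed.

Lemma bernoulli_ge (x : R) n : 0 <= x -> 1 + n%:R * x <= (1 + x) ^+ n.
Proof.
move=> x0; elim: n => [|n IH]; first by rewrite mul0r addr0 expr0.
rewrite exprS -[n.+1]addn1 natrD; have := ler0n R n; nra.
Qed.

Lemma bernoulli_le (x : R) n : 0 <= x <= 1 -> 1 - n%:R * x <= (1 - x) ^+ n.
Proof.
move=> /andP[x0 x1]; elim: n => [|n IH]; first by rewrite mul0r subr0 expr0.
have [H|H] := leP 0 (1 - n%:R * x).
  rewrite exprS -[n.+1]addn1 natrD; have := ler0n R n; nra.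
have : 0 <= (1 - x) ^+ n.+1 by rewrite exprn_ge0 // subr_ge0.
by rewrite -[n.+1]addn1 natrD; lra.
Qed.

(** With x = y^2, n y^n is at most 1 + y + ... + y^(n - 1) <= 1 / (1 - y), so n x^n <= y^n / (1 -
    y). *)
Lemma cvg_natexp (x : R) : 0 <= x < 1 -> n%:R * x ^+ n @[n --> \oo] --> (0 : R).
Proof.
move=> /andP[x0 x1]; pose y := Num.sqrt x.
have y0 : 0 <= y by exact: sqrtr_ge0.
have yx : y ^+ 2 = x by rewrite sqr_sqrtr.
have y1 : y < 1 by nra.
have H n : n%:R * y ^+ n <= (1 - y)^-1.
  have : n%:R * y ^+ n <= (1 - y ^+ n) / (1 - y).
    elim: n => [|n IH]; first by rewrite mul0r expr0 subrr mul0r.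
    rewrite ler_pdivlMr ?subr_gt0 // in IH; rewrite ler_pdivlMr ?subr_gt0 //.
    have p0 := exprn_ge0 n y0; have p1 := exprn_ile1 n y0 (ltW y1).
    rewrite exprS -[n.+1]addn1 natrD.
    have := ler_wpM2l y0 IH.
    have : 0 <= (1 - y) * (1 - y * y ^+ n).
      by apply: mulr_ge0; rewrite subr_ge0; [exact: ltW|apply: mulr_ile1 => //; exact: ltW].
    lra.
  move/le_trans; apply; apply: ler_piMl; first by rewrite invr_ge0 subr_ge0 ltW.
  by have := exprn_ge0 n y0; lra.
apply: (@squeeze_cvgr _ _ _ _ (fun=> 0) (fun n => (1 - y)^-1 * y ^+ n)).
- apply: nearW => n; rewrite mulr_ge0 ?exprn_ge0 //= -yx -exprM mulnC exprM expr2 mulrA.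
  by rewrite ler_wpM2r ?exprn_ge0.
- exact: cvg_cst.
- rewrite -[X in _ --> X](mulr0 (1 - y)^-1); apply: cvgM; first exact: cvg_cst.
  by apply: cvg_expr; rewrite ger0_norm.
Qed.

(** For t < 1/2 Bernoulli bounds the value below by 1 - n (2 t)^n. For t >= 1/2 and s = t^n, (1 -
    s)(1 + s) <= 1, and (1 + s)^(n 2^n) >= 1 + n 2^n s >= 1 + n, so the value is at most 1 / (n +
    1). *)
Lemma cutoff_cvg t : 0 <= t <= 1 ->
  cutoff n t @[n --> \oo] --> (if t < 2^-1 then 1 else 0 : R).
Proof.
move=> Ht; have /andP[t0 t1] := Ht; case: ifPn => [lt|]; last rewrite -leNgt => ge.
- apply: (@squeeze_cvgr _ _ _ _ (fun n => 1 - n%:R * (2 * t) ^+ n) (fun=> 1)).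
  + apply: nearW => n; have /andP[_ ->] := cutoff_itv n _ Ht; rewrite andbT.
    apply: le_trans (bernoulli_le _ _ _); last by rewrite exprn_ge0 ?exprn_ile1.
    by rewrite natrM natrX exprMn mulrA.
  + rewrite -[X in _ --> X]subr0; apply: cvgB; first exact: cvg_cst.
    by apply: cvg_natexp; lra.
  + exact: cvg_cst.
- apply: (@squeeze_cvgr _ _ _ _ (fun=> 0) (fun n => n.+1%:R^-1)).
  + apply: nearW => n; have /andP[-> _] := cutoff_itv n _ Ht => /=.
    have tn0 := exprn_ge0 n t0; have tn1 := exprn_ile1 n t0 t1.
    have P : 0 < (1 + t ^+ n) ^+ (n * 2 ^ n) by apply: exprn_gt0; lra.
    have A1 : cutoff n t * (1 + t ^+ n) ^+ (n * 2 ^ n) <= 1.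
      by rewrite /cutoff -exprMn; apply: exprn_ile1; nra.
    have A2 : n.+1%:R <= (1 + t ^+ n) ^+ (n * 2 ^ n).
      apply: le_trans (bernoulli_ge _ _ tn0).
      rewrite natrM natrX -mulrA -exprMn -[n.+1]addn1 natrD addrC lerD2l.
      rewrite ler_peMr // exprn_ege1 //; lra.
    rewrite -[leRHS]mul1r ler_pdivlMr // (le_trans _ A1) // ler_wpM2l //.
    by have /andP[] := cutoff_itv n _ Ht.
  + exact: cvg_cst.
  + exact: cvg_harmonic.
Qed.

End Cutoff.
Arguments cutoff {R}.

Section Trig.
Variable R : realType.

(** Sums and multiples generate the class, so that linear statements, such as the vanishing of an
    integral, follow by induction; products are covered by [trigM]. *)
Inductive trig (w : R) : (R -> R) -> Prop :=
| trig_cos (k : int) : trig w (fun x => cos (k%:~R * w * x))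
| trig_sin (k : int) : trig w (fun x => sin (k%:~R * w * x))
| trig_add f g : trig w f -> trig w g -> trig w (fun x => f x + g x)
| trig_scale c f : trig w f -> trig w (fun x => c * f x).

Lemma trig_ext w f g : f =1 g -> trig w f -> trig w g.
Proof. by move=> /funext ->. Qed.

Lemma trig_cst w c : trig w (fun=> c).
Proof.
apply: trig_ext (trig_scale _ c _ (trig_cos w 0)) => x.
by rewrite mul0r mul0r cos0 mulr1.
Qed.

Lemma trigB w f g : trig w f -> trig w g -> trig w (fun x => f x - g x).
Proof.
move=> Hf Hg; apply: trig_ext (trig_add _ _ _ Hf (trig_scale _ (-1) _ Hg)) => x.
by rewrite mulN1r.
Qed.

Lemma trigM w f g : trig w f -> trig w g -> trig w (fun x => f x * g x).
Proof.
have half F1 F2 : trig w F1 -> trig w F2 -> trig w (fun x => 2^-1 * (F1 x + F2 x)).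
  by move=> H1 H2; apply: trig_scale; exact: trig_add.
have halfB F1 F2 : trig w F1 -> trig w F2 -> trig w (fun x => 2^-1 * (F1 x - F2 x)).
  by move=> H1 H2; apply: trig_scale; exact: trigB.
move=> Hf; elim: Hf g => {f} [k|k|f1 f2 _ IH1 _ IH2|c f _ IH] g Hg.
- elim: Hg => {g} [l|l|g1 g2 _ IH1 _ IH2|c g _ IH].
  + apply: trig_ext (half _ _ (trig_cos w (k - l)) (trig_cos w (k + l))) => x.
    by rewrite rmorphB rmorphD /= !mulrBl !mulrDl cosB cosD; field.
  + apply: trig_ext (halfB _ _ (trig_sin w (k + l)) (trig_sin w (k - l))) => x.
    by rewrite rmorphB rmorphD /= !mulrBl !mulrDl sinB sinD; field.
  + by apply: trig_ext (trig_add _ _ _ IH1 IH2) => x; rewrite mulrDr.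
  + by apply: trig_ext (trig_scale _ c _ IH) => x; rewrite mulrCA.
- elim: Hg => {g} [l|l|g1 g2 _ IH1 _ IH2|c g _ IH].
  + apply: trig_ext (half _ _ (trig_sin w (k - l)) (trig_sin w (k + l))) => x.
    by rewrite rmorphB rmorphD /= !mulrBl !mulrDl sinB sinD; field.
  + apply: trig_ext (halfB _ _ (trig_cos w (k - l)) (trig_cos w (k + l))) => x.
    by rewrite rmorphB rmorphD /= !mulrBl !mulrDl cosB cosD; field.
  + by apply: trig_ext (trig_add _ _ _ IH1 IH2) => x; rewrite mulrDr.
  + by apply: trig_ext (trig_scale _ c _ IH) => x; rewrite mulrCA.
- by apply: trig_ext (trig_add _ _ _ (IH1 _ Hg) (IH2 _ Hg)) => x; rewrite mulrDl.
- by apply: trig_ext (trig_scale _ c _ (IH _ Hg)) => x; rewrite mulrA.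
Qed.

Lemma trigX w f n : trig w f -> trig w (fun x => f x ^+ n).
Proof.
move=> Hf; elim: n => [|n IH]; first exact: trig_cst.
by apply: trig_ext (trigM _ _ _ Hf IH) => x; rewrite exprS.
Qed.

Lemma trig_continuous w f : trig w f -> continuous f.
Proof.
elim=> {f} [k|k|f g _ Hf _ Hg|c f _ Hf] x.
- apply: (@continuous_comp _ _ _ (fun x => k%:~R * w * x) cos).
    by apply: cvgM; [exact: cvg_cst|exact: cvg_id].
  exact: continuous_cos.
- apply: (@continuous_comp _ _ _ (fun x => k%:~R * w * x) sin).
    by apply: cvgM; [exact: cvg_cst|exact: cvg_id].
  exact: continuous_sin.
- by apply: cvgD; [exact: Hf|exact: Hg].
- by apply: cvgM; [exact: cvg_cst|exact: Hf].
Qed.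

Lemma trig_bounded w f : trig w f -> exists B, forall x, `|f x| <= B.
Proof.
elim=> {f} [k|k|f g _ [A Hf] _ [B Hg]|c f _ [A Hf]].
- by exists 1 => x; exact: cos_max.
- by exists 1 => x; exact: sin_max.
- by exists (A + B) => x; rewrite (le_trans (ler_normD _ _)) // lerD.
- by exists (`|c| * A) => x; rewrite normrM ler_wpM2l.
Qed.

(** For w > 0 and 0 <= w d <= pi this is the open interval of radius d around a, repeated with
    period 2 pi / w. *)
Definition arc (w a d : R) : set R := [set x | cos (w * d) < cos (w * (x - a))].

(** The division by 4 keeps the argument of [cutoff] in [0, 1]; it is below 1/2 exactly on the
    arc. *)
Definition arc_approx (w a d : R) (n : nat) (x : R) :=
  cutoff n (2^-1 + (cos (w * d) - cos (w * (x - a))) / 4).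

Lemma trig_arc_approx w a d n : trig w (arc_approx w a d n).
Proof.
apply: trigX; apply: trigB; first exact: trig_cst.
apply: trigX; apply: trig_add; first exact: trig_cst.
apply: trig_ext (trig_scale _ (4^-1) _ (trigB _ _ _ (trig_cst w (cos (w * d)))
  (trig_add _ _ _ (trig_scale _ (cos (w * a)) _ (trig_cos w 1))
                  (trig_scale _ (sin (w * a)) _ (trig_sin w 1))))) => x.
by rewrite [w * (x - a)]mulrBr cosB mulr1z !mul1r; field.
Qed.

Let arc_arg_itv w a d (x : R) : 0 <= 2^-1 + (cos (w * d) - cos (w * (x - a))) / 4 <= 1.
Proof.
have := cos_le1 (w * d); have := cos_geN1 (w * d).
have := cos_le1 (w * (x - a)); have := cos_geN1 (w * (x - a)); lra.
Qed.

Lemma arc_approx_itv w a d n x : 0 <= arc_approx w a d n x <= 1.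
Proof. by apply: cutoff_itv; exact: arc_arg_itv. Qed.

Lemma arc_approx_cvg w a d x : arc_approx w a d n x @[n --> \oo] --> (\1_(arc w a d) x : R).
Proof.
have := cutoff_cvg _ _ (arc_arg_itv w a d x).
rewrite indicE /arc; case: ifPn => H.
  by rewrite mem_set //=; lra.
by rewrite memNset //= => H'; move: H; lra.
Qed.

Lemma measurable_arc w a d : measurable (arc w a d).
Proof.
rewrite (_ : arc w a d = setT `&` (fun x => cos (w * (x - a))) @^-1` `]cos (w * d), +oo[); last first.
  by apply/seteqP; split=> x /=; rewrite in_itv /= andbT; [|case].
have : continuous (fun x : R => cos (w * (x - a))).
  move=> x; apply: (@continuous_comp _ _ _ (fun x => w * (x - a)) cos).
    apply: cvgM; first exact: cvg_cst.
    by apply: cvgB; [exact: cvg_id|exact: cvg_cst].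
  exact: continuous_cos.
move=> /continuous_measurable_fun H; exact: H.
Qed.

End Trig.
Arguments trig {R}. Arguments arc {R}. Arguments arc_approx {R}.

Section Uniqueness.
Variable R : realType.
Notation mu := (@lebesgue_measure R).

(** The integral of f vanishes against all trigonometric polynomials, hence by dominated convergence
    over every periodic family of arcs; letting the period grow leaves a single interval. A
    continuous function with zero integral over every interval is 0. *)
Lemma fourier_uniqueness (f : R -> R) : continuous f -> mu.-integrable setT (EFin \o f) ->
  (forall w, \int[mu]_x (f x * cos (w * x)) = 0) ->
  (forall w, \int[mu]_x (f x * sin (w * x)) = 0) -> forall x, f x = 0.
Proof.
move=> cf fi fc fs.
have Hb w p : trig w p -> mu.-integrable setT (EFin \o (fun x => f x * p x)).
  move=> tp; have [B HB] := trig_bounded _ _ _ tp.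
  apply: (integrable_mul_bounded R _ _ _ B) => //.
  by apply: measurable_continuous => //; exact: trig_continuous tp.
have Ht w p : trig w p -> \int[mu]_x (f x * p x) = 0.
  elim=> {p} [k|k|p q tp Hp tq Hq|c p tp Hp].
  - exact: fc.
  - exact: fs.
  - under eq_Rintegral do rewrite mulrDr.
    by rewrite RintegralD ?Hp ?Hq ?addr0 //; [exact: Hb tp|exact: Hb tq].
  - under eq_Rintegral do rewrite mulrCA.
    by rewrite RintegralZl ?Hp ?mulr0 //; exact: Hb tp.
have Harc w a d : \int[mu]_(x in setT) (f x * \1_(arc w a d) x) = 0.
  have [||||_ cv] := @Rintegral_dominated_cvg_pt R setT
    (fun n x => f x * arc_approx w a d n x) (fun x => f x * \1_(arc w a d) x)
    (fun x => `|f x|) measurableT.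
  - move=> n; apply: measurable_funM; first exact: measurable_continuous.
    by apply: measurable_continuous => //; exact: trig_continuous (trig_arc_approx _ _ _ _ _).
  - by move=> x _; apply: cvgM; [exact: cvg_cst|exact: arc_approx_cvg].
  - by apply: integrable_norm.
  - move=> n x _; rewrite normrM ler_piMr //.
    have /andP[H0 H1] := arc_approx_itv R w a d n x.
    by rewrite ger0_norm.
  rewrite -(cvg_lim _ cv) //; apply/cvg_lim => //.
  under eq_fun do rewrite (Ht _ _ (trig_arc_approx _ w a d _)).
  exact: cvg_cst.
have Hitv a d : 0 < d -> \int[mu]_(x in `]a - d, a + d[) f x = 0.
  (* The period is 2 (n + 1). Once n exceeds d and |x - a|, the point x lies in the arc if and only
     if |x - a| < d. *)
  move=> d0; pose w (n : nat) : R := pi / n.+1%:R.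
  have mI : measurable `]a - d, a + d[%classic by exact: measurable_itv.
  have [||||_ cv] := @Rintegral_dominated_cvg_pt R setT
    (fun n x => f x * \1_(arc (w n) a d) x) (fun x => f x * \1_(`]a - d, a + d[%classic) x)
    (fun x => `|f x|) measurableT.
  - move=> n; apply: measurable_funM; first exact: measurable_continuous.
    by apply: measurable_indic; exact: measurable_arc.
  - move=> x _; apply: cvgM; first exact: cvg_cst.
    apply: cvg_near_cst; near=> n.
    have n0 : 0 < n.+1%:R :> R by rewrite ltr0n.
    have w0 : 0 < w n by rewrite divr_gt0 // pi_gt0.
    have wd : w n * d <= pi.
      rewrite /w -mulrA ler_piMr ?pi_ge0 // mulrC ler_pdivrMr // mul1r.
      apply: (@le_trans _ _ n%:R); last by rewrite ler_nat.
      by near: n; exact: nbhs_infty_ger.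
    have wx : w n * `|x - a| <= pi.
      rewrite /w -mulrA ler_piMr ?pi_ge0 // mulrC ler_pdivrMr // mul1r.
      apply: (@le_trans _ _ n%:R); last by rewrite ler_nat.
      by near: n; exact: nbhs_infty_ger.
    have E : (cos (w n * d) < cos (w n * (x - a))) = (`|x - a| < d).
      rewrite -[cos (w n * (x - a))]cos_norm normrM (gtr0_norm w0).
      by rewrite ltr_cos ?ltr_pM2l // in_itv /= ?wd ?wx mulr_ge0 // ltW.
    rewrite !indicE; congr ((nat_of_bool _)%:R).
    apply/idP/idP => /set_mem /= H; apply/mem_set => /=; move: H;
      rewrite /arc /= E in_itv /= ltr_norml; lra.
  - by apply: integrable_norm.
  - move=> n x _; rewrite normrM ler_piMr // indicE.
    by case: (_ \in _); rewrite ?normr1 ?normr0.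
  rewrite -[X in \int[mu]_(x in X) _]setTI -Rintegral_indic //.
  rewrite -(cvg_lim _ cv) //; apply/cvg_lim => //.
  under eq_fun do rewrite Harc.
  exact: cvg_cst.
have Hpos (g : R -> R) : continuous g -> mu.-integrable setT (EFin \o g) ->
    (forall a d, 0 < d -> \int[mu]_(x in `]a - d, a + d[) g x = 0) -> forall x, ~ 0 < g x.
  move=> cg gi gI x gx.
  have /cvgrPdist_lt /(_ _ gx) [d /= d0 Hd] := cg x.
  have := gI x d d0; apply/eqP; rewrite gt_eqF //.
  apply: Rintegral_gt0.
  - exact: measurable_itv.
  - by rewrite lebesgue_measure_itv /= lte_fin ifT ?lte_fin; lra.
  - by apply: integrableS gi.
  - move=> y /=; rewrite in_itv /= => H.
    have : `|g x - g y| < g x by apply: Hd; rewrite /= ltr_norml; lra.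
    by rewrite ltr_norml; lra.
move=> x; apply/eqP; rewrite eq_le; apply/andP; split; rewrite leNgt; apply/negP.
  exact: Hpos.
have cN : continuous (fun x => - f x) by move=> y; apply: cvgN; exact: cf.
have iN : mu.-integrable setT (EFin \o (fun x => - f x)).
  exact: (@integrableN _ _ _ mu setT (EFin \o f)).
rewrite -oppr_gt0; apply: (Hpos _ cN iN) => a d d0.
transitivity (-1 * \int[mu]_(x in `]a - d, a + d[) f x); last by rewrite Hitv ?mulr0.
rewrite -RintegralZl //; last by apply: integrableS fi.
by apply: eq_Rintegral => y _; rewrite mulN1r.
Unshelve. all: by end_near. Qed.

End Uniqueness.

(** * The kernel of a product of resolvents *)

Section Exponential.
Variable R : realType.
Notation mu := (@lebesgue_measure R).

Lemma continuous_expR_lin (k : R) : continuous (fun x : R => expR (k * x)).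
Proof.
move=> x; apply: (@continuous_comp _ _ _ (fun x => k * x) expR).
  by apply: cvgM; [exact: cvg_cst|exact: cvg_id].
exact: continuous_expR.
Qed.

Lemma continuous_expR_div (d : R) : continuous (fun x : R => expR (x / d)).
Proof.
rewrite (_ : (fun x => _) = (fun x => expR (d^-1 * x))); first exact: continuous_expR_lin.
by apply/funext => x; rewrite mulrC.
Qed.

Lemma is_derive_expR_lin (k x : R) : is_derive x 1 (fun x : R => expR (k * x)) (k * expR (k * x)).
Proof.
have H : is_derive x 1 (fun x : R => k * x) k.
  by apply: is_derive_eq; rewrite scaler1.
apply: is_derive_eq.
by rewrite mulrC.
Qed.

Lemma measurable_expR_abs (D : set R) (k a : R) : measurable D ->
  measurable_fun D (fun x : R => expR (- k * `|x - a|)).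
Proof.
move=> mD; apply: measurable_continuous => // x.
apply: (@continuous_comp _ _ _ (fun x => - k * `|x - a|) expR).
  apply: cvgM; first exact: cvg_cst.
  apply: (@continuous_comp _ _ _ (fun x => x - a) Num.norm).
    by apply: cvgB; [exact: cvg_id|exact: cvg_cst].
  exact: norm_continuous.
exact: continuous_expR.
Qed.

Lemma integrable_expR_abs (k : R) : 0 < k ->
  mu.-integrable setT (EFin \o (fun x : R => expR (- k * `|x|))).
Proof.
move=> k0; have i1 := integrable_exponential_pdf k0.
have [||i2 _] := @Rintegral_reflect R setT (fun x => exponential_pdf k (- x)) measurableT.
- by apply: measurableT_comp; [exact: measurable_exponential_pdf|exact: oppr_measurable].
- rewrite preimage_setT (_ : _ \o _ = EFin \o exponential_pdf k) //.
  by apply/funext => x; rewrite /= /affR addr0 mulN1r opprK.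
apply: (integrable_le R _ _ (fun x => k^-1 * (exponential_pdf k x + exponential_pdf k (- x)))) => //.
- have := measurable_expR_abs setT k 0 measurableT.
  by under eq_fun do rewrite subr0.
- move=> x _; rewrite ger0_norm ?expR_ge0 // mulrDr.
  have P y : 0 <= k^-1 * exponential_pdf k y.
    by rewrite mulr_ge0 ?invr_ge0 ?exponential_pdf_ge0 ?ltW.
  have E y : 0 <= y -> k^-1 * exponential_pdf k y = expR (- k * y).
    move=> y0; rewrite /exponential_pdf patchE mem_set /= ?in_itv /= ?andbT //.
    by rewrite mulrA mulVf ?gt_eqF // mul1r.
  have [x0|x0] := leP 0 x; first by rewrite (E x) // ger0_norm // lerDl.
  by rewrite ltr0_norm // -(E (- x)) ?lerDr // oppr_ge0 ltW.
- apply: integrable_scale => //; exact: integrable_add.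
Qed.

Lemma integrable_expR_abs_shift (k a : R) : 0 < k ->
  mu.-integrable setT (EFin \o (fun x : R => expR (- k * `|x - a|))) /\
  \int[mu]_x expR (- k * `|x - a|) = \int[mu]_x expR (- k * `|x|).
Proof.
move=> k0; have [||H1 ->] := @Rintegral_translate R a setT (fun x => expR (- k * `|x - a|)) measurableT.
- exact: measurable_expR_abs.
- rewrite preimage_setT (_ : _ \o _ = EFin \o (fun x : R => expR (- k * `|x|))).
    exact: integrable_expR_abs.
  by apply/funext => x; rewrite /= /affR mul1r addrK.
split=> //; rewrite preimage_setT; apply: eq_Rintegral => x _.
by rewrite /affR mul1r addrK.
Qed.

End Exponential.

(** * Integration by parts against cosines and sines on a half-line *)

Section HalfLine.
Variable R : realType.
Notation mu := (@lebesgue_measure R).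

(** Only limits along n and 1 / (n + 1) enter, so a jump of F or f at 0 does no harm; the kernel of
    a single resolvent has one. *)
Lemma Rintegral_FTC2_half (F f : R -> R) (r : R) :
  (forall x : R, 0 < x -> is_derive x 1 F (f x)) ->
  (forall x : R, 0 < x -> {for x, continuous f}) ->
  mu.-integrable `]0, +oo[ (EFin \o f) ->
  F n%:R @[n --> \oo] --> (0 : R) -> F n.+1%:R^-1 @[n --> \oo] --> r ->
  \int[mu]_(x in `]0, +oo[) f x = - r.
Proof.
move=> dF cf fi F0 Fr.
have cF x : 0 < x -> {for x, continuous F}.
  move=> /dF H; apply: differentiable_continuous; apply/derivable1_diffP.
  exact: ex_derive.
(* The right end n + 2 keeps the interval nondegenerate at n = 0. *)
pose I (n : nat) : set R := `[n.+1%:R^-1, n.+2%:R]%classic.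
have mI n : measurable (I n) by exact: measurable_itv.
have Ipos n x : I n x -> 0 < x.
  by rewrite /I /= in_itv /= => /andP[H _]; apply: lt_le_trans H; rewrite invr_gt0.
have HI n : \int[mu]_(x in I n) f x = F n.+2%:R - F n.+1%:R^-1.
  rewrite /Rintegral (@continuous_FTC2 _ f F) //.
  - apply: (@le_lt_trans _ _ 1); first by rewrite invf_le1 // ler1n.
    by rewrite ltr1n.
  - apply: (@continuous_in_subspaceT _ _ (I n) f) => x /set_mem /Ipos; exact: cf.
  - split.
    + move=> x; rewrite in_itv /= => /andP[H _].
      have x0 : 0 < x by apply: le_lt_trans H; rewrite invr_ge0.
      by have /@ex_derive := dF _ x0.
    + by apply: cvg_at_right_filter; apply: cF; rewrite invr_gt0.
    + by apply: cvg_at_left_filter; apply: cF; rewrite ltr0n.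
  - move=> x; rewrite in_itv /= => /andP[H _].
    have x0 : 0 < x by apply: le_lt_trans H; rewrite invr_ge0.
    by rewrite derive1E; have /@derive_val := dF _ x0.
pose P : set R := `]0, +oo[%classic.
have mP : measurable P by exact: measurable_itv.
have mf : measurable_fun P f by exact: integrable_measurable fi.
have [||||_ cv] := @Rintegral_dominated_cvg_pt R P
    (fun n x => f x * \1_(I n) x) f (fun x => `|f x|) mP.
- by move=> n; apply: measurable_funM => //; exact: measurable_indic.
- move=> x; rewrite /P /= in_itv /= andbT => x0.
  apply: cvg_near_cst; near=> n.
  rewrite indicE mem_set ?mulr1 // /I /= in_itv /=; apply/andP; split.
    rewrite invf_ple ?posrE ?ltr0n //; apply: (@le_trans _ _ n%:R); last by rewrite ler_nat.
    by near: n; exact: nbhs_infty_ger.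
  apply: (@le_trans _ _ n%:R); last by rewrite ler_nat; lia.
  by near: n; exact: nbhs_infty_ger.
- exact: integrable_norm.
- move=> n x _; rewrite normrM ler_piMr // indicE.
  by case: (_ \in _); rewrite ?normr1 ?normr0.
rewrite -(cvg_lim _ cv) //; apply/cvg_lim => //.
rewrite -sub0r.
rewrite (_ : (fun n => _) = (fun n => F n.+2%:R - F n.+1%:R^-1)); last first.
  apply/funext => n; rewrite Rintegral_indic //.
  rewrite (_ : `]0, +oo[ `&` I n = I n) ?HI //.
  by apply: setIidr => x /Ipos; rewrite /= in_itv /= andbT.
apply: cvgB => //.
by rewrite -(cvg_shiftn 2) in F0; under eq_fun do rewrite -addn2.
Unshelve. all: by end_near. Qed.

Lemma cvg_expR_nat (c : R) : 0 < c -> expR (- c * n%:R) @[n --> \oo] --> (0 : R).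
Proof.
move=> c0; rewrite (_ : (fun n => _) = (fun n => expR (- c) ^+ n)).
  by apply: cvg_expr; rewrite ger0_norm ?expR_ge0 // expR_lt1 oppr_lt0.
by apply/funext => n; rewrite -expRM_natr.
Qed.

(** Since d v' = u - v, the integrands are the derivatives of d v cos(w x) and d v sin(w x). Both
    vanish at infinity; at 0 the first tends to d r and the second to 0. *)
Lemma half_fourier (d w c A r : R) (u v : R -> R) : 0 < c -> d != 0 ->
  (forall x : R, 0 < x -> is_derive x 1 v ((u x - v x) / d)) ->
  (forall x : R, 0 < x -> {for x, continuous u}) ->
  measurable_fun (`]0, +oo[%classic : set R) u -> measurable_fun (`]0, +oo[%classic : set R) v ->
  (forall x : R, 0 < x -> `|u x| <= A * expR (- c * `|x|)) ->
  (forall x : R, 0 < x -> `|v x| <= A * expR (- c * `|x|)) ->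
  v n.+1%:R^-1 @[n --> \oo] --> r ->
  \int[mu]_(x in `]0, +oo[) ((u x - v x) * cos (w * x) - w * d * v x * sin (w * x)) = - (d * r) /\
  \int[mu]_(x in `]0, +oo[) ((u x - v x) * sin (w * x) + w * d * v x * cos (w * x)) = 0.
Proof.
move=> c0 d0 dv cu mu_ mv bu bv vr.
have mP : measurable (`]0, +oo[%classic : set R) by exact: measurable_itv.
have mc : measurable_fun (`]0, +oo[%classic : set R) (fun x => cos (w * x)).
  apply: measurable_continuous => // x; apply: (@continuous_comp _ _ _ (fun x => w * x) cos).
    by apply: cvgM; [exact: cvg_cst|exact: cvg_id].
  exact: continuous_cos.
have ms : measurable_fun (`]0, +oo[%classic : set R) (fun x => sin (w * x)).
  apply: measurable_continuous => // x; apply: (@continuous_comp _ _ _ (fun x => w * x) sin).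
    by apply: cvgM; [exact: cvg_cst|exact: cvg_id].
  exact: continuous_sin.
have dlin (x : R) : is_derive x 1 (fun x : R => w * x) w.
  by apply: is_derive_eq; rewrite scaler1.
have cc (x : R) : {for x, continuous (fun x : R => cos (w * x))}.
  apply: (@continuous_comp _ _ _ (fun x => w * x) cos).
    by apply: cvgM; [exact: cvg_cst|exact: cvg_id].
  exact: continuous_cos.
have cs (x : R) : {for x, continuous (fun x : R => sin (w * x))}.
  apply: (@continuous_comp _ _ _ (fun x => w * x) sin).
    by apply: cvgM; [exact: cvg_cst|exact: cvg_id].
  exact: continuous_sin.
have cv (x : R) : 0 < x -> {for x, continuous v}.
  move=> /dv H; apply: differentiable_continuous; apply/derivable1_diffP.
  exact: ex_derive.
have iE : mu.-integrable (`]0, +oo[%classic : set R)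
    (EFin \o (fun x => (A + A + `|w * d| * A) * expR (- c * `|x|))).
  by apply: integrable_scale => //; apply: integrableS (integrable_expR_abs R c c0).
have small (s : R -> R) : (forall x, `|s x| <= 1) -> d * v n%:R * s n%:R @[n --> \oo] --> (0 : R).
  move=> s1; apply: norm_cvg0.
  apply: (@squeeze_cvgr _ _ _ _ (fun=> 0) (fun n => `|d| * A * expR (- c * n%:R))).
  - near=> n; rewrite normr_ge0 /= !normrM.
    have n0 : 0 < n%:R :> R by rewrite ltr0n; near: n; exact: nbhs_infty_gt.
    apply: (@le_trans _ _ (`|d| * `|v n%:R|)); first by rewrite ler_piMr // mulr_ge0.
    by rewrite -mulrA ler_wpM2l // (le_trans (bv _ n0)) // ger0_norm.
  - exact: cvg_cst.
  - rewrite -[X in _ --> X](mulr0 (`|d| * A)); apply: cvgM; first exact: cvg_cst.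
    exact: cvg_expR_nat.
have inv0 (s : R -> R) : continuous s -> s n.+1%:R^-1 @[n --> \oo] --> s 0.
  move=> cts; apply: (@cvg_comp _ _ _ (fun n => n.+1%:R^-1) s _ (nbhs 0)); last exact: cts.
  exact: cvg_harmonic.
have bnd (s t : R -> R) x : `|s x| <= 1 -> `|t x| <= 1 -> 0 < x ->
    `|(u x - v x) * s x + w * d * v x * t x| <= (A + A + `|w * d| * A) * expR (- c * `|x|).
  move=> s1 t1 x0; have := bu _ x0; have := bv _ x0 => H1 H2.
  rewrite (le_trans (ler_normD _ _)) // !normrM.
  have : `|u x - v x| * `|s x| <= A * expR (- c * `|x|) + A * expR (- c * `|x|).
    by rewrite (le_trans (ler_piMr _ s1)) // (le_trans (ler_normB _ _)) // lerD.
  have : `|w| * `|d| * `|v x| * `|t x| <= `|w| * `|d| * (A * expR (- c * `|x|)).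
    by rewrite (le_trans (ler_piMr _ t1)) ?mulr_ge0 // ler_wpM2l ?mulr_ge0.
  by lra.
split.
- apply: (@Rintegral_FTC2_half (fun x => d * v x * cos (w * x)) _ (d * r)).
  + move=> x x0; have H := dv x x0.
    apply: is_derive_eq; rewrite /GRing.scale /=.
    by field.
  + move=> x x0; apply: cvgB; apply: cvgM; [|exact: cc| |exact: cs].
      by apply: cvgB; [exact: cu|exact: cv].
    by apply: cvgM; [exact: cvg_cst|exact: cv].
  + apply: integrable_le iE => //.
      apply: measurable_funB; apply: measurable_funM => //; first exact: measurable_funB.
      by apply: measurable_funM => //; exact: measurable_cst.
    move=> x /=; rewrite in_itv /= andbT => x0.
    have := bnd (fun x => cos (w * x)) (fun x => - sin (w * x)) x; rewrite mulrN; apply => //.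
      exact: cos_max.
    by rewrite normrN sin_max.
  + by apply: (small (fun x => cos (w * x))) => x; exact: cos_max.
  + rewrite -[d * r]mulr1 -[X in _ * X]cos0 -[X in cos X](mulr0 w); apply: cvgM; last first.
      by apply: (inv0 (fun x => cos (w * x))) => x; exact: cc.
    by apply: cvgM; [exact: cvg_cst|].
- rewrite -[RHS]oppr0; apply: (@Rintegral_FTC2_half (fun x => d * v x * sin (w * x)) _ 0).
  + move=> x x0; have H := dv x x0.
    apply: is_derive_eq; rewrite /GRing.scale /=.
    by field.
  + move=> x x0; apply: cvgD; apply: cvgM; [|exact: cs| |exact: cc].
      by apply: cvgB; [exact: cu|exact: cv].
    by apply: cvgM; [exact: cvg_cst|exact: cv].
  + apply: integrable_le iE => //.
      apply: measurable_funD; apply: measurable_funM => //; first exact: measurable_funB.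
      by apply: measurable_funM => //; exact: measurable_cst.
    move=> x /=; rewrite in_itv /= andbT => x0.
    by apply: (bnd (fun x => sin (w * x)) (fun x => cos (w * x))); rewrite ?cos_max ?sin_max.
  + by apply: (small (fun x => sin (w * x))) => x; exact: sin_max.
  + rewrite -(mulr0 (d * r)) -[X in _ * X]sin0 -[X in sin X](mulr0 w); apply: cvgM; last first.
      by apply: (inv0 (fun x => sin (w * x))) => x; exact: cs.
    by apply: cvgM; [exact: cvg_cst|].
Unshelve. all: by end_near. Qed.

End HalfLine.

(** * Decaying solutions of the resolvent equation *)

Section Step.
Variable R : realType.
Notation mu := (@lebesgue_measure R).

Lemma Rintegral_itv_bound (a b C : R) (f : R -> R) : a <= b ->
  mu.-integrable `[a, b] (EFin \o f) -> (forall t, a <= t <= b -> `|f t| <= C) ->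
  `|\int[mu]_(t in `[a, b]) f t| <= C * (b - a).
Proof.
move=> ab fi fC; have mI : measurable (`[a, b]%classic : set R) by exact: measurable_itv.
apply: le_trans (le_normr_Rintegral _ fi) _ => //.
have -> : C * (b - a) = \int[mu]_(t in `[a, b]) C.
  rewrite Rintegral_cst //; congr (_ * _).
  suff E : mu (`[a, b]%classic : set R) = (b - a)%:E by rewrite -[LHS]/(fine (b - a)%:E) -E.
  rewrite lebesgue_measure_itv /= lte_fin.
  by case: ltgtP ab => // ->; rewrite subrr.
apply: le_Rintegral => //.
- exact: integrable_norm.
- apply: continuous_compact_integrable; first exact: segment_compact.
  by apply: continuous_subspaceT => x; exact: cvg_cst.
Qed.

Lemma Rintegral_subset_le (D : set R) (f : R -> R) : measurable D ->
  mu.-integrable setT (EFin \o f) -> (forall x, 0 <= f x) ->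
  \int[mu]_(x in D) f x <= \int[mu]_x f x.
Proof.
move=> mD fi f0; rewrite -[X in \int[mu]_(x in X) _ <= _]setTI -Rintegral_indic //.
apply: le_Rintegral => //.
- apply: (integrable_mul_bounded R _ _ _ 1) => //.
  by move=> x _; rewrite indicE; case: (_ \in _); rewrite ?normr1 ?normr0.
- by move=> x _; rewrite ler_piMr // indicE; case: (_ \in _).
Qed.

(** From |x| <= |t| + (x - t). The surplus k of 1/d over the decay rate c makes integrals over ]-oo,
    x] converge and keeps the factor e^(-c |x|) outside. *)
Lemma exp_window (c k d x t : R) : 0 < c -> k = d^-1 - c -> t <= x ->
  expR (t / d) * expR (- c * `|t|) <= expR (x / d) * expR (- c * `|x|) * expR (- k * `|t - x|).
Proof.
move=> c0 kd tx; rewrite -!expRD ler_expR.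
have H : `|x| <= `|t| + (x - t).
  by rewrite -{1}[x](subrK t) addrC (le_trans (ler_normD _ _)) // lerD2l ger0_norm // subr_ge0.
rewrite (_ : `|t - x| = x - t); last by rewrite distrC ger0_norm // subr_ge0.
by rewrite kd; nra.
Qed.

(** For d > 0 the solution decaying at both ends is v(x) = (1/d) e^(-x/d) int e^(t/d) u(t) dt, the
    integral extending over ]-oo, x]. *)
Lemma resolvent_pos (d c A : R) (u : R -> R) : 0 < d -> 0 < c ->
  measurable_fun setT u -> (forall x, `|u x| <= A * expR (- c * `|x|)) ->
  exists v c' A', [/\ 0 < c', (forall x, `|v x| <= A' * expR (- c' * `|x|)),
    continuous v,
    (forall x y, x <= y -> expR (y / d) * v y - expR (x / d) * v x =
       d^-1 * \int[mu]_(t in `[x, y]) (expR (t / d) * u t)) &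
    (forall x, {for x, continuous u} -> is_derive x 1 v ((u x - v x) / d))].
Proof.
move=> d0 c0 mu_ uA.
have A0 : 0 <= A by have := uA 0; rewrite normr0 mulr0 expR0 mulr1; apply: le_trans.
(* The new decay rate must stay strictly below 1/d, so that the surplus k is positive. *)
pose c' := Num.min c (d^-1 / 2); pose k := d^-1 - c'.
have di0 : 0 < d^-1 by rewrite invr_gt0.
have c'0 : 0 < c' by rewrite /c' lt_min c0 divr_gt0.
have c'c : c' <= c by rewrite /c' ge_min lexx.
have k0 : 0 < k by rewrite /k subr_gt0 (@le_lt_trans _ _ (d^-1 / 2)) ?ge_min ?lexx ?orbT //; lra.
have uA' t : `|u t| <= A * expR (- c' * `|t|).
  by rewrite (le_trans (uA t)) // ler_wpM2l // ler_expR ler_wpM2r // lerN2.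
pose J := \int[mu]_x expR (- k * `|x|).
pose g t := expR (t / d) * u t.
have mg (D : set R) : measurable D -> measurable_fun D g.
  move=> mD; apply: measurable_funM; last exact: measurable_funTS.
  by apply: measurable_continuous => //; exact: continuous_expR_div.
have gb x t : t <= x -> `|g t| <= A * (expR (x / d) * expR (- c' * `|x|)) * expR (- k * `|t - x|).
  move=> tx; rewrite /g normrM ger0_norm ?expR_ge0 //.
  apply: (@le_trans _ _ (A * (expR (t / d) * expR (- c' * `|t|)))).
    by rewrite mulrCA ler_wpM2l ?expR_ge0.
  rewrite -[leRHS]mulrA ler_wpM2l //.
  exact: exp_window.
have mN (x : R) : measurable (`]-oo, x]%classic : set R) by exact: measurable_itv.
have iB x (D : set R) : measurable D -> mu.-integrable D (EFin \o (fun t =>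
    A * (expR (x / d) * expR (- c' * `|x|)) * expR (- k * `|t - x|))).
  move=> mD; apply: integrable_scale => //.
  by apply: integrableS (integrable_expR_abs_shift R k x k0).1.
have ig x : mu.-integrable `]-oo, x] (EFin \o g).
  apply: integrable_le (iB x _ _) => //; first exact: mg.
  by move=> t /=; rewrite in_itv /= => tx; exact: gb.
pose W x := \int[mu]_(t in `]-oo, x]) g t.
have igI x y : mu.-integrable `[x, y] (EFin \o g).
  by apply: integrableS (ig y) => // t /=; rewrite !in_itv /= => /andP[].
have Wxy x y : x <= y -> W y - W x = \int[mu]_(t in `[x, y]) g t.
  move=> xy; rewrite /W (Rintegral_itvB (ig y)) ?bnd_simp //.
  rewrite Rintegral_itv_obnd_cbnd //.
  by apply: integrableS (ig y) => // t /=; rewrite !in_itv /= => /andP[].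
have Wb x : `|W x| <= A * (expR (x / d) * expR (- c' * `|x|)) * J.
  apply: le_trans (le_normr_Rintegral _ (ig x)) _ => //.
  rewrite /J -(integrable_expR_abs_shift R k x k0).2.
  rewrite -RintegralZl //; last exact: (integrable_expR_abs_shift R k x k0).1.
  apply: (@le_trans _ _ (\int[mu]_(t in `]-oo, x]) (A * (expR (x / d) * expR (- c' * `|x|)) * expR (- k * `|t - x|)))).
    apply: le_Rintegral => //; first exact: integrable_norm (ig x).
      exact: iB.
    by move=> t /=; rewrite in_itv /= => tx; exact: gb.
  apply: Rintegral_subset_le => //.
  - exact: iB.
  - by move=> t; rewrite !mulr_ge0 ?expR_ge0.
have cW : continuous W.
  move=> x; pose C := A * expR ((x + 1) / d) + 1.
  have C0 : 0 < C by rewrite ltr_wpDl // mulr_ge0 ?expR_ge0.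
  have lip a b : a <= b -> b <= x + 1 -> `|W b - W a| <= C * (b - a).
    move=> ab bx; rewrite Wxy //; apply: Rintegral_itv_bound => // t /andP[_ tb].
    rewrite /g normrM ger0_norm ?expR_ge0 // mulrC /C (@le_trans _ _ (A * expR ((x + 1) / d))) ?lerDl //.
    apply: ler_pM; rewrite ?expR_ge0 ?normr_ge0 //.
      by rewrite (le_trans (uA t)) // ler_piMr // -expR0 ler_expR mulNr oppr_le0 mulr_ge0 // ltW.
    by rewrite ler_expR ler_wpM2r ?(ltW di0) // (le_trans tb).
  apply/cvgrPdist_lt => e e0; near=> y.
  have y1 : `|x - y| < 1 by near: y; apply: (@cvgr_dist_lt _ _ _ _ _ id x cvg_id).
  have yC : `|x - y| < e / C by near: y; apply: (@cvgr_dist_lt _ _ _ _ _ id x cvg_id); rewrite divr_gt0.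
  rewrite ltr_pdivlMr // mulrC in yC; apply: le_lt_trans yC.
  have [xy|yx] := leP x y.
    rewrite distrC [`|x - y|]distrC [`|y - x|]ger0_norm ?subr_ge0 // lip //.
    by move: y1; rewrite ltr_norml; lra.
  rewrite [`|x - y|]ger0_norm; last by rewrite subr_ge0 ltW.
  by apply: lip; [exact: ltW|lra].
exists (fun x => d^-1 * expR (- d^-1 * x) * W x), c', (d^-1 * A * J); split.
- exact: c'0.
- move=> x; rewrite normrM [`|d^-1 * _|]ger0_norm; last by rewrite mulr_ge0 ?expR_ge0 // ltW.
  apply: le_trans (ler_wpM2l _ (Wb x)) _; first by rewrite mulr_ge0 ?expR_ge0 // ltW.
  rewrite (_ : expR (- d^-1 * x) = (expR (x / d))^-1); last by rewrite mulNr expRN mulrC.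
  rewrite le_eqVlt; apply/orP; left; apply/eqP; field.
  by rewrite (gt_eqF d0) expR_eq0.
- move=> x; apply: cvgM; last exact: cW.
  by apply: cvgM; [exact: cvg_cst|exact: continuous_expR_lin].
- move=> x y xy.
  have E z w : expR (z / d) * (d^-1 * expR (- d^-1 * z) * w) = d^-1 * w.
    rewrite (_ : expR (- d^-1 * z) = (expR (z / d))^-1); last by rewrite mulNr expRN mulrC.
    by field; rewrite (gt_eqF d0) expR_eq0.
  by rewrite !E -mulrBr Wxy.
- move=> x cux.
  have cgx : {for x, continuous g}.
    apply: cvgM; last exact: cux.
    exact: continuous_expR_div.
  have [dW W'] : derivable W x 1 /\ W^`()%classic x = g x.
    apply: (@continuous_FTC1 _ g -oo%O x (x + 1)); [by rewrite ltrDl|exact: ig|by rewrite ltNyr|exact: cgx].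
  have H : is_derive x 1 W (g x).
    by apply: DeriveDef; [exact: dW|rewrite -derive1E; exact: W'].
  have H2 := is_derive_expR_lin R (- d^-1) x.
  apply: is_derive_eq; rewrite /GRing.scale /= /g.
  rewrite (_ : expR (- d^-1 * x) = (expR (x / d))^-1); last by rewrite mulNr expRN mulrC.
  by field; rewrite (gt_eqF d0) expR_eq0.
Unshelve. all: by end_near. Qed.
Lemma integrable_bounded_itv (a b B : R) (f : R -> R) : measurable_fun setT f ->
  (forall t, a <= t <= b -> `|f t| <= B) -> mu.-integrable `[a, b] (EFin \o f).
Proof.
move=> mf fB; apply: (integrable_le R _ _ (fun=> B)).
- exact: measurable_itv.
- exact: measurable_funTS.
- by move=> t /=; rewrite in_itv /=; exact: fB.
- apply: continuous_compact_integrable; first exact: segment_compact.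
  by apply: continuous_subspaceT => x; exact: cvg_cst.
Qed.

Lemma expR_div_bound (d a b t : R) : a <= t <= b -> expR (t / d) <= expR ((`|a| + `|b|) * `|d^-1|).
Proof.
move=> /andP[at_ tb]; rewrite ler_expR (le_trans (ler_norm _)) // normrM ler_wpM2r //.
rewrite ler_norml; apply/andP; split.
  by have := ler_norm (- a); have := normr_ge0 b; rewrite normrN; lra.
by have := ler_norm b; have := normr_ge0 a; lra.
Qed.

Lemma integrable_expR_itv (d a b B : R) (u : R -> R) : measurable_fun setT u ->
  (forall t, `|u t| <= B) -> mu.-integrable `[a, b] (EFin \o (fun t => expR (t / d) * u t)).
Proof.
move=> mu_ uB.
apply: (integrable_bounded_itv a b (expR ((`|a| + `|b|) * `|d^-1|) * B)).
  by apply: measurable_funM => //; apply: measurable_continuous => //; exact: continuous_expR_div.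
move=> t tab; rewrite normrM; apply: ler_pM => //.
by rewrite ger0_norm ?expR_ge0 // expR_div_bound.
Qed.

(** The reflection x to -x exchanges d and -d in the equation, which reduces negative d to
    [resolvent_pos]. *)
Lemma resolvent (d c A : R) (u : R -> R) : d != 0 -> 0 < c ->
  measurable_fun setT u -> (forall x, `|u x| <= A * expR (- c * `|x|)) ->
  exists v c' A', [/\ 0 < c', (forall x, `|v x| <= A' * expR (- c' * `|x|)),
    continuous v,
    (forall x y, x <= y -> expR (y / d) * v y - expR (x / d) * v x =
       d^-1 * \int[mu]_(t in `[x, y]) (expR (t / d) * u t)) &
    (forall x, {for x, continuous u} -> is_derive x 1 v ((u x - v x) / d))].
Proof.
move=> dN0 c0 mu_ uA.
have [d0|d0] := ltP 0 d; first exact: (resolvent_pos d c A).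
have {dN0}d0 : 0 < - d by rewrite oppr_gt0 lt_neqAle dN0.
have mN : measurable_fun setT (fun x : R => u (- x)).
  by apply: measurableT_comp => //; exact: oppr_measurable.
have A0 : 0 <= A by have := uA 0; rewrite normr0 mulr0 expR0 mulr1; apply: le_trans.
have uB t : `|u t| <= A.
  by rewrite (le_trans (uA t)) // ler_piMr // -expR0 ler_expR mulNr oppr_le0 mulr_ge0 // ltW.
have [x|v [c' [A' [c'0 vb cv rel dv]]]] := resolvent_pos (- d) c A (fun x => u (- x)) d0 c0 mN.
  by rewrite (le_trans (uA _)) // normrN.
have Ed (t : R) : - t / - d = t / d by rewrite invrN mulrNN.
exists (fun x => v (- x)), c', A'; split.
- exact: c'0.
- by move=> x; rewrite (le_trans (vb _)) // normrN.
- by move=> x; apply: (@continuous_comp _ _ _ -%R v); [exact: opp_continuous|exact: cv].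
- move=> x y xy; have := rel (- y) (- x); rewrite lerN2 => /(_ xy); rewrite !Ed => H.
  rewrite -opprB H invrN mulNr opprK; congr (_ * _).
  have [||_ ->] := @Rintegral_reflect R `[x, y]%classic (fun t => expR (t / d) * u t) (measurable_itv _).
  + apply: measurable_funM; last exact: measurable_funTS.
    by apply: measurable_continuous => //; exact: continuous_expR_div.
  + rewrite (_ : affR R (-1) 0 @^-1` _ = `[- y, - x]%classic); last first.
      by apply/seteqP; split=> t /=; rewrite !in_itv /= /affR; lra.
    rewrite (_ : _ \o _ = EFin \o (fun t => expR (t / - d) * u (- t))).
      exact: (integrable_expR_itv (- d) _ _ A).
    by apply/funext => t; rewrite /= /affR addr0 mulN1r invrN mulNr mulrN.
  + rewrite (_ : affR R (-1) 0 @^-1` _ = `[- y, - x]%classic); last first.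
      by apply/seteqP; split=> t /=; rewrite !in_itv /= /affR; lra.
    by apply: eq_Rintegral => t _; rewrite /affR addr0 mulN1r mulNr mulrN.
- move=> x cux.
  have cuN : {for - x, continuous (fun x => u (- x))}.
    apply: (@continuous_comp _ _ _ -%R u); first exact: opp_continuous.
    by rewrite opprK.
  have := dv _ cuN; rewrite opprK => H.
  have HN : is_derive x 1 (-%R : R -> R) (-1) by exact: is_deriveNid.
  apply: is_derive_eq.
  by rewrite invrN mulrN1 mulrN opprK.
Qed.

End Step.

Section FourierStep.
Variable R : realType.
Notation mu := (@lebesgue_measure R).

Definition expdec (c A : R) (f : R -> R) := 0 < c /\ forall x, `|f x| <= A * expR (- c * `|x|).

Lemma expdec_ge0 c A f : expdec c A f -> 0 <= A.
Proof. by move=> [_ /(_ 0)]; rewrite normr0 mulr0 expR0 mulr1; apply: le_trans. Qed.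

Lemma expdec_weaken c A c' A' f : expdec c A f -> 0 < c' -> c' <= c -> A <= A' -> expdec c' A' f.
Proof.
move=> Hf c'0 cc AA; have A0 := expdec_ge0 _ _ _ Hf; case: Hf => c0 Hf; split=> // x.
apply: le_trans (Hf x) _; apply: ler_pM => //.
by rewrite ler_expR ler_wpM2r // lerN2.
Qed.

Lemma expdec_common c A f c' A' g : expdec c A f -> expdec c' A' g ->
  exists d B, expdec d B f /\ expdec d B g.
Proof.
move=> Hf Hg; have A0 := expdec_ge0 _ _ _ Hf; have A'0 := expdec_ge0 _ _ _ Hg.
exists (Num.min c c'), (A + A'); case: (Hf) (Hg) => [c0 _] [c'0 _]; split.
  by apply: expdec_weaken Hf _ _ _; rewrite ?lt_min ?c0 ?ge_min ?lexx ?lerDl.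
by apply: expdec_weaken Hg _ _ _; rewrite ?lt_min ?c0 ?ge_min ?lexx ?orbT ?lerDr.
Qed.

Lemma expdec_bounded c A f x : expdec c A f -> `|f x| <= A.
Proof.
move=> Hf; have A0 := expdec_ge0 _ _ _ Hf; case: Hf => c0 H.
by rewrite (le_trans (H x)) // ler_piMr // -expR0 ler_expR mulNr oppr_le0 mulr_ge0 // ltW.
Qed.

Lemma expdec_integrable c A f : measurable_fun setT f -> expdec c A f ->
  mu.-integrable setT (EFin \o f).
Proof.
move=> mf [c0 Hf]; apply: integrable_le (_ : mu.-integrable _ (EFin \o (fun x => A * expR (- c * `|x|)))) => //.
by apply: integrable_scale => //; exact: integrable_expR_abs.
Qed.

Lemma Rintegral_halves (f : R -> R) : mu.-integrable setT (EFin \o f) ->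
  \int[mu]_x f x = \int[mu]_(x in `]0, +oo[) f x + \int[mu]_(x in `]0, +oo[) f (- x).
Proof.
move=> fi; have mf : measurable_fun setT f by exact: integrable_measurable fi.
rewrite -(setUv (`]0, +oo[%classic : set R)) Rintegral_setU; last 4 first.
- exact: measurable_itv.
- by apply: measurableC; exact: measurable_itv.
- by rewrite setUv.
- exact/disj_setPCl.
congr (_ + _); rewrite (_ : ~` _ = `]-oo, 0]%classic); last first.
  by apply/seteqP; split=> x /=; rewrite !in_itv /= ?andbT leNgt => /negP.
have fN (D : set R) : measurable D -> mu.-integrable D (EFin \o (fun x => f (- x))).
  move=> mD; suff : mu.-integrable setT (EFin \o (fun x => f (- x))).
    by apply: integrableS.
  have [||//] := @Rintegral_reflect R setT (fun x => f (- x)) measurableT.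
    by apply: measurableT_comp => //; exact: oppr_measurable.
  rewrite preimage_setT (_ : _ \o _ = EFin \o f) //.
  by apply/funext => x; rewrite /= /affR addr0 mulN1r opprK.
have E0 : affR R (-1) 0 @^-1` `]-oo, 0] = `[0, +oo[%classic.
  by apply/seteqP; split=> t /=; rewrite !in_itv /= /affR ?andbT; lra.
have [||_ ->] := @Rintegral_reflect R `]-oo, 0]%classic f (measurable_itv _).
- exact: measurable_funTS.
- rewrite E0 (_ : _ \o _ = EFin \o (fun x => f (- x))).
    by apply: fN; exact: measurable_itv.
  by apply/funext => x; rewrite /= /affR addr0 mulN1r.
rewrite E0 -Rintegral_itv_obnd_cbnd; last first.
  rewrite (_ : _ \o _ = EFin \o (fun x => f (- x))).
    by apply: fN; exact: measurable_itv.
  by apply/funext => x; rewrite /= /affR addr0 mulN1r.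
by apply: eq_Rintegral => x _; rewrite /affR addr0 mulN1r.
Qed.

Lemma integrable_mul_trig (D : set R) (f s : R -> R) : measurable D -> continuous s ->
  (forall x, `|s x| <= 1) -> mu.-integrable D (EFin \o f) ->
  mu.-integrable D (EFin \o (fun x => f x * s x)).
Proof.
by move=> mD cs s1 fi; apply: (integrable_mul_bounded R _ _ _ 1) => //; exact: measurable_continuous.
Qed.

Lemma continuous_cos_lin (w : R) : continuous (fun x : R => cos (w * x)).
Proof.
move=> x; apply: (@continuous_comp _ _ _ (fun x => w * x) cos).
  by apply: cvgM; [exact: cvg_cst|exact: cvg_id].
exact: continuous_cos.
Qed.

Lemma continuous_sin_lin (w : R) : continuous (fun x : R => sin (w * x)).
Proof.
move=> x; apply: (@continuous_comp _ _ _ (fun x => w * x) sin).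
  by apply: cvgM; [exact: cvg_cst|exact: cvg_id].
exact: continuous_sin.
Qed.

Definition fcos (f : R -> R) w := \int[mu]_x (f x * cos (w * x)).
Definition fsin (f : R -> R) w := \int[mu]_x (f x * sin (w * x)).

(** In complex form, with [fcos] - i [fsin] as transform, (1 + i w d) times the transform of v is
    that of u. The left half-line is reflected and treated with -d and -w; the boundary terms at 0
    cancel because v is continuous. *)
Lemma resolvent_fourier (d c A c' A' w : R) (u v : R -> R) : d != 0 ->
  measurable_fun setT u -> expdec c A u -> expdec c' A' v -> continuous v ->
  (forall x : R, x != 0 -> {for x, continuous u}) ->
  (forall x : R, x != 0 -> is_derive x 1 v ((u x - v x) / d)) ->
  fcos v w + w * d * fsin v w = fcos u w /\ fsin v w - w * d * fcos v w = fsin u w.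
Proof.
move=> d0 mu_ Hu Hv cv cu dv.
have [e [B [Hu' Hv']]] := expdec_common _ _ _ _ _ _ Hu Hv.
have [e0 bu] := Hu'; have [_ bv] := Hv'.
have mv : measurable_fun setT v by exact: measurable_continuous.
have iu := expdec_integrable _ _ _ mu_ Hu; have iv := expdec_integrable _ _ _ mv Hv.
have mN (f : R -> R) (D : set R) : measurable_fun setT f -> measurable_fun D (fun x => f (- x)).
  by move=> mf; apply: measurable_funTS; apply: measurableT_comp => //; exact: oppr_measurable.
have [x x0|x x0|||x x0|x x0||R1 R2] := half_fourier R d w e B (v 0) u v e0 d0.
- by apply: dv; rewrite gt_eqF.
- by apply: cu; rewrite gt_eqF.
- exact: measurable_funTS.
- exact: measurable_funTS.
- exact: bu.
- exact: bv.
- apply: (@cvg_comp _ _ _ (fun n => n.+1%:R^-1) v _ (nbhs 0)); last exact: cv.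
  exact: cvg_harmonic.
have [||x x0|x x0|||x x0|x x0||L1 L2] := half_fourier R (- d) (- w) e B (v 0) (fun x => u (- x)) (fun x => v (- x)).
- exact: e0.
- by rewrite oppr_eq0.
- have xN : - x != 0 by rewrite oppr_eq0 gt_eqF.
  have H := dv _ xN.
  have HN : is_derive x 1 (-%R : R -> R) (-1) by exact: is_deriveNid.
  by apply: is_derive_eq; rewrite invrN mulrN1 mulrN.
- apply: (@continuous_comp _ _ _ -%R u); first exact: opp_continuous.
  by apply: cu; rewrite oppr_eq0 gt_eqF.
- exact: mN.
- exact: mN.
- by rewrite (le_trans (bu _)) // normrN.
- by rewrite (le_trans (bv _)) // normrN.
- rewrite -[X in _ --> v X]oppr0.
  apply: (@cvg_comp _ _ _ (fun n => - n.+1%:R^-1) v _ (nbhs (- 0))); last exact: cv.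
  by apply: cvgN; exact: cvg_harmonic.
have iuv : mu.-integrable setT (EFin \o (fun x => u x - v x)) by exact: integrable_sub.
have it f s t : mu.-integrable setT (EFin \o f) -> continuous s -> (forall x, `|s x| <= 1) ->
    (t = s) -> mu.-integrable setT (EFin \o (fun x => f x * t x)).
  by move=> fi cs s1 ->; exact: integrable_mul_trig.
have cc := continuous_cos_lin w; have ss := continuous_sin_lin w.
have cc1 x : `|cos (w * x)| <= 1 by exact: cos_max.
have ss1 x : `|sin (w * x)| <= 1 by exact: sin_max.
split.
- have : \int[mu]_x ((u x - v x) * cos (w * x) - w * d * v x * sin (w * x)) = 0.
    rewrite Rintegral_halves.
      rewrite R1 -[RHS](subrr (d * v 0)) addrC; congr (_ + _).
      rewrite -[RHS]opprK -mulNr -L1; apply: eq_Rintegral => x _.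
      by rewrite !(mulNr, mulrN) cosN sinN; ring.
    apply: integrable_sub => //; first exact: integrable_mul_trig.
    under [X in _ \o X]eq_fun do rewrite -mulrA.
    by apply: integrable_scale => //; exact: integrable_mul_trig.
  rewrite RintegralB //; first last.
  + under [X in _ \o X]eq_fun do rewrite -mulrA.
    by apply: integrable_scale => //; exact: integrable_mul_trig.
  + exact: integrable_mul_trig.
  under eq_Rintegral do rewrite mulrBl.
  rewrite RintegralB //; [|exact: integrable_mul_trig|exact: integrable_mul_trig].
  under [X in _ - X]eq_Rintegral do rewrite -mulrA.
  rewrite RintegralZl //; last exact: integrable_mul_trig.
  by rewrite -/(fcos u w) -/(fcos v w) -/(fsin v w); lra.
- have : \int[mu]_x ((u x - v x) * sin (w * x) + w * d * v x * cos (w * x)) = 0.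
    rewrite Rintegral_halves.
      rewrite R2 add0r -[RHS]L2; apply: eq_Rintegral => x _.
      by rewrite !(mulNr, mulrN) cosN sinN; ring.
    apply: integrable_add => //; first exact: integrable_mul_trig.
    under [X in _ \o X]eq_fun do rewrite -mulrA.
    by apply: integrable_scale => //; exact: integrable_mul_trig.
  rewrite RintegralD //; first last.
  + under [X in _ \o X]eq_fun do rewrite -mulrA.
    by apply: integrable_scale => //; exact: integrable_mul_trig.
  + exact: integrable_mul_trig.
  under eq_Rintegral do rewrite mulrBl.
  rewrite RintegralB //; [|exact: integrable_mul_trig|exact: integrable_mul_trig].
  under [X in _ + X]eq_Rintegral do rewrite -mulrA.
  rewrite RintegralZl //; last exact: integrable_mul_trig.
  by rewrite -/(fsin u w) -/(fcos v w) -/(fsin v w); lra.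
Qed.

End FourierStep.

(** * The kernel of a single resolvent *)

Section ExpSide.
Variable R : realType.
Notation mu := (@lebesgue_measure R).

(* The fundamental solution of [d * h' + h = delta_0] that decays at both ends. *)
Definition expside (d x : R) : R := d^-1 * expR (- x / d) * ((0 <= x)%R%:R - (d < 0)%R%:R).

Lemma expside_shift d y s : (0 <= y + s) = (0 <= y) ->
  expside d (y + s) = expR (- s / d) * expside d y.
Proof. by move=> H; rewrite /expside H opprD mulrDl expRD; ring. Qed.

(** Continuing the left branch exponentially up to 0 misses the value there by the jump 1/d. *)
Lemma expside_jump d y : y < 0 -> expside d 0 = expR (y / d) * expside d y + d^-1.
Proof.
move=> y0; rewrite /expside lexx leNgt y0 /= oppr0 mul0r expR0 mulNr.
have := expRxMexpNx_1 (y / d) => H.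
rewrite (_ : expR (y / d) * _ = d^-1 * (expR (y / d) * expR (- (y / d))) * (0 - (d < 0)%R%:R)); last by ring.
by rewrite H; ring.
Qed.

Lemma expside_oppr d x : x != 0 -> expside d (- x) = expside (- d) x.
Proof.
move=> x0; rewrite /expside oppr_lt0 oppr_ge0 opprK invrN mulrNN.
case: (ltgtP x 0) x0 => // _ _; case: (ltgtP d 0) => [_|_|->];
  by rewrite /= ?invr0 ?subrr ?subr0 ?sub0r; ring.
Qed.

Lemma expside_dec d : d != 0 -> expdec R `|d|^-1 `|d|^-1 (expside d).
Proof.
move=> d0; split; first by rewrite invr_gt0 normr_gt0.
move=> x; rewrite /expside !normrM normfV -mulrA ler_wpM2l ?invr_ge0 //.
rewrite (ger0_norm (expR_ge0 _)); have := expR_ge0 (- `|d|^-1 * `|x|) => E0.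
have [d1|d1|d1] := ltgtP d 0; last by rewrite d1 eqxx in d0.
- have [x0|x0] := leP 0 x; first by rewrite subrr normr0 mulr0.
  by rewrite sub0r normrN normr1 mulr1 (ltr0_norm d1) (ltr0_norm x0) invrN opprK [d^-1 * _]mulrC.
- have [x0|x0] := leP 0 x; last by rewrite subrr normr0 mulr0.
  by rewrite subr0 normr1 mulr1 (gtr0_norm d1) (ger0_norm x0) !mulNr [d^-1 * _]mulrC.
Qed.

Lemma measurable_expside d : measurable_fun setT (expside d).
Proof.
apply: measurable_funM.
  apply: measurable_funM => //.
  apply: measurable_continuous => // x.
  rewrite (_ : (fun x => _) = (fun x : R => expR (- d^-1 * x))); first exact: continuous_expR_lin.
  by apply/funext => t; rewrite mulNr mulNr mulrC.
apply: measurable_funB => //.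
rewrite (_ : (fun x => _) = (\1_(`[0, +oo[%classic : set R) : R -> R)).
  exact: measurable_indic.
apply/funext => x; rewrite indicE; congr ((nat_of_bool _)%:R).
by apply/idP/idP => [H|/set_mem]; [apply/mem_set|]; rewrite /= in_itv /= andbT.
Qed.

Lemma expside_continuous d x : x != 0 -> {for x, continuous (expside d)}.
Proof.
move=> x0; pose s : R := (0 <= x)%R%:R - (d < 0)%R%:R.
have key : continuous (fun y => d^-1 * expR (- d^-1 * y) * s).
  move=> y; apply: cvgM; last exact: cvg_cst.
  by apply: cvgM; [exact: cvg_cst|exact: continuous_expR_lin].
have Ex : expside d x = d^-1 * expR (- d^-1 * x) * s by rewrite /expside !mulNr [x / d]mulrC.
have {}key := key x; rewrite /continuous_at /= -Ex in key; apply: cvg_trans key.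
apply: near_eq_cvg; near=> y.
rewrite /expside /s !mulNr [y / d]mulrC; congr (_ * ((nat_of_bool _)%:R - _)).
have : `|x - y| < `|x|.
  by near: y; apply: (@cvgr_dist_lt _ _ _ _ _ id x cvg_id); rewrite normr_gt0.
have [x1|x1] := leP 0 x.
    rewrite (ger0_norm x1) ltr_norml => /andP[_ H].
    by have -> : 0 <= y by lra.
  rewrite (ltr0_norm x1) ltr_norml => /andP[H _].
  by rewrite leNgt; have -> : y < 0 by lra.
Unshelve. all: by end_near. Qed.

(** On ]0, +oo[ the kernel solves d v' + v = 0, so [half_fourier] applies with u = 0; the right-hand
    side 1 is the boundary term d (1/d). *)
Let pos_half d w : 0 < d ->
  \int[mu]_(x in `]0, +oo[) (expside d x * cos (w * x)) +
  w * d * \int[mu]_(x in `]0, +oo[) (expside d x * sin (w * x)) = 1 /\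
  \int[mu]_(x in `]0, +oo[) (expside d x * sin (w * x)) -
  w * d * \int[mu]_(x in `]0, +oo[) (expside d x * cos (w * x)) = 0.
Proof.
move=> d0; have dN0 : d != 0 by rewrite gt_eqF.
pose v x := d^-1 * expR (- d^-1 * x).
have [c0 bv] := expside_dec _ dN0.
have vE x : 0 < x -> v x = expside d x.
  move=> x0; rewrite /v /expside (ltW x0) ltNge (ltW d0) /= subr0 mulr1 mulNr mulNr.
  by rewrite [x / d]mulrC.
have cv : continuous v.
  by move=> x; apply: cvgM; [exact: cvg_cst|exact: continuous_expR_lin].
have [x x0|x x0|||x x0|x x0||R1 R2] := half_fourier R d w `|d|^-1 `|d|^-1 d^-1 (fun=> 0) v c0 dN0.
- have H := is_derive_expR_lin R (- d^-1) x.
  by apply: is_derive_eq; rewrite /GRing.scale /= /v; ring.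
- exact: cvg_cst.
- exact: measurable_cst.
- by apply: measurable_continuous => //; exact: measurable_itv.
- by rewrite normr0 mulr_ge0 ?expR_ge0.
- by rewrite vE // bv.
- rewrite -[X in _ --> X]mulr1 -[X in _ * X]expR0 -[X in expR X](mulr0 (- d^-1)).
  apply: (@cvg_comp _ _ _ (fun n => n.+1%:R^-1) v _ (nbhs 0)); last exact: cv.
  exact: cvg_harmonic.
have mP : measurable (`]0, +oo[%classic : set R) by exact: measurable_itv.
have iE : mu.-integrable (`]0, +oo[%classic : set R) (EFin \o expside d).
  apply: integrableS (expdec_integrable R _ _ _ (measurable_expside d) (expside_dec _ dN0)) => //.
have iEs s : continuous s -> (forall x, `|s x| <= 1) ->
    mu.-integrable (`]0, +oo[%classic : set R) (EFin \o (fun x => expside d x * s x)).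
  by move=> cs s1; exact: integrable_mul_trig.
have ic := iEs _ (continuous_cos_lin R w) (fun x => cos_max _).
have is_ := iEs _ (continuous_sin_lin R w) (fun x => sin_max _).
have E (p q : R -> R) (k l : R) : continuous p -> (forall x, `|p x| <= 1) ->
    continuous q -> (forall x, `|q x| <= 1) ->
    k * \int[mu]_(x in `]0, +oo[) (expside d x * p x) + l * \int[mu]_(x in `]0, +oo[) (expside d x * q x)
    = \int[mu]_(x in `]0, +oo[) (k * (expside d x * p x) + l * (expside d x * q x)).
  move=> cp p1 cq q1; rewrite RintegralD //; try exact: integrable_scale (iEs _ _ _).
  by rewrite !RintegralZl //; exact: iEs.
have cc := continuous_cos_lin R w; have ss := continuous_sin_lin R w.
have cc1 x : `|cos (w * x)| <= 1 by exact: cos_max.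
have ss1 x : `|sin (w * x)| <= 1 by exact: sin_max.
split.
- have H : \int[mu]_(x in `]0, +oo[) (-1 * (expside d x * cos (w * x)) + - (w * d) * (expside d x * sin (w * x)))
      = - (d * d^-1).
    rewrite -R1; apply: eq_Rintegral => x; rewrite inE /= in_itv /= andbT => x0.
    by rewrite (vE x x0); ring.
  rewrite -(E _ _ (-1) (- (w * d)) cc cc1 ss ss1) mulfV // in H; move: H.
  by move: (Rintegral _ _ _) (Rintegral _ _ _) => p q H; lra.
- have H : \int[mu]_(x in `]0, +oo[) (-1 * (expside d x * sin (w * x)) + w * d * (expside d x * cos (w * x)))
      = 0.
    rewrite -[RHS]R2; apply: eq_Rintegral => x; rewrite inE /= in_itv /= andbT => x0.
    by rewrite (vE x x0); ring.
  rewrite -(E _ _ (-1) (w * d) ss ss1 cc cc1) // in H; move: H.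
  by move: (Rintegral _ _ _) (Rintegral _ _ _) => p q H; lra.
Qed.

(** The kernel lives on one half-line, chosen by the sign of d; reflection carries negative d to
    [pos_half]. *)
Lemma expside_fourier d w : d != 0 ->
  fcos R (expside d) w + w * d * fsin R (expside d) w = 1 /\
  fsin R (expside d) w - w * d * fcos R (expside d) w = 0.
Proof.
move=> dN0.
have iE := expdec_integrable R _ _ _ (measurable_expside d) (expside_dec _ dN0).
have cc := continuous_cos_lin R w; have ss := continuous_sin_lin R w.
have cc1 x : `|cos (w * x)| <= 1 by exact: cos_max.
have ss1 x : `|sin (w * x)| <= 1 by exact: sin_max.
rewrite /fcos /fsin !Rintegral_halves; try exact: integrable_mul_trig.
have E0 (d' : R) (s : R -> R) : 0 < d' ->
    \int[mu]_(x in `]0, +oo[) (expside (- d') x * s x) = 0.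
  move=> d0; under eq_Rintegral => x.
    rewrite inE /= in_itv /= andbT => x0.
    rewrite /expside (ltW x0) oppr_lt0 d0 /= subrr mulr0 mul0r.
    over.
  by rewrite Rintegral_cst ?mul0r //; exact: measurable_itv.
have EN (s : R -> R) : \int[mu]_(x in `]0, +oo[) (expside d (- x) * s (w * - x)) =
    \int[mu]_(x in `]0, +oo[) (expside (- d) x * s (- (w * x))).
  apply: eq_Rintegral => x; rewrite inE /= in_itv /= andbT => x0.
  by rewrite expside_oppr ?mulrN // gt_eqF.
rewrite (EN cos) (EN sin).
have [d0|d0|d0] := ltgtP d 0; last by rewrite d0 eqxx in dN0.
- have dd : 0 < - d by rewrite oppr_gt0.
  have E1 (s : R -> R) : \int[mu]_(x in `]0, +oo[) (expside d x * s (w * x)) = 0.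
    by rewrite -[d]opprK E0.
  rewrite (E1 cos) (E1 sin).
  have [P1 P2] := pos_half (- d) w dd.
  have iEN := expdec_integrable R _ _ _ (measurable_expside (- d)) (expside_dec (- d) (lt0r_neq0 dd)).
  have EN1 : \int[mu]_(x in `]0, +oo[) (expside (- d) x * sin (- (w * x))) =
      - \int[mu]_(x in `]0, +oo[) (expside (- d) x * sin (w * x)).
    transitivity (-1 * \int[mu]_(x in `]0, +oo[) (expside (- d) x * sin (w * x))); last by rewrite mulN1r.
    rewrite -RintegralZl //; first by apply: eq_Rintegral => x _; rewrite sinN; ring.
    by apply: integrableS (integrable_mul_trig R setT _ _ measurableT ss ss1 iEN).
  have EN2 : \int[mu]_(x in `]0, +oo[) (expside (- d) x * cos (- (w * x))) =
      \int[mu]_(x in `]0, +oo[) (expside (- d) x * cos (w * x)).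
    by apply: eq_Rintegral => x _; rewrite cosN.
  rewrite EN1 EN2.
  rewrite !add0r; split; first by rewrite -P1; ring.
  by apply: oppr_inj; rewrite oppr0 -[RHS]P2; ring.
- have [P1 P2] := pos_half d w d0.
  have E2 (s : R -> R) : \int[mu]_(x in `]0, +oo[) (expside (- d) x * s (- (w * x))) = 0.
    exact: (E0 d (fun x => s (- (w * x)))).
  by rewrite (E2 cos) (E2 sin) !addr0.
Qed.

End ExpSide.

(** * Products of resolvents and identification of g *)

Section Chain.
Variable R : realType.
Notation mu := (@lebesgue_measure R).
Local Notation C := R[i].

(** The step records both forms of the resolvent equation: the integrated one feeds the Zak
    transform, the derivative the Fourier transform. The derivative is asserted only at continuity
    points of u, because the kernel of a single resolvent jumps at 0. *)
Inductive tpker : seq R -> (R -> R) -> Prop :=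
| tpker1 d : d != 0 -> tpker [:: d] (expside R d)
| tpkerS d ds u v : d != 0 -> tpker ds u ->
    (exists c A, expdec R c A v) -> continuous v ->
    (forall x y, x <= y -> expR (y / d) * v y - expR (x / d) * v x =
       d^-1 * \int[mu]_(t in `[x, y]) (expR (t / d) * u t)) ->
    (forall x, {for x, continuous u} -> is_derive x 1 v ((u x - v x) / d)) ->
    tpker (d :: ds) v.

Lemma tpker_dec ds h : tpker ds h -> exists c A, expdec R c A h.
Proof.
case=> [d d0|//]; exists `|d|^-1, `|d|^-1; exact: expside_dec.
Qed.

Lemma tpker_measurable ds h : tpker ds h -> measurable_fun setT h.
Proof. by case=> [d d0|*]; [exact: measurable_expside|exact: measurable_continuous]. Qed.

Lemma tpker_continuous0 ds h (x : R) : tpker ds h -> x != 0 -> {for x, continuous h}.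
Proof. by case=> [d d0|d {}ds u v _ _ _ cv *]; [exact: expside_continuous|exact: cv]. Qed.

Lemma tpker_continuous ds h : tpker ds h -> (1 < size ds)%N -> continuous h.
Proof. by case=> [//|d {}ds u v _ _ _ cv]. Qed.

Lemma tpker_exists d ds : d != 0 -> all (fun e => e != 0) ds -> exists h, tpker (d :: ds) h.
Proof.
elim: ds d => [|e ds IH] d d0 /=; first by exists (expside R d); exact: tpker1.
move=> /andP[e0 /(IH _ e0)] [u Hu].
have [c [A Hd]] := tpker_dec _ _ Hu; have [c0 uA] := Hd.
have [v [c' [A' [c'0 vb cv rel dv]]]] := resolvent R d c A u d0 c0 (tpker_measurable _ _ Hu) uA.
by exists v; apply: (tpkerS d _ u) => //; exists c', A'.
Qed.

(** A product equal to 1 needs no inverses in the induction and shows in addition that the factors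
    do not vanish. *)
Lemma tpker_fourier ds h w : tpker ds h ->
  Complex (fcos R h w) (- fsin R h w) * \prod_(d <- ds) (1 + 'i%C * (w * d)%:C%C) = 1 :> C.
Proof.
elim=> {ds h} [d d0|d ds u v d0 Hu IH [c [A Hv]] cv rel dv].
- rewrite big_seq1; have [E1 E2] := expside_fourier R d w d0.
  move: (fcos _ _ _) (fsin _ _ _) E1 E2 => p q E1 E2; simpc.
  by congr Complex; lra.
- rewrite big_cons mulrA -[RHS]IH; congr (_ * _).
  have [c' [A' Hu']] := tpker_dec _ _ Hu.
  have [E1 E2] := resolvent_fourier R d c' A' c A w u v d0 (tpker_measurable _ _ Hu) Hu' Hv cv
    (fun x x0 => tpker_continuous0 _ _ x Hu x0)
    (fun x x0 => dv x (tpker_continuous0 _ _ x Hu x0)).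
  rewrite -E1 -E2; move: (fcos _ _ _) (fsin _ _ _) => p q; simpc.
  by congr Complex; lra.
Qed.

Lemma fcosN f w : fcos R f (- w) = fcos R f w.
Proof. by apply: eq_Rintegral => x _; rewrite mulNr cosN. Qed.

Lemma fsinN f w : mu.-integrable setT (EFin \o f) -> fsin R f (- w) = - fsin R f w.
Proof.
move=> fi; transitivity (-1 * fsin R f w); last by rewrite mulN1r.
rewrite /fsin -RintegralZl //; first by apply: eq_Rintegral => x _; rewrite mulNr sinN; ring.
by apply: integrable_mul_trig => //; [exact: continuous_sin_lin|move=> x; exact: sin_max].
Qed.

Lemma fcos_lin f g a b w : mu.-integrable setT (EFin \o f) -> mu.-integrable setT (EFin \o g) ->
  fcos R (fun x => a * f x + b * g x) w = a * fcos R f w + b * fcos R g w.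
Proof.
move=> fi gi; rewrite /fcos.
have H k : mu.-integrable setT (EFin \o k) -> mu.-integrable setT (EFin \o (fun x => k x * cos (w * x))).
  move=> ki; apply: integrable_mul_trig => //; [exact: continuous_cos_lin|move=> x; exact: cos_max].
rewrite -!RintegralZl //; [|exact: H|exact: H].
rewrite -RintegralD //; [|by apply: integrable_scale => //; exact: H|by apply: integrable_scale => //; exact: H].
by apply: eq_Rintegral => x _; ring.
Qed.

Lemma fsin_lin f g a b w : mu.-integrable setT (EFin \o f) -> mu.-integrable setT (EFin \o g) ->
  fsin R (fun x => a * f x + b * g x) w = a * fsin R f w + b * fsin R g w.
Proof.
move=> fi gi; rewrite /fsin.
have H k : mu.-integrable setT (EFin \o k) -> mu.-integrable setT (EFin \o (fun x => k x * sin (w * x))).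
  move=> ki; apply: integrable_mul_trig => //; [exact: continuous_sin_lin|move=> x; exact: sin_max].
rewrite -!RintegralZl //; [|exact: H|exact: H].
rewrite -RintegralD //; [|by apply: integrable_scale => //; exact: H|by apply: integrable_scale => //; exact: H].
by apply: eq_Rintegral => x _; ring.
Qed.

Lemma fourierE (g : R -> C) xi : cintegrable setT g ->
  fourier g xi = Complex
    (fcos R (fun x => complex.Re (g x)) (2 * pi * xi) + fsin R (fun x => complex.Im (g x)) (2 * pi * xi))
    (fcos R (fun x => complex.Im (g x)) (2 * pi * xi) - fsin R (fun x => complex.Re (g x)) (2 * pi * xi)).
Proof.
move=> [gr gi]; rewrite /fourier /cint; set w := 2 * pi * xi.
have E x : 2 * pi * - (x * xi) = - (w * x) by rewrite /w; ring.
have Hc k : mu.-integrable setT (EFin \o k) -> mu.-integrable setT (EFin \o (fun x => k x * cos (w * x))).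
  move=> ki; apply: integrable_mul_trig => //; [exact: continuous_cos_lin|move=> x; exact: cos_max].
have Hs k : mu.-integrable setT (EFin \o k) -> mu.-integrable setT (EFin \o (fun x => k x * sin (w * x))).
  move=> ki; apply: integrable_mul_trig => //; [exact: continuous_sin_lin|move=> x; exact: sin_max].
congr Complex.
- rewrite /fcos /fsin -RintegralD //; [|exact: Hc|exact: Hs].
  apply: eq_Rintegral => x _; rewrite /cexpi E cosN sinN.
  by case: (g x) => a b; simpc => /=; ring.
- rewrite /fcos /fsin -RintegralB //; [|exact: Hc|exact: Hs].
  apply: eq_Rintegral => x _; rewrite /cexpi E cosN sinN.
  by case: (g x) => a b; simpc => /=; ring.
Qed.

Lemma totally_positive_tpker (g : R -> C) m : (2 <= m)%N ->
  totally_positive_finite_type g m ->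
  continuous (fun x : R => complex.Re (g x)) -> continuous (fun x : R => complex.Im (g x)) ->
  exists ds h c, [/\ tpker ds h, (1 < size ds)%N, 0 < c & forall x, g x = (c * h x)%:C%C].
Proof.
move=> m2 [ig [c [delta [c0 [delta0 Hg]]]]] cr ci.
pose ds := [seq delta k | k <- enum 'I_m].
have dsN0 : all (fun e => e != 0) ds by apply/allP => _ /mapP [k _ ->].
have ds2 : (1 < size ds)%N by rewrite size_map size_enum_ord.
have [h Hh] : exists h, tpker ds h.
  by case: ds dsN0 ds2 => [|d s] //= /andP[d0 s0] _; exact: tpker_exists.
have ch := tpker_continuous _ _ Hh ds2.
have [e [A Hd]] := tpker_dec _ _ Hh.
have ih := expdec_integrable R _ _ _ (tpker_measurable _ _ Hh) Hd.
have Hf xi : fourier g xi = c%:C%C * Complex (fcos R h (2 * pi * xi)) (- fsin R h (2 * pi * xi)).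
  rewrite Hg; congr (_ * _).
  have := tpker_fourier _ _ (2 * pi * xi) Hh; rewrite big_map big_enum /=.
  have -> : \prod_(k < m) (1 + 'i%C * (2 * pi * xi * delta k)%:C%C) =
     \prod_(k < m) (1 + 'i%C * (2 * pi * delta k * xi)%:C%C) :> C.
    by apply: eq_bigr => k _; rewrite mulrAC.
  rewrite prodfV => H.
  have N0 : \prod_(k < m) (1 + 'i%C * (2 * pi * delta k * xi)%:C%C) != 0 :> C.
    by apply/eqP => E0; move: H; rewrite E0 mulr0 => /eqP; rewrite eq_sym oner_eq0.
  by rewrite -[RHS](mulfK N0) H mul1r.
case: (ig) => ir ii.
pose gr x := complex.Re (g x); pose gi x := complex.Im (g x).
have Hw w : fcos R gr w + fsin R gi w = c * fcos R h w /\ fcos R gi w - fsin R gr w = - (c * fsin R h w).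
  have := Hf (w / (2 * pi)); rewrite fourierE //.
  have -> : 2 * pi * (w / (2 * pi)) = w.
    by rewrite mulrC divfK // mulf_neq0 // gt_eqF // pi_gt0.
  rewrite -/gr -/gi; simpc => -[-> ->]; split=> //; ring.
(* The transform of the complex function g mixes its real and imaginary parts. Cosine transforms are
   even and sine transforms odd in w, so the equations at w and -w separate them. *)
have Hall w : [/\ fcos R gr w = c * fcos R h w, fsin R gr w = c * fsin R h w,
    fcos R gi w = 0 & fsin R gi w = 0].
  have [H1 H2] := Hw w; have := Hw (- w); rewrite !fcosN !fsinN // => -[H3 H4].
  move: (fcos R gr w) (fcos R gi w) (fsin R gr w) (fsin R gi w) (fcos R h w) (fsin R h w) H1 H2 H3 H4.
  by move=> *; split; lra.
exists ds, h, c; split => // x.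
have Egi : forall x, gi x = 0.
  apply: fourier_uniqueness => // w; have [_ _ H1 H2] := Hall w; [exact: H1|exact: H2].
have Egr : forall x, 1 * gr x + (- c) * h x = 0.
  apply: (@fourier_uniqueness R (fun x => 1 * gr x + (- c) * h x)).
  - move=> y; apply: cvgD; apply: cvgM; [exact: cvg_cst|exact: cr|exact: cvg_cst|exact: ch].
  - by apply: integrable_add => //; apply: integrable_scale.
  - move=> w; rewrite -/(fcos R _ w) fcos_lin //; have [-> _ _ _] := Hall w; ring.
  - move=> w; rewrite -/(fsin R _ w) fsin_lin //; have [_ -> _ _] := Hall w; ring.
have := Egr x; have := Egi x; rewrite /gr /gi; case: (g x) => a b /= -> H.
by congr Complex; lra.
Qed.

End Chain.

(** * The Zak transform of the kernel *)

Section SumIntegral.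
Variable R : realType.
Notation mu := (@lebesgue_measure R).

Lemma Rintegral_bigsum (D : set R) (I : Type) (s : seq I) (f : I -> R -> R) : measurable D ->
  (forall i, mu.-integrable D (EFin \o f i)) ->
  mu.-integrable D (EFin \o (fun x => \sum_(i <- s) f i x)) /\
  \int[mu]_(x in D) (\sum_(i <- s) f i x) = \sum_(i <- s) \int[mu]_(x in D) f i x.
Proof.
move=> mD fi; elim: s => [|i s [IH1 IH2]].
  rewrite big_nil (_ : (fun x => _) = fun=> 0); last by apply/funext => x; rewrite big_nil.
  split; last by rewrite Rintegral_cst // mul0r.
  exact: integrable0.
rewrite big_cons (_ : (fun x => _) = fun x => f i x + \sum_(j <- s) f j x); last first.
  by apply/funext => x; rewrite big_cons.
by split; [exact: integrable_add|rewrite RintegralD // IH2].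
Qed.

(** The partial sums are bounded by 3 A / (1 - r), uniformly in N and t, which is an integrable
    majorant on a bounded interval. *)
Lemma Rintegral_zs (x y A r : R) (f : int -> R -> R) : 0 <= r < 1 ->
  (forall k, measurable_fun setT (f k)) ->
  (forall t, x <= t <= y -> expb A r (f ^~ t)) ->
  mu.-integrable `[x, y] (EFin \o (fun t => zs (f ^~ t))) /\
  \int[mu]_(t in `[x, y]) zs (f ^~ t) = zs (fun k => \int[mu]_(t in `[x, y]) f k t).
Proof.
move=> Hr mf Hf; have /andP[r0 r1] := Hr.
have mI : measurable (`[x, y]%classic : set R) by exact: measurable_itv.
have Hin t : (`[x, y]%classic : set R) t -> x <= t <= y by rewrite /= in_itv.
have ifk k : mu.-integrable `[x, y] (EFin \o f k).
  apply: (integrable_bounded_itv R x y A) => // t /Hf H.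
  have A0 := expb_ge0 _ _ _ _ H.
  by rewrite (le_trans (H k)) // ler_piMr // exprn_ile1 // ltW.
have Hs N := Rintegral_bigsum (`[x, y]%classic) _ (index_enum 'I_(2 * N).+1)
  (fun i => f (i%:Z - N%:Z)) mI (fun i => ifk _).
have [||||i1 cv] := @Rintegral_dominated_cvg_pt R (`[x, y]%classic)
  (fun N t => zpart (f ^~ t) N) (fun t => zs (f ^~ t)) (fun=> 3 * A / (1 - r)) mI.
- by move=> N; have [/integrable_measurable] := Hs N.
- by move=> t /Hin /Hf H; exact: zs_cvg Hr H.
- apply: continuous_compact_integrable; first exact: segment_compact.
  by apply: continuous_subspaceT => t; exact: cvg_cst.
- by move=> N t /Hin /Hf H; exact: zpart_bound.
split=> //; apply/esym/cvg_lim => //.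
rewrite (_ : zpart _ = fun N => \int[mu]_(t in `[x, y]) zpart (f ^~ t) N) //.
by apply/funext => N; have [_ ->] := Hs N.
Qed.

Lemma integral_continuous (W f : R -> R) :
  (forall x y, x <= y -> mu.-integrable `[x, y] (EFin \o f)) ->
  (forall x y, x <= y -> exists B, forall t, x <= t <= y -> `|f t| <= B) ->
  (forall x y, x <= y -> W y - W x = \int[mu]_(t in `[x, y]) f t) -> continuous W.
Proof.
move=> fi fb HW x; have [|B HB] := fb (x - 1) (x + 1); first lra.
have B0 : 0 <= B by apply: le_trans (HB x _); rewrite ?normr_ge0 //; lra.
have lip a b : x - 1 <= a -> a <= b -> b <= x + 1 -> `|W b - W a| <= (B + 1) * (b - a).
  move=> xa ab bx; rewrite HW //; apply: Rintegral_itv_bound => //; first exact: fi.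
  by move=> t /andP[H1 H2]; rewrite (le_trans (HB t _)) ?lerDl //; lra.
apply/cvgrPdist_lt => e e0; near=> y.
have y1 : `|x - y| < 1 by near: y; apply: (@cvgr_dist_lt _ _ _ _ _ id x cvg_id).
have yC : `|x - y| < e / (B + 1).
  near: y; apply: (@cvgr_dist_lt _ _ _ _ _ id x cvg_id); rewrite divr_gt0 //; lra.
rewrite ltr_pdivlMr in yC; last lra.
rewrite mulrC in yC; apply: le_lt_trans yC; move: y1; rewrite ltr_norml => /andP[y1 y2].
have [xy|yx] := leP x y.
  rewrite distrC [`|x - y|]distrC [`|y - x|]ger0_norm ?subr_ge0 //.
  by apply: lip; lra.
rewrite [`|x - y|]ger0_norm; last by rewrite subr_ge0 ltW.
by apply: lip; lra.
Unshelve. all: by end_near. Qed.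

End SumIntegral.

Section Zak.
Variable R : realType.
Notation mu := (@lebesgue_measure R).
Variable T : R.
Hypothesis T0 : 0 < T.

(** For s = cos and s = sin these are the real and the imaginary part of the Zak transform, for real
    h and period T. *)
Definition zaks (s : R -> R) (h : R -> R) (phi x : R) :=
  zs (fun k : int => h (x - k%:~R * T) * s (k%:~R * phi)).

Lemma expdec_expb (c A : R) (h : R -> R) (x : R) : expdec R c A h ->
  0 < expR (- c * T) < 1 /\
  expb (A * expR (c * `|x|)) (expR (- c * T)) (fun k : int => h (x - k%:~R * T)).
Proof.
move=> Hd; have A0 := expdec_ge0 _ _ _ _ Hd; have [c0 Hh] := Hd; split.
  by rewrite expR_gt0 expR_lt1 mulNr oppr_lt0 mulr_gt0.
move=> k; rewrite (le_trans (Hh _)) // -mulrA ler_wpM2l //.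
rewrite -expRM_natr -expRD ler_expR.
have H : `|k|%N%:R * T <= `|x - k%:~R * T| + `|x|.
  have -> : `|k|%N%:R * T = `|k%:~R * T|.
    by rewrite normrM (gtr0_norm T0) -intr_norm -abszE.
  by rewrite -{1}[k%:~R * T](subrK x) (le_trans (ler_normD _ _)) // distrC.
by nra.
Qed.

Lemma zaks_expb (c A : R) (h s : R -> R) (phi x : R) : expdec R c A h -> (forall t, `|s t| <= 1) ->
  expb (A * expR (c * `|x|)) (expR (- c * T)) (fun k : int => h (x - k%:~R * T) * s (k%:~R * phi)).
Proof.
by move=> Hd s1; have [_ H] := expdec_expb _ _ _ x Hd; apply: expbM.
Qed.

Lemma zaks_bounded (c A : R) (h s : R -> R) (phi a b : R) : expdec R c A h -> (forall t, `|s t| <= 1) ->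
  exists B, forall t, a <= t <= b -> `|zaks s h phi t| <= B.
Proof.
move=> Hd s1; have A0 := expdec_ge0 _ _ _ _ Hd; have [c0 _] := Hd.
exists (3 * (A * expR (c * (`|a| + `|b|))) / (1 - expR (- c * T))) => t /andP[at_ tb].
have [/andP[r0 r1] _] := expdec_expb _ _ _ t Hd.
apply: le_trans (zs_bound _ _ _ _ _ (zaks_expb _ _ _ s phi t Hd s1)) _; first by rewrite ltW.
have r2 : 0 <= (1 - expR (- c * T))^-1 by rewrite invr_ge0 subr_ge0 ltW.
have c1 : 0 <= c by exact: ltW.
rewrite ler_wpM2r // ler_wpM2l // ler_wpM2l // ler_expR ler_wpM2l //.
rewrite ler_norml; apply/andP; split.
  by have := ler_norm (- a); have := normr_ge0 b; rewrite normrN; lra.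
by have := ler_norm b; have := normr_ge0 a; lra.
Qed.

(** Shifting the index by 1 gives Z(x + T) = e^(i phi) Z(x), written here in coordinates. *)
Lemma zakcos_shift (c A : R) (h : R -> R) (phi x : R) : expdec R c A h ->
  zaks cos h phi (x + T) = cos phi * zaks cos h phi x - sin phi * zaks sin h phi x /\
  zaks sin h phi (x + T) = sin phi * zaks cos h phi x + cos phi * zaks sin h phi x.
Proof.
move=> Hd; have [Hr _] := expdec_expb _ _ _ x Hd; have Hr' : 0 <= expR (- c * T) < 1 by lra.
have Hc := zaks_expb _ _ _ cos phi x Hd (@cos_max R).
have Hs := zaks_expb _ _ _ sin phi x Hd (@sin_max R).
have Hc' := zaks_expb _ _ _ cos phi (x + T) Hd (@cos_max R).
have Hs' := zaks_expb _ _ _ sin phi (x + T) Hd (@sin_max R).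
have E (k : int) : x + T - (k + 1)%:~R * T = x - k%:~R * T by rewrite rmorphD /=; ring.
have Ea (k : int) : (k + 1)%:~R * phi = k%:~R * phi + phi by rewrite rmorphD /=; ring.
split; rewrite /zaks.
- rewrite -(zs_shift1 _ _ _ _ Hr' Hc') -mulNr -!(zsZ _ _ _ _ _ Hr' Hc) -!(zsZ _ _ _ _ _ Hr' Hs).
  rewrite -(zsD _ _ _ _ _ _ Hr' (expbZ _ _ _ _ _ Hc) (expbZ _ _ _ _ _ Hs)).
  by apply: eq_zs => k; rewrite E Ea cosD /=; ring.
- rewrite -(zs_shift1 _ _ _ _ Hr' Hs') -!(zsZ _ _ _ _ _ Hr' Hc) -!(zsZ _ _ _ _ _ Hr' Hs).
  rewrite -(zsD _ _ _ _ _ _ Hr' (expbZ _ _ _ _ _ Hc) (expbZ _ _ _ _ _ Hs)).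
  by apply: eq_zs => k; rewrite E Ea sinD /=; ring.
Qed.

(** Translation by k T multiplies both sides of the integrated equation by the same factor e^(-k
    T/d). Hence the equation holds for each translate, and by [Rintegral_zs] for the weighted
    sum. *)
Lemma zaks_relation (c A c' A' d : R) (u v s : R -> R) (phi : R) : measurable_fun setT u ->
  expdec R c A u -> expdec R c' A' v -> (forall t, `|s t| <= 1) ->
  (forall x y, x <= y -> expR (y / d) * v y - expR (x / d) * v x =
       d^-1 * \int[mu]_(t in `[x, y]) (expR (t / d) * u t)) ->
  forall x y, x <= y -> mu.-integrable `[x, y] (EFin \o (fun t => expR (t / d) * zaks s u phi t)) /\
     expR (y / d) * zaks s v phi y - expR (x / d) * zaks s v phi x =
       d^-1 * \int[mu]_(t in `[x, y]) (expR (t / d) * zaks s u phi t).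
Proof.
move=> mu_ Hu Hv s1 rel x y xy.
have A0 := expdec_ge0 _ _ _ _ Hu.
have [Hr _] := expdec_expb _ _ _ x Hu; have Hr' : 0 <= expR (- c * T) < 1 by lra.
have [Hq _] := expdec_expb _ _ _ x Hv; have Hq' : 0 <= expR (- c' * T) < 1 by lra.
pose f (k : int) t := expR (t / d) * (u (t - k%:~R * T) * s (k%:~R * phi)).
pose B := expR ((`|x| + `|y|) * `|d^-1|) * (A * expR (c * (`|x| + `|y|))).
have mtr (k : int) : measurable_fun setT (fun t : R => u (t - k%:~R * T)).
  rewrite (_ : (fun t => _) = u \o affR R 1 (- (k%:~R * T))); last first.
    by apply/funext => t; rewrite /= /affR mul1r.
  by apply: measurableT_comp => //; exact: measurable_affR.
have mf k : measurable_fun setT (f k).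
  apply: measurable_funM; first by apply: measurable_continuous => //; exact: continuous_expR_div.
  by apply: measurable_funM.
have Hf t : x <= t <= y -> expb B (expR (- c * T)) (f ^~ t).
  move=> xty k; rewrite /f normrM ger0_norm ?expR_ge0 // /B -[leRHS]mulrA.
  apply: ler_pM => //; first exact: expR_div_bound.
  apply: le_trans (zaks_expb _ _ _ s phi t Hu s1 k) _.
  rewrite ler_wpM2r ?exprn_ge0 ?expR_ge0 // ler_wpM2l // ler_expR ler_wpM2l //; first by rewrite ltW //; case: Hu.
  have /andP[xt ty] := xty.
  rewrite ler_norml; apply/andP; split.
    by have := ler_norm (- x); have := normr_ge0 y; rewrite normrN; lra.
  by have := ler_norm y; have := normr_ge0 x; lra.
have Ez t : zs (f ^~ t) = expR (t / d) * zaks s u phi t.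
  exact: zsZ Hr' (zaks_expb _ _ _ s phi t Hu s1).
have [i1 E1] := Rintegral_zs R x y B _ f Hr' mf Hf.
rewrite (_ : (fun t => zs (f^~ t)) = (fun t => expR (t / d) * zaks s u phi t)) in i1 E1; last exact/funext.
split=> //.
have Hvx := zaks_expb _ _ _ s phi x Hv s1; have Hvy := zaks_expb _ _ _ s phi y Hv s1.
rewrite E1 -mulNr -(zsZ _ _ _ _ _ Hq' Hvx) -(zsZ _ _ _ _ _ Hq' Hvy).
rewrite -(zsD _ _ _ _ _ _ Hq' (expbZ _ _ _ _ _ Hvy) (expbZ _ _ _ _ _ Hvx)).
have Hint : expb (B * (y - x)) (expR (- c * T)) (fun k => \int[mu]_(t in `[x, y]) f k t).
  move=> k; rewrite mulrAC; apply: Rintegral_itv_bound => //.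
    apply: (integrable_bounded_itv R x y B) => // t /Hf H.
    rewrite (le_trans (H k)) // ler_piMr ?(expb_ge0 _ _ _ _ H) // exprn_ile1 //; lra.
  by move=> t /Hf.
rewrite -(zsZ _ _ _ _ _ Hr' Hint); apply: eq_zs => k /=.
rewrite /f.
have Eint : \int[mu]_(t in `[x, y]) (expR (t / d) * (u (t - k%:~R * T) * s (k%:~R * phi))) =
    s (k%:~R * phi) * expR (k%:~R * T / d) *
    \int[mu]_(t in `[x - k%:~R * T, y - k%:~R * T]) (expR (t / d) * u t).
  have iu a b : mu.-integrable `[a, b] (EFin \o (fun t => expR (t / d) * u t)).
    by apply: (integrable_expR_itv R d a b A) => // t; exact: expdec_bounded Hu.
  have E0 : affR R 1 (- (k%:~R * T)) @^-1` `[x - k%:~R * T, y - k%:~R * T] = `[x, y]%classic.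
    by apply/seteqP; split=> t /=; rewrite !in_itv /= /affR mul1r; lra.
  have ic : mu.-integrable `[x, y]
      (EFin \o ((fun t => expR (t / d) * u t) \o affR R 1 (- (k%:~R * T)))).
    apply: (integrable_bounded_itv R x y (expR ((`|x - k%:~R * T| + `|y - k%:~R * T|) * `|d^-1|) * A)).
      apply: measurableT_comp; last exact: measurable_affR.
      by apply: measurable_funM => //; apply: measurable_continuous => //; exact: continuous_expR_div.
    move=> t txy; rewrite /= normrM ger0_norm ?expR_ge0 //; apply: ler_pM => //.
      by apply: expR_div_bound; rewrite /affR mul1r; lra.
    exact: expdec_bounded Hu.
  have [||_ ->] := @Rintegral_translate R (- (k%:~R * T)) `[x - k%:~R * T, y - k%:~R * T]%classic
      (fun t => expR (t / d) * u t) (measurable_itv _).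
  - exact: integrable_measurable (iu _ _).
  - by rewrite E0.
  rewrite E0 -(RintegralZl _ _ ic) //.
  apply: eq_Rintegral => t _; rewrite /= /affR mul1r.
  rewrite (_ : expR (t / d) = expR (k%:~R * T / d) * expR ((t - k%:~R * T) / d)); first by ring.
  by rewrite -expRD; congr expR; ring.
transitivity (s (k%:~R * phi) * expR (k%:~R * T / d) *
   (d^-1 * \int[mu]_(t in `[x - k%:~R * T, y - k%:~R * T]) (expR (t / d) * u t))); last first.
  by rewrite Eint mulrCA.
rewrite -rel ?lerD2r //.
rewrite (_ : expR (y / d) = expR (k%:~R * T / d) * expR ((y - k%:~R * T) / d)); last first.
  by rewrite -expRD; congr expR; ring.
rewrite (_ : expR (x / d) = expR (k%:~R * T / d) * expR ((x - k%:~R * T) / d)); last first.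
  by rewrite -expRD; congr expR; ring.
ring.
Qed.

End Zak.

(** * One resolvent acting on quasi-periodic curves *)

Section ZakStep.
Variable R : realType.
Notation mu := (@lebesgue_measure R).
Variables (T p q d : R).
Hypotheses (T0 : 0 < T) (pq : p ^+ 2 + q ^+ 2 = 1) (d0 : d != 0).
Variables (Uc Us Vc Vs : R -> R).
Let E t := expR (t / d).
Let Q := expR (T / d).

(* A pair (Fc, Fs) stands for the complex function Fc + i Fs, and p + i q for the
   multiplier e^(i phi); [turning] is Im (conj F(t) F(t')) >= 0 for t' within one
   period after t. *)
Definition quasiper (Fc Fs : R -> R) := forall x : R,
  Fc (x + T) = p * Fc x - q * Fs x /\ Fs (x + T) = q * Fc x + p * Fs x.
Definition turning (Fc Fs : R -> R) := forall t t' : R, t <= t' <= t + T ->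
  0 <= Fc t * Fs t' - Fs t * Fc t'.
Definition nowhere0 (Fc Fs : R -> R) := forall t : R, 0 < Fc t ^+ 2 + Fs t ^+ 2.
(* The integrated form of d g' + g = f, which makes sense without differentiability. *)
Definition resolves (f g : R -> R) := forall x y : R, x <= y ->
  mu.-integrable `[x, y] (EFin \o (fun t => expR (t / d) * f t)) /\
  expR (y / d) * g y - expR (x / d) * g x = d^-1 * \int[mu]_(t in `[x, y]) (expR (t / d) * f t).

Let E0 t : 0 < E t. Proof. exact: expR_gt0. Qed.
Let EDT t : E (t + T) = Q * E t.
Proof. by rewrite /E /Q mulrDl expRD mulrC. Qed.
Let Q0 : 0 < Q. Proof. exact: expR_gt0. Qed.

Let Q1 : Q != 1.
Proof.
rewrite -expR0; apply/eqP => /expR_inj /eqP; rewrite mulf_eq0 invr_eq0.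
by rewrite (negbTE d0) orbF gt_eqF.
Qed.

(** Both factors have the sign of d. Over one period of a T-periodic solution the integrated
    equation produces exactly this factor, so positivity passes through for both signs of d. *)
Let dQ : 0 < d * (Q - 1).
Proof.
have [d1|d1] := ltP 0 d; first by rewrite mulr_gt0 // subr_gt0 expR_gt1 divr_gt0.
have {}d1 : d < 0 by rewrite lt_neqAle d0.
by rewrite nmulr_rgt0 // subr_lt0 expR_lt1 pmulr_rlt0 // invr_lt0.
Qed.

Let int f x y := \int[mu]_(t in `[x, y]) (E t * f t).

Let relI f g x y : resolves f g -> x <= y -> d * E y * g y - d * E x * g x = int f x y.
Proof.
move=> H /H [_ H2]; rewrite -[RHS](mulVKf d0) /int /E -H2; ring.
Qed.

Let intlin f1 f2 a b x y : x <= y ->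
  mu.-integrable `[x, y] (EFin \o (fun t => E t * f1 t)) ->
  mu.-integrable `[x, y] (EFin \o (fun t => E t * f2 t)) ->
  a * int f1 x y + b * int f2 x y = \int[mu]_(t in `[x, y]) (E t * (a * f1 t + b * f2 t)) /\
  mu.-integrable `[x, y] (EFin \o (fun t => E t * (a * f1 t + b * f2 t))).
Proof.
move=> xy i1 i2; have mI : measurable (`[x, y]%classic : set R) by exact: measurable_itv.
rewrite (_ : (fun t => E t * _) = fun t => a * (E t * f1 t) + b * (E t * f2 t)); last first.
  by apply/funext => t; ring.
split; last by apply: integrable_add => //; exact: integrable_scale.
rewrite RintegralD //; [|exact: integrable_scale|exact: integrable_scale].
by rewrite !RintegralZl.
Qed.

Let intlin_ge0 f1 f2 a b x y : x <= y ->
  mu.-integrable `[x, y] (EFin \o (fun t => E t * f1 t)) ->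
  mu.-integrable `[x, y] (EFin \o (fun t => E t * f2 t)) ->
  (forall t, x <= t <= y -> 0 <= a * f1 t + b * f2 t) ->
  0 <= a * int f1 x y + b * int f2 x y.
Proof.
move=> xy i1 i2 H; have [-> _] := intlin _ _ a b _ _ xy i1 i2.
by apply: Rintegral_ge0 => t /=; rewrite in_itv /= => /H; exact: mulr_ge0 (ltW (E0 t)).
Qed.

Let intlin_gt0 f1 f2 a b x y : x < y ->
  mu.-integrable `[x, y] (EFin \o (fun t => E t * f1 t)) ->
  mu.-integrable `[x, y] (EFin \o (fun t => E t * f2 t)) ->
  (forall t, x < t < y -> 0 < a * f1 t + b * f2 t) ->
  0 < a * int f1 x y + b * int f2 x y.
Proof.
move=> xy i1 i2 H; have [-> i3] := intlin _ _ a b _ _ (ltW xy) i1 i2.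
have mI : measurable (`]x, y[%classic : set R) by exact: measurable_itv.
have i4 : mu.-integrable `]x, y[ (EFin \o (fun t => E t * (a * f1 t + b * f2 t))).
  by apply: integrableS i3 => // t /=; rewrite !in_itv /= => /andP[/ltW -> /ltW ->].
have i5 : mu.-integrable `[x, y[ (EFin \o (fun t => E t * (a * f1 t + b * f2 t))).
  by apply: integrableS i3 => // t /=; rewrite !in_itv /= => /andP[-> /ltW ->].
rewrite -Rintegral_itv_bndo_bndc // -Rintegral_itv_obnd_cbnd //.
apply: Rintegral_gt0 => //.
  by rewrite lebesgue_measure_itv /= lte_fin xy lte_fin subr_gt0.
by move=> t /=; rewrite in_itv /= => /H; exact: mulr_gt0.
Qed.

(** Let z = p + i q, let A and B be the integrals of E U over [x, y] and [y - T, x], and X = d E(x)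
    V(x). Then d E(y) V(y) = X + A, and quasi-periodicity gives (Q z - 1) X = A + Q z B. So Im(conj
    V(x) V(y)) has the sign of Im(conj X A), and |Q z - 1|^2 Im(conj X A) equals Q q |A|^2 plus Q
    times the sum of Q Im(conj B A) and Im(conj A z B). *)
Lemma turning_step : 0 < q -> quasiper Uc Us -> quasiper Vc Vs ->
  resolves Uc Vc -> resolves Us Vs -> turning Uc Us -> turning Vc Vs.
Proof.
move=> q0 qU qV rc rs tU x y /andP[xy yT].
have yx : y - T <= x by lra.
have [iAc _] := rc _ _ xy; have [iAs _] := rs _ _ xy.
have [iBc _] := rc _ _ yx; have [iBs _] := rs _ _ yx.
have EA1 := relI _ _ _ _ rc xy; have EA2 := relI _ _ _ _ rs xy.
have EB1 := relI _ _ _ _ rc yx; have EB2 := relI _ _ _ _ rs yx.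
(* A double integral over s in [y - T, x] and t in [x, y]. There s <= t <= s + T and t <= s + T <= t
   + T, so [turning] makes Im(conj U(s) U(t)) and Im(conj U(t) U(s + T)) nonnegative. *)
have key : 0 <= Q * (int Uc (y - T) x * int Us x y - int Us (y - T) x * int Uc x y)
   + (int Uc x y * (q * int Uc (y - T) x + p * int Us (y - T) x)
     - int Us x y * (p * int Uc (y - T) x - q * int Us (y - T) x)).
  rewrite (_ : _ + _ = (- Q * int Us (y - T) x + (q * int Uc (y - T) x + p * int Us (y - T) x)) * int Uc x y
    + (Q * int Uc (y - T) x - (p * int Uc (y - T) x - q * int Us (y - T) x)) * int Us x y); last by ring.
  apply: intlin_ge0 => // t /andP[xt ty].
  rewrite (_ : _ + _ = (Q * Us t + q * Uc t - p * Us t) * int Uc (y - T) x +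
     (- Q * Uc t + p * Uc t + q * Us t) * int Us (y - T) x); last by ring.
  apply: intlin_ge0 => // s /andP[ys sx].
  have H1 := tU s t; have H2 := tU t (s + T); have [Hc Hs] := qU s.
  rewrite Hc Hs in H2.
  have {}H1 : 0 <= Q * (Uc s * Us t - Us s * Uc t) by rewrite mulr_ge0 ?H1 ?(ltW Q0) //; lra.
  have {}H2 := H2 (ltac:(lra)).
  lra.
have [Vc1 Vs1] := qV (y - T); rewrite subrK in Vc1 Vs1.
have EyT := EDT (y - T); rewrite subrK in EyT.
move: key EA1 EA2 EB1 EB2; rewrite Vc1 Vs1 EyT.
move: (int Uc x y) (int Us x y) (int Uc (y - T) x) (int Us (y - T) x) => Ac As Bc Bs key EA1 EA2 EB1 EB2.
set D := (p * Q - 1) ^+ 2 + (q * Q) ^+ 2.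
have D0 : 0 < D.
  by rewrite ltr_wpDl ?sqr_ge0 // exprn_gt0 // mulr_gt0.
have main : 0 <= (d * E x * Vc x) * As - (d * E x * Vs x) * Ac.
  rewrite -(pmulr_rge0 _ D0).
  rewrite (_ : D * _ = Q * q * (Ac ^+ 2 + As ^+ 2) + Q * (Q * (Bc * As - Bs * Ac) + (Ac * (q * Bc + p * Bs) - As * (p * Bc - q * Bs)))).
    apply: addr_ge0; last by apply: mulr_ge0 => //; exact: ltW.
    by apply: mulr_ge0; [apply: mulr_ge0; exact: ltW|apply: addr_ge0; exact: sqr_ge0].
  have EX : (p * Q - 1) * (d * E x * Vc x) - q * Q * (d * E x * Vs x) = Ac + Q * (p * Bc - q * Bs).
    by rewrite -EA1 -EB1 -EB2; ring.
  have EY : q * Q * (d * E x * Vc x) + (p * Q - 1) * (d * E x * Vs x) = As + Q * (q * Bc + p * Bs).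
    by rewrite -EA2 -EB1 -EB2; ring.
  rewrite (_ : D * _ =
    ((p * Q - 1) * ((p * Q - 1) * (d * E x * Vc x) - q * Q * (d * E x * Vs x)) +
      q * Q * (q * Q * (d * E x * Vc x) + (p * Q - 1) * (d * E x * Vs x))) * As -
    ((p * Q - 1) * (q * Q * (d * E x * Vc x) + (p * Q - 1) * (d * E x * Vs x)) -
      q * Q * ((p * Q - 1) * (d * E x * Vc x) - q * Q * (d * E x * Vs x))) * Ac); last by rewrite /D; ring.
  (* The two sides differ by a multiple of p^2 + q^2 - 1, which is inserted as a zero. *)
  rewrite EX EY -[RHS]addr0 -[X in _ = _ + X](mul0r (Q ^+ 2 * (Bc * As - Bs * Ac))).
  by have <- : p ^+ 2 + q ^+ 2 - 1 = 0; [rewrite pq subrr|ring].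
have dE0 : 0 < d ^+ 2 * (E x * (Q * E (y - T))).
  by rewrite mulr_gt0 ?exprn_even_gt0 // !mulr_gt0.
rewrite -(pmulr_rge0 _ dE0).
rewrite [leRHS](_ : _ = (d * E x * Vc x) * (d * (Q * E (y - T)) * (q * Vc (y - T) + p * Vs (y - T))) -
   (d * E x * Vs x) * (d * (Q * E (y - T)) * (p * Vc (y - T) - q * Vs (y - T)))); last by ring.
have -> : d * (Q * E (y - T)) * (q * Vc (y - T) + p * Vs (y - T)) = As + d * E x * Vs x by rewrite -EA2 subrK.
have -> : d * (Q * E (y - T)) * (p * Vc (y - T) - q * Vs (y - T)) = Ac + d * E x * Vc x by rewrite -EA1 subrK.
by rewrite [leRHS](_ : _ = d * E x * Vc x * As - d * E x * Vs x * Ac) //; ring.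
Qed.

(** If V(x) = 0, then V(x + T) = 0 and the integral of E U over [x, x + T] is 0. But Im(conj U(x)
    U(t)) + Im(conj U(t) U(x + T)) is positive for every t inside: both terms are nonnegative, and
    if both vanish, U(t) is parallel to the independent vectors U(x) and z U(x), z = p + i q, hence
    0. *)
Lemma nowhere0_step : 0 < q -> quasiper Uc Us -> quasiper Vc Vs ->
  resolves Uc Vc -> resolves Us Vs -> turning Uc Us -> nowhere0 Uc Us -> nowhere0 Vc Vs.
Proof.
move=> q0 qU qV rc rs tU nU x.
rewrite lt_neqAle addr_ge0 ?sqr_ge0 // andbT eq_sym paddr_eq0 ?sqr_ge0 // !sqrf_eq0.
apply/negP => /andP[/eqP Vc0 /eqP Vs0].
have xT : x <= x + T by rewrite lerDl ltW.
have [iAc _] := rc _ _ xT; have [iAs _] := rs _ _ xT.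
have EA1 := relI _ _ _ _ rc xT; have EA2 := relI _ _ _ _ rs xT.
have [Vc1 Vs1] := qV x; rewrite Vc1 Vs1 Vc0 Vs0 !mulr0 subrr addr0 ?mulr0 ?subrr in EA1 EA2.
have : 0 < (q * Uc x + p * Us x - Us x) * int Uc x (x + T) + (Uc x - (p * Uc x - q * Us x)) * int Us x (x + T).
  apply: intlin_gt0 => //; first by rewrite ltrDl.
  move=> t /andP[xt tx].
  have H1 : 0 <= Uc x * Us t - Us x * Uc t by apply: tU; lra.
  have H2 : 0 <= Uc t * (q * Uc x + p * Us x) - Us t * (p * Uc x - q * Us x).
    by have [<- <-] := qU x; apply: tU; lra.
  have := nU t; have := nU x.
  move: (Uc x) (Us x) (Uc t) (Us t) H1 H2 => a b u v H1 H2 ab uv.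
  rewrite (_ : _ + _ = (a * v - b * u) + (u * (q * a + p * b) - v * (p * a - q * b))); last by ring.
  rewrite lt_neqAle addr_ge0 // andbT eq_sym paddr_eq0 //.
  apply/negP => /andP[/eqP e1 /eqP e2].
  have e3 : q * (u * a + v * b) = 0.
    by rewrite -[RHS]e2 -[RHS]addr0 -[X in _ = _ + X](mulr0 p) -e1; ring.
  have {}e3 : u * a + v * b = 0 by apply: (mulfI (lt0r_neq0 q0)); rewrite e3 mulr0.
  have : (a ^+ 2 + b ^+ 2) * (u ^+ 2 + v ^+ 2) = (a * v - b * u) ^+ 2 + (u * a + v * b) ^+ 2 by ring.
  rewrite e1 e3 expr0n addr0 /= => /eqP; rewrite mulf_eq0 !gt_eqF //.
by rewrite -EA1 -EA2 !mulr0 addr0 ltxx.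
Qed.

Lemma positive_step : p = 1 -> q = 0 -> quasiper Uc Us -> quasiper Vc Vs ->
  resolves Uc Vc -> (forall t, 0 < Uc t) -> forall t, 0 < Vc t.
Proof.
move=> p1 q0 qU qV rc pU x.
have xT : x < x + T by rewrite ltrDl.
have [iAc _] := rc _ _ (ltW xT).
have := relI _ _ _ _ rc (ltW xT).
have [-> _] := qV x; rewrite p1 q0 mul0r subr0 mul1r EDT.
have : 0 < 1 * int Uc x (x + T) + 0 * int Uc x (x + T).
  by apply: intlin_gt0 => // t _; rewrite mul1r mul0r addr0.
rewrite mul1r mul0r addr0 => H EA; rewrite -EA in H.
rewrite -(pmulr_rgt0 _ (_ : 0 < E x * (d * (Q - 1)))); first by move: H; rewrite (_ : _ - _ = E x * (d * (Q - 1)) * Vc x) //; ring.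
exact: mulr_gt0.
Qed.

(** With F(x + T) = - F(x) this fixes the sign of F on every interval between consecutive points of
    y0 + T Z. The sign chosen after y0 is +, so y0 is determined modulo 2 T. *)
Definition alternates (F : R -> R) := exists y0 : R, forall t : R, y0 < t < y0 + T -> 0 < F t.

(** I = d E V increases strictly on [y0, y0 + T], where U is positive, and I(x + T) = - Q I(x) gives
    the end values opposite signs. The zero y1 between them is the new place of the sign change. *)
Lemma alternates_step : p = -1 -> q = 0 -> quasiper Uc Us -> quasiper Vc Vs ->
  resolves Uc Vc -> continuous Vc -> alternates Uc -> alternates Vc.
Proof.
move=> p1 q0 qU qV rc cV [y0 pU].
pose I x := d * E x * Vc x.
have IT x : I (x + T) = - Q * I x.
  by rewrite /I; have [-> _] := qV x; rewrite p1 q0 EDT; ring.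
have Iinc x y : y0 <= x -> x < y -> y <= y0 + T -> I x < I y.
  move=> yx xy yT; have [iAc _] := rc _ _ (ltW xy).
  rewrite -subr_gt0 (relI _ _ _ _ rc (ltW xy)).
  have : 0 < 1 * int Uc x y + 0 * int Uc x y.
    apply: intlin_gt0 => // t /andP[xt ty]; rewrite mul1r mul0r addr0; apply: pU; lra.
  by rewrite mul1r mul0r addr0.
have y0T : y0 < y0 + T by rewrite ltrDl.
have I0 : I y0 < 0.
  have := Iinc _ _ (lexx _) y0T (lexx _); rewrite IT.
  by have := Q0; nra.
have I1 : 0 < I (y0 + T) by rewrite IT; have := Q0; nra.
have cI : continuous I.
  move=> x; apply: cvgM; last exact: cV.
  by apply: cvgM; [exact: cvg_cst|exact: continuous_expR_div].
have [y1 y1I Iy1] : exists2 y1, y1 \in `[y0, y0 + T] & I y1 = 0.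
  apply: IVT; [exact: ltW|exact: continuous_subspaceT|].
  by rewrite ge_min le_max (ltW I0) (ltW I1) orbT.
have N0 : y0 != y1 by apply/eqP => E1; move: I0; rewrite E1 Iy1 ltxx.
have N1 : y1 != y0 + T by apply/eqP => E1; move: I1; rewrite -E1 Iy1 ltxx.
have /andP[y01 y1T] : y0 < y1 < y0 + T.
  by move: y1I; rewrite in_itv /= => /andP[H1 H2]; rewrite !lt_neqAle N0 N1 H1 H2.
have Ipos t : y1 < t < y1 + T -> 0 < I t.
  move=> /andP[H1 H2]; have [tT|tT] := leP t (y0 + T).
    by rewrite -Iy1; apply: Iinc => //; exact: ltW.
  have H : I (t - T) < 0 by rewrite -Iy1; apply: Iinc; lra.
  by have := IT (t - T); rewrite subrK => ->; rewrite mulNr oppr_gt0 pmulr_rlt0.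
have [d1|d1] := ltP 0 d.
  exists y1 => t /Ipos; rewrite /I pmulr_rgt0 //; exact: mulr_gt0.
have {}d1 : d < 0 by rewrite lt_neqAle d0.
(* For d < 0 the function V is negative just after y1; moving on by one period restores the sign. *)
exists (y1 + T) => t /andP[H1 H2].
have Ht : y1 < t - T < y1 + T by lra.
have := Ipos _ Ht; rewrite /I -mulrA nmulr_rgt0 // pmulr_rlt0 //.
have [] := qV (t - T); rewrite subrK p1 q0 => -> _; lra.
Qed.

End ZakStep.

Section Periodicity.
Variable R : realType.
Variable T : R.
Hypothesis T0 : 0 < T.

Lemma periodic_int (g : R -> R) : (forall x, g (x + T) = g x) ->
  forall (n : int) x, g (x + n%:~R * T) = g x.
Proof.
move=> H; have Hn (n : nat) x : g (x + n%:R * T) = g x.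
  elim: n => [|n IH]; first by rewrite mul0r addr0.
  by rewrite -[n.+1]addn1 natrD mulrDl mul1r addrA H IH.
case=> n x; first exact: Hn.
by rewrite NegzE -[in RHS](subrK (n.+1%:R * T) x) Hn rmorphN /= mulNr.
Qed.

Lemma reduce_mod (a x : R) : exists n : int, a <= x - n%:~R * T < a + T.
Proof.
exists (Num.floor ((x - a) / T)).
have := floor_le ((x - a) / T); have := lt_succ_floor ((x - a) / T).
rewrite rmorphD /= ltr_pdivrMr // ler_pdivlMr //; lra.
Qed.

Lemma alternates_nonzero F : (forall x, F (x + T) = - F x) -> alternates R T F ->
  exists y0 : R, forall x, F x = 0 -> exists n : int, x = y0 + n%:~R * T.
Proof.
move=> HF [y0 H]; exists y0 => x Fx.
have [n /andP[H1 H2]] := reduce_mod y0 x; exists n.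
(* The square is T-periodic, which transports a zero into the period after y0. *)
have HF2 : forall x, (fun x => F x ^+ 2) (x + T) = (fun x => F x ^+ 2) x.
  by move=> t /=; rewrite HF sqrrN.
have := periodic_int _ HF2 n (x - n%:~R * T); rewrite /= subrK Fx expr0n /= => /esym/eqP.
rewrite sqrf_eq0 => /eqP F0.
move: H1; rewrite le_eqVlt => /orP[/eqP -> |H1]; first by rewrite subrK.
by have := H (x - n%:~R * T); rewrite H1 H2 F0 ltxx => /(_ isT).
Qed.

End Periodicity.

(** * Zeros of the Zak transform *)

Section ZakNonvanishing.
Variable R : realType.
Notation mu := (@lebesgue_measure R).
Variable T : R.
Hypothesis T0 : 0 < T.

Let zc h phi := zaks R T cos h phi.
Let zsn h phi := zaks R T sin h phi.

Let quasiper_zak c A h phi : expdec R c A h ->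
  quasiper R T (cos phi) (sin phi) (zc h phi) (zsn h phi).
Proof. by move=> Hd x; apply: zakcos_shift T0 _ _ _ _ _ Hd. Qed.

(** For 0 <= x < T no translate crosses its jump, so all terms carry the common factor e^(-x/d). *)
Lemma expside_zak_itv d s phi x : 0 <= x < T ->
  (forall t, `|s t| <= 1) -> d != 0 ->
  zaks R T s (expside R d) phi x = expR (- x / d) * zaks R T s (expside R d) phi 0.
Proof.
move=> /andP[x0 xT] s1 d0; have Hd := expside_dec R _ d0.
have [Hr _] := expdec_expb R T T0 _ _ _ 0 Hd.
rewrite -(zsZ _ _ _ _ _ _ (zaks_expb R T T0 _ _ _ s phi 0 Hd s1)); last by lra.
apply: eq_zs => k; rewrite mulrA sub0r; congr (_ * _).
rewrite addrC; apply: expside_shift.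
have [k0|k0] := lerP k 0.
  have : 0 <= - (k%:~R * T) by rewrite oppr_ge0 pmulr_lle0 // lerz0.
  by move=> H; rewrite H addr_ge0.
have H : T <= k%:~R * T by apply: ler_peMl; [exact: ltW|rewrite ler1z -gtz0_ge1].
have /negbTE -> : ~~ (0 <= - (k%:~R * T) + x) by rewrite -ltNge; have := T0; lra.
by have /negbTE -> : ~~ (0 <= - (k%:~R * T)) by rewrite -ltNge; have := T0; lra.
Qed.

(** At x = T only the translate k = 1 has crossed its jump, which contributes s(phi) / d. *)
Lemma expside_zak_jump d s phi : (forall t, `|s t| <= 1) -> d != 0 ->
  zaks R T s (expside R d) phi T =
    expR (- T / d) * zaks R T s (expside R d) phi 0 + d^-1 * s phi.
Proof.
move=> s1 d0; have Hd := expside_dec R _ d0.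
have [Hr _] := expdec_expb R T T0 _ _ _ 0 Hd.
have Hr' : 0 <= expR (- `|d|^-1 * T) < 1 by lra.
have H0 := zaks_expb R T T0 _ _ _ s phi 0 Hd s1.
rewrite -(zsZ _ _ _ _ _ Hr' H0) -[d^-1 * s phi](zs_single R 1).
have Hs : expb (`|d^-1 * s phi| * (expR (- `|d|^-1 * T))^-1) (expR (- `|d|^-1 * T))
    (fun k : int => if k == 1 then d^-1 * s phi else 0).
  move=> k; case: eqP => [->|_]; last by rewrite normr0 mulr_ge0 ?mulr_ge0 ?invr_ge0 ?exprn_ge0 ?expR_ge0.
  by rewrite expr1 mulfVK // expR_eq0.
rewrite -(zsD _ _ _ _ _ _ Hr' (expbZ _ _ _ _ _ H0) Hs).
apply: eq_zs => k /=; rewrite sub0r.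
case: eqP => [->|/eqP k1].
  rewrite !mul1r subrr (expside_jump R d (- T)) ?oppr_lt0 //; ring.
rewrite addr0 mulrA; congr (_ * _); rewrite addrC; apply: expside_shift.
have [k0|k0] := lerP k 0.
  have : 0 <= - (k%:~R * T) by rewrite oppr_ge0 pmulr_lle0 // lerz0.
  by move=> H; rewrite H addr_ge0 // ltW.
have H : 2 * T <= k%:~R * T.
  by apply: ler_wpM2r; [exact: ltW|rewrite (_ : 2 = 2%:~R) // ler_int; lia].
have /negbTE -> : ~~ (0 <= - (k%:~R * T) + T) by rewrite -ltNge; have := T0; lra.
by have /negbTE -> : ~~ (0 <= - (k%:~R * T)) by rewrite -ltNge; have := T0; lra.
Qed.

Section Base.
Variables (d phi : R).
Hypothesis d0 : d != 0.
Let Hd := expside_dec R _ d0.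
Let a := zc (expside R d) phi 0.
Let b := zsn (expside R d) phi 0.
Let Q := expR (- T / d).

(** Quasi-periodicity and the jump give two expressions for Z(T); with z = e^(i phi) they combine to
    (z - Q) (a + i b) = z / d, where now Q = e^(-T/d). *)
Let jump_eq : cos phi * a - sin phi * b = Q * a + d^-1 * cos phi /\
  sin phi * a + cos phi * b = Q * b + d^-1 * sin phi.
Proof.
have [] := quasiper_zak _ _ _ phi Hd 0; rewrite add0r => <- <-.
by split; apply: expside_zak_jump => //; [exact: cos_max|exact: sin_max].
Qed.

Let itvE x : 0 <= x < T -> zc (expside R d) phi x = expR (- x / d) * a /\
  zsn (expside R d) phi x = expR (- x / d) * b.
Proof.
by move=> Hx; split; apply: expside_zak_itv => //; [exact: cos_max|exact: sin_max].
Qed.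

Let ab0 : 0 < a ^+ 2 + b ^+ 2.
Proof.
rewrite lt_neqAle addr_ge0 ?sqr_ge0 // andbT eq_sym paddr_eq0 ?sqr_ge0 // !sqrf_eq0.
apply/negP => /andP[/eqP a0 /eqP b0]; have [] := jump_eq; rewrite a0 b0 !mulr0 subrr !add0r.
move=> /esym/eqP + /esym/eqP; rewrite !mulf_eq0 invr_eq0 (negbTE d0) /= => /eqP c0 /eqP s0.
by have := cos2Dsin2 phi; rewrite c0 s0 expr0n /= addr0 => /eqP; rewrite eq_sym oner_eq0.
Qed.

Lemma nowhere0_base : nowhere0 R (zc (expside R d) phi) (zsn (expside R d) phi).
Proof.
move=> t; have [n Hn] := reduce_mod R T T0 0 t; rewrite add0r in Hn.
pose g x := zc (expside R d) phi x ^+ 2 + zsn (expside R d) phi x ^+ 2.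
have Hg x : g (x + T) = g x.
  rewrite /g; have [-> ->] := quasiper_zak _ _ _ phi Hd x.
  rewrite -[RHS]mul1r -(cos2Dsin2 phi); ring.
rewrite -/(g t) -[t](subrK (n%:~R * T)) (periodic_int R T g Hg) /g.
have [-> ->] := itvE _ Hn; rewrite !exprMn -mulrDr.
by apply: mulr_gt0 => //; apply: exprn_gt0; exact: expR_gt0.
Qed.

(** On [0, T[ the curve stays on one ray, and at T it turns at once by the angle phi. The quantity
    is therefore 0 before T is crossed and a nonnegative multiple of sin phi afterwards. *)
Lemma turning_base : 0 <= sin phi ->
  turning R T (zc (expside R d) phi) (zsn (expside R d) phi).
Proof.
move=> q0 t t' /andP[tt tT]; have [n Hn] := reduce_mod R T T0 0 t; rewrite add0r in Hn.
have /andP[Hn1 Hn2] := Hn.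
pose g x := zc (expside R d) phi x * zsn (expside R d) phi (x + (t' - t)) -
            zsn (expside R d) phi x * zc (expside R d) phi (x + (t' - t)).
have Hg x : g (x + T) = g x.
  rewrite /g addrAC; have [-> ->] := quasiper_zak _ _ _ phi Hd x.
  have [-> ->] := quasiper_zak _ _ _ phi Hd (x + (t' - t)).
  rewrite -[RHS]mul1r -(cos2Dsin2 phi); ring.
have -> : zc (expside R d) phi t * zsn (expside R d) phi t' - zsn (expside R d) phi t * zc (expside R d) phi t' = g t.
  by rewrite /g (_ : t + (t' - t) = t') //; ring.
rewrite -[t](subrK (n%:~R * T)) (periodic_int R T g Hg) /g.
have [-> ->] := itvE _ Hn.
set x := t - n%:~R * T in Hn Hn1 Hn2 *; set y := x + (t' - t).
have xy : x <= y by rewrite /y; lra.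
have yT : y <= x + T by rewrite /y; lra.
have [y1|y1] := ltP y T.
  have [|-> ->] := itvE y; first by lra.
  rewrite [X in 0 <= X](_ : _ = 0) //; ring.
have Hy : 0 <= y - T < T by lra.
have [] := quasiper_zak _ _ _ phi Hd (y - T); rewrite subrK => -> ->.
have [-> ->] := itvE _ Hy.
rewrite [X in 0 <= X](_ : _ = expR (- x / d) * expR (- (y - T) / d) * (sin phi * (a ^+ 2 + b ^+ 2))); last by ring.
by rewrite !mulr_ge0 ?expR_ge0 // ltW.
Qed.

Lemma positive_base : cos phi = 1 -> sin phi = 0 -> forall t, 0 < zc (expside R d) phi t.
Proof.
move=> c1 s0 t; have [n Hn] := reduce_mod R T T0 0 t; rewrite add0r in Hn.
have Hg x : zc (expside R d) phi (x + T) = zc (expside R d) phi x.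
  have [-> _] := quasiper_zak _ _ _ phi Hd x; rewrite c1 s0; ring.
rewrite -[t](subrK (n%:~R * T)) (periodic_int R T _ Hg).
have [-> _] := itvE _ Hn; rewrite mulr_gt0 ?expR_gt0 //.
have [+ _] := jump_eq; rewrite c1 s0 mul1r mul0r subr0 mulr1 => Ha.
have {}Ha : (1 - Q) * a = d^-1 by lra.
have [d1|d1] := ltP 0 d.
  have Q1 : 0 < 1 - Q by rewrite subr_gt0 /Q expR_lt1 mulNr oppr_lt0 divr_gt0.
  by rewrite -(pmulr_rgt0 _ Q1) Ha invr_gt0.
have {}d1 : d < 0 by rewrite lt_neqAle d0.
have Q1 : 1 - Q < 0 by rewrite subr_lt0 /Q expR_gt1 mulNr oppr_gt0 pmulr_rlt0 // invr_lt0.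
by rewrite -(nmulr_rlt0 _ Q1) Ha invr_lt0.
Qed.

Lemma alternates_base : cos phi = -1 -> sin phi = 0 -> alternates R T (zc (expside R d) phi).
Proof.
move=> c1 s0.
have [+ _] := jump_eq; rewrite c1 s0 mul0r subr0 => Ha.
have {}Ha : (1 + Q) * a = d^-1 by lra.
have Q1 : 0 < 1 + Q by rewrite addr_gt0 // expR_gt0.
have [d1|d1] := ltP 0 d.
  exists 0 => t; rewrite add0r => /andP[t0 tT].
  have [|-> _] := itvE t; first by lra.
  by rewrite mulr_gt0 ?expR_gt0 // -(pmulr_rgt0 _ Q1) Ha invr_gt0.
have {}d1 : d < 0 by rewrite lt_neqAle d0.
exists T => t /andP[t0 tT].
have [] := quasiper_zak _ _ _ phi Hd (t - T); rewrite subrK c1 s0 => -> _.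
have [|-> _] := itvE (t - T); first by lra.
rewrite mul0r subr0 mulN1r oppr_gt0 pmulr_rlt0 ?expR_gt0 //.
by rewrite -(pmulr_rlt0 _ Q1) Ha invr_lt0.
Qed.

End Base.

Let resolves_zak c A c' A' d u v s phi : measurable_fun setT u ->
  expdec R c A u -> expdec R c' A' v -> (forall t, `|s t| <= 1) ->
  (forall x y, x <= y -> expR (y / d) * v y - expR (x / d) * v x =
       d^-1 * \int[mu]_(t in `[x, y]) (expR (t / d) * u t)) ->
  resolves R d (zaks R T s u phi) (zaks R T s v phi).
Proof. by move=> m1 h1 h2 h3 h4 x y xy; apply: (zaks_relation R T T0 c A c' A'). Qed.

(** By the integrated equation d e^(x/d) Z v(x) is an indefinite integral of a locally bounded
    function. This covers a discontinuous inner kernel u as well. *)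
Lemma zaks_continuous ds h s phi : tpker R ds h -> (1 < size ds)%N -> (forall t, `|s t| <= 1) ->
  continuous (zaks R T s h phi).
Proof.
case=> [d d0 //|d {}ds u v d0 Hu [c' [A' Hv]] cv rel _] _ s1.
have [c [A Hu']] := tpker_dec _ _ _ Hu.
have H := resolves_zak _ _ _ _ _ _ _ _ phi (tpker_measurable _ _ _ Hu) Hu' Hv s1 rel.
have cW : continuous (fun x : R => d * (expR (x / d) * zaks R T s v phi x)).
  apply: (integral_continuous R _ (fun t : R => expR (t / d) * zaks R T s u phi t)).
  - by move=> x y /H [].
  - move=> x y xy; have [B HB] := zaks_bounded R T T0 _ _ _ s phi x y Hu' s1.
    exists (expR ((`|x| + `|y|) * `|d^-1|) * B) => t txy.
    rewrite normrM ger0_norm ?expR_ge0 //; apply: ler_pM; rewrite ?expR_ge0 ?normr_ge0 //.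
      exact: expR_div_bound.
    exact: HB.
  - by move=> x y /H [_ E]; rewrite -mulrBr E mulVKf.
move=> x.
rewrite (_ : zaks R T s v phi = fun x : R => d^-1 * expR (- d^-1 * x) * (d * (expR (x / d) * zaks R T s v phi x))).
  apply: cvgM; last exact: cW.
  by apply: cvgM; [exact: cvg_cst|exact: continuous_expR_lin].
apply/funext => y; rewrite mulNr expRN [d^-1 * y]mulrC.
by field; rewrite d0 expR_eq0.
Qed.

(** One induction for the cases sin phi > 0, e^(i phi) = 1 and e^(i phi) = -1. In the first case
    [turning] is carried along because the step for [nowhere0] relies on it. *)
Let tpker_zak ds h phi : tpker R ds h ->
  [/\ 0 < sin phi -> turning R T (zc h phi) (zsn h phi) /\ nowhere0 R (zc h phi) (zsn h phi),
      cos phi = 1 -> sin phi = 0 -> forall t, 0 < zc h phi t &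
      cos phi = -1 -> sin phi = 0 -> alternates R T (zc h phi)].
Proof.
have pq := cos2Dsin2 phi; have c1 := @cos_max R; have s1 := @sin_max R.
elim=> {ds h} [d d0|d ds u v d0 Hu [IH1 IH2 IH3] [c' [A' Hv]] cv rel dv].
  split; [|exact: positive_base|exact: alternates_base].
  by move=> q0; split; [apply: turning_base => //; exact: ltW|exact: nowhere0_base].
have [c [A Hu']] := tpker_dec _ _ _ Hu.
have mu_ := tpker_measurable _ _ _ Hu.
have Rc := resolves_zak _ _ _ _ _ _ _ _ phi mu_ Hu' Hv c1 rel.
have Rs := resolves_zak _ _ _ _ _ _ _ _ phi mu_ Hu' Hv s1 rel.
have qU := quasiper_zak _ _ _ phi Hu'; have qV := quasiper_zak _ _ _ phi Hv.
split.
- move=> q0; have [tU nU] := IH1 q0; split.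
    exact: (turning_step R T _ _ d pq d0 _ _ _ _ q0 qU qV Rc Rs tU).
  exact: (nowhere0_step R T _ _ d T0 d0 _ _ _ _ q0 qU qV Rc Rs tU nU).
- move=> p1 q0; exact: (positive_step R T _ _ d T0 d0 _ _ _ _ p1 q0 qU qV Rc (IH2 p1 q0)).
- move=> p1 q0; have aU := IH3 p1 q0.
  have cV : continuous (zc v phi).
    apply: (zaks_continuous (d :: ds)) => //; last by case: (ds) Hu => // H; inversion H.
    by apply: (tpkerS _ _ _ _ _ d0 Hu) => //; exists c', A'.
  exact: (alternates_step R T _ _ d T0 d0 _ _ _ _ p1 q0 qU qV Rc cV aU).
Qed.

Lemma zak_nonzero ds h phi x : tpker R ds h -> cos phi != -1 ->
  0 < zaks R T cos h phi x ^+ 2 + zaks R T sin h phi x ^+ 2.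
Proof.
move=> Hh cN1.
have [s0|s0|s0] := ltgtP (sin phi) 0.
- have sN : 0 < sin (- phi) by rewrite sinN oppr_gt0.
  have [/(_ sN) [_ H] _ _] := tpker_zak _ _ (- phi) Hh.
  have := H x; rewrite /zc /zsn (_ : zaks R T cos h (- phi) x = zaks R T cos h phi x); last first.
    by apply: eq_zs => k; rewrite mulrN cosN.
  suff -> : zaks R T sin h (- phi) x = - zaks R T sin h phi x by rewrite sqrrN.
  have [c [A Hd]] := tpker_dec _ _ _ Hh; have [Hr _] := expdec_expb R T T0 _ _ _ x Hd.
  rewrite -[RHS]mulN1r /zaks -(zsZ _ _ _ _ _ _ (zaks_expb R T T0 _ _ _ sin phi x Hd (@sin_max R))); last by lra.
  by apply: eq_zs => k; rewrite mulrN sinN; ring.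
- by have [/(_ s0) [_ H] _ _] := tpker_zak _ _ phi Hh; exact: H.
- have c1 : cos phi = 1.
    have /eqP := cos2Dsin2 phi; rewrite s0 expr0n addr0 /= sqrf_eq1 (negbTE cN1) orbF.
    by move/eqP.
  by have [_ H _] := tpker_zak _ _ phi Hh; rewrite ltr_pwDl ?sqr_ge0 // exprn_gt0 // H.
Qed.

(** At x = T/2 the substitution k to 1 - k negates the argument of h and multiplies the weight by
    cos phi = -1, so the transform vanishes there. Its zeros lie in one coset of T Z, which must be
    that of T/2. *)
Lemma zak_even_nonzero ds h phi x : tpker R ds h -> cos phi = -1 -> (forall t, h (- t) = h t) ->
  (forall n : int, x != T / 2 + n%:~R * T) -> zaks R T cos h phi x != 0.
Proof.
move=> Hh c1 he xN.
have s0 : sin phi = 0.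
  by have /eqP := cos2Dsin2 phi; rewrite c1 sqrrN expr1n -subr_eq0 addrC addKr sqrf_eq0 => /eqP.
have [_ _ /(_ c1 s0) alt] := tpker_zak _ _ phi Hh.
have [c [A Hd]] := tpker_dec _ _ _ Hh.
have HF t : zc h phi (t + T) = - zc h phi t.
  by have [-> _] := quasiper_zak _ _ _ phi Hd t; rewrite c1 s0; ring.
have [y0 Hy] := alternates_nonzero R T T0 _ HF alt.
have half0 : zc h phi (T / 2) = 0.
  have [Hr _] := expdec_expb R T T0 _ _ _ (T / 2) Hd.
  have Hb := zaks_expb R T T0 _ _ _ cos phi (T / 2) Hd (@cos_max R).
  suff : zc h phi (T / 2) = - zc h phi (T / 2) by move=> /eqP; rewrite -addr_eq0 -mulr2n mulrn_eq0 => /eqP.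
  rewrite -[RHS]mulN1r /zc /zaks -(zsZ _ _ _ _ _ _ Hb); last by lra.
  rewrite -[LHS](zs_shift _ _ _ _ 1 Hr Hb) -[LHS]zs_reflect.
  apply: eq_zs => k.
  rewrite rmorphD rmorphN /= (_ : T / 2 - (- k%:~R + 1) * T = - (T / 2 - k%:~R * T)); last by field.
  rewrite he mulrDl mul1r mulNr cosD cosN sinN c1 s0; ring.
have [n Hn] := Hy _ half0.
apply/eqP => /Hy [k Hk]; have /eqP := xN (k - n); apply.
by rewrite Hn Hk rmorphB /=; ring.
Qed.

End ZakNonvanishing.

(** * Finite Fourier analysis and circulant systems *)

Section ComplexExp.
Variable R : realType.
Local Notation C := R[i].

Lemma cconjE (z : C) : cconj z = conjc z.
Proof. by case: z. Qed.

Lemma cabs2E (z : C) : (cabs2 z)%:C%C = z * cconj z.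
Proof. by case: z => a b; rewrite /cabs2 /cconj; simpc => /=; congr Complex; ring. Qed.

Lemma cabs2M (z w : C) : cabs2 (z * w) = cabs2 z * cabs2 w.
Proof. by case: z w => a b [a' b']; rewrite /cabs2; simpc => /=; ring. Qed.

Lemma cabs2_ge0 (z : C) : 0 <= cabs2 z.
Proof. by rewrite addr_ge0 ?sqr_ge0. Qed.

Lemma cabs2_cconj (z : C) : cabs2 (cconj z) = cabs2 z.
Proof. by case: z => a b; rewrite /cabs2 /= sqrrN. Qed.

Lemma cabs2_0 : cabs2 (0 : C) = 0.
Proof. by rewrite /cabs2 /= expr0n addr0. Qed.

Lemma cconjM (z w : C) : cconj (z * w) = cconj z * cconj w.
Proof. by rewrite !cconjE rmorphM. Qed.

Lemma cconj_sum (I : Type) (s : seq I) (F : I -> C) : cconj (\sum_(i <- s) F i) = \sum_(i <- s) cconj (F i).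
Proof. by rewrite cconjE rmorph_sum; apply: eq_bigr => i _; rewrite cconjE. Qed.

Lemma cexpiD (s t : R) : cexpi (s + t) = cexpi s * cexpi t.
Proof. by rewrite /cexpi mulrDr cosD sinD; simpc; congr Complex; ring. Qed.

Lemma cexpi0 : cexpi (0 : R) = 1.
Proof. by rewrite /cexpi mulr0 cos0 sin0. Qed.

Lemma cconj_cexpi (t : R) : cconj (cexpi t) = cexpi (- t).
Proof. by rewrite /cexpi /cconj /= mulrN cosN sinN. Qed.

Lemma cabs2_cexpi (t : R) : cabs2 (cexpi t) = 1.
Proof. by rewrite /cabs2 /= cos2Dsin2. Qed.

Lemma cexpi1 : cexpi (1 : R) = 1.
Proof. by rewrite /cexpi mulr1 mulrC mulr_natr cos2pi sin2pi. Qed.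

Lemma cexpi_int (n : int) : cexpi (n%:~R : R) = 1.
Proof.
have Hn (k : nat) : cexpi (k%:R : R) = 1.
  elim: k => [|k IH]; first exact: cexpi0.
  by rewrite -[k.+1]addn1 natrD cexpiD IH cexpi1 mulr1.
case: n => n; first exact: Hn.
by rewrite NegzE rmorphN /= -cconj_cexpi Hn /cconj /= oppr0.
Qed.

Lemma cexpiMn (t : R) (n : nat) : cexpi (t * n%:R) = cexpi t ^+ n.
Proof.
elim: n => [|n IH]; first by rewrite mulr0 cexpi0.
by rewrite -[n.+1]addn1 natrD mulrDr mulr1 cexpiD IH exprD.
Qed.

(** The fractional part u satisfies sin(pi u) = 0 with 0 <= pi u < pi, hence u = 0. *)
Lemma cos2pi_eq1 (t : R) : cos (2 * pi * t) = 1 -> exists n : int, t = n%:~R.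
Proof.
move=> H; exists (Num.floor t).
pose u := t - (Num.floor t)%:~R.
have u0 : 0 <= u by rewrite subr_ge0 floor_le.
have u1 : u < 1 by rewrite ltrBlDr addrC; have := lt_succ_floor t; rewrite rmorphD /=.
have Hu : cos (2 * pi * u) = 1.
  have : cexpi t = 1.
    by rewrite /cexpi H; congr Complex; apply: cos1sin0; rewrite H normr1.
  rewrite -[t](subrK (Num.floor t)%:~R) cexpiD cexpi_int mulr1 -/u.
  by move=> /(congr1 (@complex.Re R)).
have Hs : sin (pi * u) = 0.
  move: Hu; rewrite (_ : 2 * pi * u = (pi * u) *+ 2); last by rewrite mulr2n; ring.
  rewrite cos_mulr2n cos2sin2 => H2; apply/eqP; rewrite -sqrf_eq0; apply/eqP.
  by move: H2; rewrite mulr2n; lra.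
have pu : pi * u < pi by rewrite gtr_pMr // pi_gt0.
suff : u = 0 by move/eqP; rewrite subr_eq0 => /eqP.
apply/eqP; rewrite eq_le u0 andbT leNgt; apply/negP => up.
have /sin_gt0_pi : 0 < pi * u < pi by rewrite pu mulr_gt0 // pi_gt0.
by rewrite Hs ltxx.
Qed.

Lemma cexpi_eq1 (t : R) : cexpi t = 1 -> exists n : int, t = n%:~R.
Proof. by move=> /(congr1 (@complex.Re R)) /cos2pi_eq1. Qed.

Lemma sum_cexpi (N : nat) (d : int) : (0 < N)%N ->
  \sum_(j < N) cexpi (j%:R * d%:~R / N%:R : R) = if (N%:Z %| d)%Z then N%:R else 0.
Proof.
move=> N0; have NR : N%:R != 0 :> R by rewrite pnatr_eq0 -lt0n.
case: ifPn => [/dvdzP [k ->]|Nd].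
  rewrite (eq_bigr (fun=> 1)) ?sumr_const ?card_ord // => j _.
  rewrite rmorphM /= (_ : j%:R * (k%:~R * N%:Z%:~R) / N%:R = (j%:Z * k)%:~R).
    exact: cexpi_int.
  by rewrite rmorphM /=; field.
pose z : C := cexpi (d%:~R / N%:R).
have z1 : z != 1.
  apply/eqP => /cexpi_eq1 [k Hk]; move/negP: Nd; apply; apply/dvdzP; exists k.
  have /eqP : d%:~R = (k * N%:Z)%:~R :> R by rewrite rmorphM /= -Hk divfK.
  by rewrite eqr_int => /eqP.
have zN : z ^+ N = 1 by rewrite /z -cexpiMn divfK // cexpi_int.
rewrite (eq_bigr (fun j : 'I_N => z ^+ j)); last first.
  by move=> j _; rewrite /z -cexpiMn; congr cexpi; ring.
have := subrX1 z N; rewrite zN subrr => /esym/eqP; rewrite mulf_eq0 subr_eq0 (negbTE z1) /=.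
by move/eqP.
Qed.

Lemma sumC (I : Type) (s : seq I) (F : I -> R) :
  (\sum_(i <- s) F i)%:C%C = \sum_(i <- s) (F i)%:C%C :> C.
Proof. exact: rmorph_sum. Qed.

Lemma dft_parseval (N : nat) (f : 'I_N -> C) : (0 < N)%N ->
  \sum_(j < N) cabs2 (\sum_(r < N) f r * cexpi (- (j%:R * r%:R / N%:R))) =
  N%:R * \sum_(r < N) cabs2 (f r).
Proof.
move=> N0; apply: (@complexI R); rewrite rmorphM /= !sumC.
transitivity (\sum_(j < N) \sum_(r < N) \sum_(s < N)
    f r * cconj (f s) * cexpi (j%:R * (s%:Z - r%:Z)%:~R / N%:R)).
  apply: eq_bigr => j _; rewrite cabs2E cconj_sum mulr_suml; apply: eq_bigr => r _.
  rewrite mulr_sumr; apply: eq_bigr => s _.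
  rewrite cconjM cconj_cexpi opprK.
  rewrite (_ : j%:R * (s%:Z - r%:Z)%:~R / N%:R = - (j%:R * r%:R / N%:R) + j%:R * s%:R / N%:R); last first.
    by rewrite rmorphB /=; ring.
  by rewrite cexpiD; ring.
rewrite exchange_big /= mulr_sumr; apply: eq_bigr => r _.
rewrite exchange_big /= (bigD1 r) //= [X in _ + X]big1 ?addr0; last first.
  move=> s sr; rewrite -mulr_sumr sum_cexpi // ifF ?mulr0 //.
  apply/negbTE/negP => /dvdzP [k Hk]; move/negP: sr; apply; apply/eqP/val_inj => /=.
  have rN := ltn_ord r; have sN := ltn_ord s.
  have [k0|k0|k0] := ltgtP k 0; last by move: Hk; rewrite k0 mul0r; lia.
    have H1 : k * N%:Z <= -1 * N%:Z by apply: ler_wpM2r; lia.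
    lia.
  have H1 : 1 * N%:Z <= k * N%:Z by apply: ler_wpM2r; lia.
  lia.
by rewrite -mulr_sumr sum_cexpi // subrr dvdz0 cabs2E mulrC rmorph_nat.
Qed.

End ComplexExp.

Section Cyclic.
Variable R : realType.
Local Notation C := R[i].
Variables (N : nat).
Hypothesis N0 : (0 < N)%N.

Lemma sum_periodic (G : int -> C) (r : int) : (forall k, G (k + N%:Z) = G k) ->
  \sum_(k < N) G (r - k%:Z) = \sum_(k < N) G k%:Z.
Proof.
move=> GN.
have S1 (H : int -> C) : (forall k, H (k + N%:Z) = H k) -> \sum_(k < N) H (k%:Z + 1) = \sum_(k < N) H k%:Z.
  move=> HN; case: N N0 HN => // n _ HN; rewrite big_ord_recr big_ord_recl /= addrC.
  rewrite (_ : n%:Z + 1 = 0 + n.+1%:Z); last by lia.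
  rewrite HN; congr (_ + _); apply: eq_bigr => k _; congr H.
  by rewrite /bump /=; lia.
have Sn (n : nat) (H : int -> C) : (forall k, H (k + N%:Z) = H k) ->
    \sum_(k < N) H (k%:Z + n%:Z) = \sum_(k < N) H k%:Z.
  elim: n => [|n IH] HN; first by apply: eq_bigr => k _; rewrite addr0.
  rewrite -[RHS]IH // -(S1 (fun k => H (k + n%:Z))).
    by apply: eq_bigr => k _; congr H; lia.
  by move=> k; rewrite addrAC HN.
have Sz (n : int) (H : int -> C) : (forall k, H (k + N%:Z) = H k) ->
    \sum_(k < N) H (k%:Z + n) = \sum_(k < N) H k%:Z.
  case: n => n HN; first exact: Sn.
  rewrite -(Sn n.+1 (fun k => H (k + Negz n))); last by move=> k; rewrite addrAC HN.
  by apply: eq_bigr => k _; congr H; lia.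
rewrite (reindex_inj rev_ord_inj) /= -(Sz (r - N%:Z + 1)) //.
by apply: eq_bigr => k _; congr G; have := ltn_ord k; lia.
Qed.

Definition symbol (a : int -> C) (j : nat) : C :=
  \sum_(s < N) a s%:Z * cexpi (- (j%:R * s%:R / N%:R)).

(** Parseval in k: the finite Fourier transform of the correlation of f with a is the transform of f
    times the conjugate of [symbol a]. *)
Lemma cyclic_correlation (f : 'I_N -> C) (a : int -> C) : (forall k, a (k + N%:Z) = a k) ->
  N%:R * \sum_(k < N) cabs2 (\sum_(r < N) f r * cconj (a (r%:Z - k%:Z))) =
  \sum_(j < N) cabs2 (\sum_(r < N) f r * cexpi (- (j%:R * r%:R / N%:R))) * cabs2 (symbol a j).
Proof.
move=> aN; have NR : N%:R != 0 :> R by rewrite pnatr_eq0 -lt0n.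
rewrite -dft_parseval //; apply: eq_bigr => j _.
rewrite -(cabs2_cconj _ (symbol a j)) -cabs2M; congr cabs2.
transitivity (\sum_(r < N) \sum_(k < N)
    f r * cconj (a (r%:Z - k%:Z)) * cexpi (- (j%:R * k%:R / N%:R))).
  by rewrite exchange_big /=; apply: eq_bigr => k _; rewrite mulr_suml.
rewrite mulr_suml; apply: eq_bigr => r _.
pose G (k : int) : C := cconj (a k) * cexpi (j%:R * k%:~R / N%:R).
have GN k : G (k + N%:Z) = G k.
  rewrite /G aN rmorphD /= mulrDr mulrDl mulfK // cexpiD.
  by rewrite (_ : cexpi j%:R = 1) ?mulr1 // (cexpi_int R j).
rewrite -mulrA /symbol cconj_sum.
transitivity (f r * cexpi (- (j%:R * r%:R / N%:R)) * \sum_(k < N) G (r%:Z - k%:Z)).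
  rewrite mulr_sumr; apply: eq_bigr => k _; rewrite /G rmorphB /=.
  rewrite (_ : - (j%:R * k%:R / N%:R) = - (j%:R * r%:R / N%:R) + j%:R * (r%:~R - k%:~R) / N%:R).
    by rewrite cexpiD; ring.
  by field.
rewrite sum_periodic // -mulrA; congr (_ * (_ * _)); apply: eq_bigr => s _.
by rewrite /G cconjM cconj_cexpi opprK.
Qed.

(* The analysis operator of a cyclic system is a circulant matrix, diagonalized by
   the finite Fourier transform. *)
Lemma cyclic_frame (f : 'I_N -> C) (a : int -> C) (A B : R) : (forall k, a (k + N%:Z) = a k) ->
  (forall j, (j < N)%N -> A <= cabs2 (symbol a j) <= B) ->
  A * \sum_(r < N) cabs2 (f r) <=
    \sum_(k < N) cabs2 (\sum_(r < N) f r * cconj (a (r%:Z - k%:Z))) <=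
    B * \sum_(r < N) cabs2 (f r).
Proof.
move=> aN HAB; have NR : 0 < N%:R :> R by rewrite ltr0n.
rewrite -(ler_pM2l NR) -[X in _ && X](ler_pM2l NR) cyclic_correlation //.
rewrite !(mulrCA N%:R) -dft_parseval // !mulr_sumr; apply/andP; split;
  apply: ler_sum => j _; have /andP[H1 H2] := HAB j (ltn_ord j); rewrite mulrC.
  by rewrite ler_wpM2l ?cabs2_ge0.
by rewrite [leRHS]mulrC mulrC ler_wpM2l ?cabs2_ge0.
Qed.

End Cyclic.

(** * Periodization and the Zak transform *)

Section Symbol.
Variable R : realType.
Local Notation C := R[i].

Lemma Complex_sum (I : Type) (s : seq I) (F G : I -> R) :
  \sum_(i <- s) Complex (F i) (G i) = Complex (\sum_(i <- s) F i) (\sum_(i <- s) G i).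
Proof.
elim: s => [|i s IH]; first by rewrite !big_nil.
by rewrite !big_cons IH; simpc.
Qed.

Lemma zs_sum (I : Type) (s : seq I) (u : I -> int -> R) (r : R) : 0 <= r < 1 ->
  (forall i, exists A, expb A r (u i)) ->
  \sum_(i <- s) zs (u i) = zs (fun k => \sum_(i <- s) u i k).
Proof.
move=> Hr Hu.
suff [] : (exists A, expb A r (fun k => \sum_(i <- s) u i k)) /\
  \sum_(i <- s) zs (u i) = zs (fun k => \sum_(i <- s) u i k) by [].
elim: s => [|i s [[B HB] IH]].
  split; first by exists 0 => k; rewrite big_nil normr0 mul0r.
  rewrite big_nil -[LHS](zs_single R 0 0); apply: eq_zs => k.
  by rewrite big_nil if_same.
have [A HA] := Hu i; split.
  exists (A + B) => k; rewrite big_cons mulrDl.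
  by apply: le_trans (ler_normD _ _) _; apply: lerD.
rewrite big_cons IH -(zsD _ _ _ _ _ _ Hr HA HB).
by apply: eq_zs => k; rewrite big_cons.
Qed.

Lemma zs_continuous (u : R -> int -> R) (A r : R) : 0 <= r < 1 -> (forall t, expb A r (u t)) ->
  (forall k, continuous (u ^~ k)) -> continuous (fun t => zs (u t)).
Proof.
move=> Hr Hu cu t; apply/cvgrPdist_lt => e e0.
have rN : (fun n : nat => 2 * A * r ^+ n / (1 - r)) @ \oo --> 2 * A * 0 / (1 - r).
  apply: cvgMl; apply: cvgMr; apply: cvg_expr; rewrite ger0_norm; lra.
have e3 : 0 < e / 3 by lra.
have [N _ HN] : \forall n \near \oo, 2 * A * r ^+ n / (1 - r) < e / 3.
  by apply: (cvgr_lt _ rN); rewrite mulr0 mul0r.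
have {}HN := HN N (leqnn N).
have cN : (fun t => zpart (u t) N) x @[x --> t] --> zpart (u t) N.
  rewrite /zpart; elim: (index_enum _) => [|i l IH].
    by rewrite big_nil; under eq_fun do rewrite big_nil; exact: cvg_cst.
  by rewrite big_cons; under eq_fun do rewrite big_cons; apply: cvgD => //; exact: cu.
move/cvgrPdist_lt : cN => /(_ _ e3); apply: filterS => s Hs.
have H1 := zs_tail _ _ _ _ N Hr (Hu t); have H2 := zs_tail _ _ _ _ N Hr (Hu s).
move: Hs HN H1 H2; move: (zpart _ N) (zpart _ N) (zs _) (zs _) (_ / (1 - r)) => a b c d q.
by rewrite !ltr_norml !ler_norml => /andP[? ?] ? /andP[? ?] /andP[? ?]; lra.
Qed.

Lemma pos_bounds (F : R -> R) (a b : R) : a <= b -> continuous F ->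
  (forall t, a <= t <= b -> 0 < F t) ->
  exists A B, [/\ 0 < A, 0 < B & forall t, a <= t <= b -> A <= F t <= B].
Proof.
move=> ab cF F0; have cF' : {within `[a, b], continuous F} by exact: continuous_subspaceT.
have [p pab Hp] := EVT_min ab cF'; have [q qab Hq] := EVT_max ab cF'.
exists (F p), (F q); split; [exact: F0|exact: F0|].
by move=> t tab; rewrite Hp ?Hq.
Qed.

Variables (d A : R) (G : R -> R).
Hypothesis HG : expdec R d A G.

Definition per (K : nat) (x : R) := zs (fun k : int => G (x - k%:~R * K%:R)).

Lemma per_periodic (K : nat) (x : R) (n : int) : (0 < K)%N -> per K (x + n%:~R * K%:R) = per K x.
Proof.
move=> K0; have KR : 0 < K%:R :> R by rewrite ltr0n.
have [Hr Hx] := expdec_expb R _ KR _ _ _ x HG.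
rewrite -[RHS](zs_shift _ _ _ _ (- n) Hr Hx); apply: eq_zs => k; congr G.
by rewrite rmorphD rmorphN /=; ring.
Qed.

(** Every integer is k N + s with 0 <= s < N, and the weight sees only s, so summing over k first
    produces the periodization with period N M. Translates by + s M on the left and - k M on the
    right account for the sign in the weight. *)
Lemma zak_sum (M N : nat) (tr : R -> R) (phi x : R) : (0 < M)%N -> (0 < N)%N ->
  (forall t, `|tr t| <= 1) ->
  (forall (k : int) (s : nat), tr ((k * N%:Z + s%:Z)%:~R * phi) = tr (s%:R * phi)) ->
  \sum_(s < N) per (N * M) (x + s%:R * M%:R) * tr (s%:R * phi) =
  zs (fun k : int => G (x - k%:~R * M%:R) * tr (- (k%:~R * phi))).
Proof.
move=> M0 N0 tr1 trN.
have MR : 0 < M%:R :> R by rewrite ltr0n.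
have KR : 0 < (N * M)%:R :> R by rewrite ltr0n muln_gt0 M0 N0.
have [HrM HM] := expdec_expb R _ MR _ _ _ x HG.
have HrM' : 0 <= expR (- d * M%:R) < 1 by lra.
have HM' : expb (A * expR (d * `|x|)) (expR (- d * M%:R))
    (fun k : int => G (x - k%:~R * M%:R) * tr (- (k%:~R * phi))) by apply: expbM.
have HM2 : expb (A * expR (d * `|x|)) (expR (- d * M%:R))
    (fun k : int => G (x + k%:~R * M%:R) * tr (k%:~R * phi)).
  by move=> k; have := HM' (- k); rewrite rmorphN /= !mulNr !opprK abszN.
rewrite -zs_reflect; under [RHS]eq_zs => k do rewrite rmorphN /= !mulNr !opprK.
rewrite -(zs_regroup _ _ _ _ N N0 HrM' HM2) -zs_reflect.
pose v (s : 'I_N) (k : int) := G (x + s%:R * M%:R - k%:~R * (N * M)%:R) * tr (s%:R * phi).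
have Hv (s : 'I_N) : expb (A * expR (d * `|x + s%:R * M%:R|)) (expR (- d * (N * M)%:R)) (v s).
  have [_ H] := expdec_expb R _ KR _ _ _ (x + s%:R * M%:R) HG.
  exact: expbM.
have [Hr _] := expdec_expb R _ KR _ _ _ x HG; have Hr' : 0 <= expR (- d * (N * M)%:R) < 1 by lra.
transitivity (\sum_(s < N) zs (v s)).
  apply: eq_bigr => s _; rewrite mulrC.
  have [_ H] := expdec_expb R _ KR _ _ _ (x + s%:R * M%:R) HG.
  by rewrite /per -(zsZ _ _ _ _ _ Hr' H); apply: eq_zs => k; rewrite mulrC.
rewrite (zs_sum _ _ _ _ Hr'); last by move=> s; eexists; exact: Hv.
apply: eq_zs => k; apply: eq_bigr => s _; rewrite trN /v; congr (G _ * _).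
by rewrite natrM rmorphD rmorphM rmorphN /=; ring.
Qed.

Lemma symbol_zak (M N j : nat) (x : R) : (0 < M)%N -> (0 < N)%N ->
  symbol R N (fun s => (per (N * M) (x + s%:~R * M%:R))%:C%C) j =
  Complex (zaks R M%:R cos G (2 * pi * j%:R / N%:R) x) (zaks R M%:R sin G (2 * pi * j%:R / N%:R) x).
Proof.
move=> M0 N0; have NR : N%:R != 0 :> R by rewrite pnatr_eq0 -lt0n.
set phi := 2 * pi * j%:R / N%:R.
have E (k : int) (s : nat) : cexpi (- ((k * N%:Z + s%:Z)%:~R * (j%:R / N%:R))) = cexpi (- (s%:R * (j%:R / N%:R))) :> C.
  rewrite [X in cexpi X = _](_ : _ = - (s%:R * (j%:R / N%:R)) + (- k * j%:Z)%:~R); last first.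
    by rewrite rmorphD !rmorphM rmorphN /=; field.
  by rewrite cexpiD cexpi_int mulr1.
have Ephi (t : R) : 2 * pi * - (t * (j%:R / N%:R)) = - (t * phi) by rewrite /phi; field.
rewrite /symbol; transitivity (\sum_(s < N) Complex
    (per (N * M) (x + s%:R * M%:R) * cos (- (s%:R * phi)))
    (per (N * M) (x + s%:R * M%:R) * sin (- (s%:R * phi)))).
  apply: eq_bigr => s _; rewrite (_ : - _ = - (s%:R * (j%:R / N%:R))); last by field.
  by rewrite /cexpi Ephi; simpc.
rewrite Complex_sum; congr Complex.
  (* The finite transform carries e^(-i s phi) and the Zak transform e^(i k phi), hence the negated
     argument. *)
  rewrite (zak_sum M N (fun t => cos (- t)) phi) //.
  - by apply: eq_zs => k; rewrite opprK.
  - by move=> t; exact: cos_max.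
  - by move=> k s; have := congr1 (@complex.Re R) (E k s); rewrite /cexpi /= !Ephi.
rewrite (zak_sum M N (fun t => sin (- t)) phi) //.
- by apply: eq_zs => k; rewrite opprK.
- by move=> t; exact: sin_max.
- by move=> k s; have := congr1 (@complex.Im R) (E k s); rewrite /cexpi /= !Ephi.
Qed.

Lemma zaks_continuous_phase (T x : R) (s : R -> R) : 0 < T -> continuous s -> (forall t, `|s t| <= 1) ->
  continuous (fun phi => zaks R T s G phi x).
Proof.
move=> T0 cs s1; have [Hr Hx] := expdec_expb R _ T0 _ _ _ x HG.
apply: (zs_continuous _ (A * expR (d * `|x|)) (expR (- d * T))); first by lra.
  by move=> phi; apply: expbM.
move=> k phi; apply: cvgMr.
have ck : (k%:~R * p : R) @[p --> phi] --> k%:~R * phi by apply: cvgMr; exact: cvg_id.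
exact: (cvg_comp _ _ ck (cs _)).
Qed.

End Symbol.

(** * Gabor systems on a finite cycle *)

Section FiniteFrame.
Variable R : realType.
Local Notation C := R[i].
Variables (M N : nat).
Hypotheses (M0 : (0 < M)%N) (N0 : (0 < N)%N).

Lemma sum_block (V : zmodType) (F : nat -> V) :
  \sum_(n < N * M) F n = \sum_(i < M) \sum_(r < N) F (r * M + i)%N.
Proof.
rewrite exchange_big -(big_mkord xpredT F) big_nat_mul big_mkord; apply: eq_bigr => r _ /=.
rewrite -[X in \sum_(X <= _ < _) _]add0n big_addn mulSn addnK big_mkord.
by apply: eq_bigr => i _; rewrite addnC.
Qed.

(** Write n = r M + i. The modulation by l / M depends on i alone, so Parseval in l separates the
    residues i; each leaves a cyclic system of length N in the variable r. *)
Lemma finite_gabor_bounds (f a : int -> C) (A B : R) : (forall k, a (k + (N * M)%:Z) = a k) ->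
  (forall i j, (i < M)%N -> (j < N)%N ->
     A <= cabs2 (symbol R N (fun s => a (i%:Z + s * M%:Z)) j) <= B) ->
  M%:R * A * \sum_(n < N * M) cabs2 (f n%:Z) <=
    \sum_(k < N) \sum_(l < M) cabs2 (\sum_(n < N * M)
       f n%:Z * cconj (a (n%:Z - (k * M)%N%:Z) * cexpi (l%:R / M%:R * n%:R))) <=
  M%:R * B * \sum_(n < N * M) cabs2 (f n%:Z).
Proof.
move=> aK HAB; have MR : M%:R != 0 :> R by rewrite pnatr_eq0 -lt0n.
pose fi (i : 'I_M) (r : 'I_N) := f (r * M + i)%N%:Z.
pose ai (i : 'I_M) (s : int) := a (i%:Z + s * M%:Z).
have E (k : 'I_N) : \sum_(l < M) cabs2 (\sum_(n < N * M)
       f n%:Z * cconj (a (n%:Z - (k * M)%N%:Z) * cexpi (l%:R / M%:R * n%:R))) =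
    M%:R * \sum_(i < M) cabs2 (\sum_(r < N) fi i r * cconj (ai i (r%:Z - k%:Z))).
  rewrite -dft_parseval //; apply: eq_bigr => l _; congr cabs2.
  rewrite (sum_block _ (fun n => f n%:Z * cconj (a (n%:Z - (k * M)%N%:Z) * cexpi (l%:R / M%:R * n%:R)))).
  apply: eq_bigr => i _; rewrite mulr_suml; apply: eq_bigr => r _.
  rewrite cconjM cconj_cexpi mulrA; congr (_ * cconj (a _) * _); first by lia.
  rewrite [X in cexpi X = _](_ : _ = - (l%:R * i%:R / M%:R) + (- (l%:Z * r%:Z))%:~R); last first.
    by rewrite natrD natrM rmorphN rmorphM /=; field.
  by rewrite cexpiD cexpi_int mulr1.
rewrite (eq_bigr _ (fun k _ => E k)) -mulr_sumr exchange_big /=.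
rewrite (sum_block _ (fun n => cabs2 (f n%:Z))) -!mulrA !ler_pM2l ?ltr0n // !mulr_sumr.
have H i := cyclic_frame R N N0 (fi i) (ai i) A B.
have aiN i k : ai i (k + N%:Z) = ai i k.
  by rewrite /ai -[RHS]aK; congr a; lia.
apply/andP; split; apply: ler_sum => i _;
  by have /andP[] := H i (aiN i) (fun j => HAB i j (ltn_ord i)).
Qed.

End FiniteFrame.

Section Esum.
Variable R : realType.

Lemma esum_fin_set (T : choiceType) (r : seq T) (F : T -> R) : uniq r -> (forall t, 0 <= F t) ->
  (\esum_(i in [set` r]) (F i)%:E = (\sum_(i <- r) F i)%:E)%E.
Proof.
move=> ur F0; rewrite esum_fset //; last by move=> i _; rewrite lee_fin.
by rewrite -fsbig_seq // sumEFin.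
Qed.

Lemma esum_finType (T : finType) (F : T -> R) : (forall t, 0 <= F t) ->
  (\esum_(i in [set: T]) (F i)%:E = (\sum_(i : T) F i)%:E)%E.
Proof.
move=> F0; rewrite -esum_fin_set ?index_enum_uniq //; congr (esum _ _).
by apply/seteqP; split => // t _ /=; rewrite mem_index_enum.
Qed.

Lemma esum_pair_finType (S : choiceType) (T : finType) (F : S * T -> R) : (forall t, 0 <= F t) ->
  (\esum_(i in [set: S * T]) (F i)%:E = \esum_(s in [set: S]) (\sum_(t : T) F (s, t))%:E)%E.
Proof.
move=> F0; transitivity (\esum_(s in [set: S]) \esum_(t in [set: T]) (F (s, t))%:E)%E.
  rewrite esum_esum; last by move=> *; rewrite lee_fin.
  have -> : [set: S] `*`` (fun=> [set: T]) = [set: S * T] by apply/seteqP; split.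
  by apply: eq_esum => -[].
by apply: eq_esum => s _; rewrite esum_finType.
Qed.

Let zrange (N : nat) : seq int := [seq i%:Z - N%:Z | i <- iota 0 (2 * N).+1].

Let zrange_uniq N : uniq (zrange N).
Proof. by rewrite map_inj_uniq ?iota_uniq // => i j; lia. Qed.

Let zpart_zrange (u : int -> R) N : zpart u N = \sum_(k <- zrange N) u k.
Proof. by rewrite /zrange big_map -[iota _ _]/(index_iota 0 (2 * N).+1) big_mkord. Qed.

Let mem_zrange N (k : int) : (`|k| <= N)%N -> k \in zrange N.
Proof.
move=> kN; apply/mapP; exists (absz (k + N%:Z)); last by lia.
by rewrite mem_iota; lia.
Qed.

Lemma zpart_le_esum (u : int -> R) N : (forall k, 0 <= u k) ->
  ((zpart u N)%:E <= \esum_(k in [set: int]) (u k)%:E)%E.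
Proof.
move=> u0; apply: esum_ge; exists [set` zrange N]; first by split; [exact: finite_seq|].
by rewrite -fsbig_seq // sumEFin zpart_zrange.
Qed.

Lemma esum_le_zpart (u : int -> R) (B : R) : (forall k, 0 <= u k) -> (forall N, zpart u N <= B) ->
  (\esum_(k in [set: int]) (u k)%:E <= B%:E)%E.
Proof.
move=> u0 HB; apply: ge_ereal_sup => _ [X [finX _] <-].
have [r Xr] := (finite_seqP X).1 finX; pose N := \max_(x <- r) absz x.
have XN k : X k -> (`|k| <= N)%N.
  by rewrite Xr /= => kr; exact: (@leq_bigmax_seq _ _ xpredT absz).
apply: (@le_trans _ _ (zpart u N)%:E); last by rewrite lee_fin.
rewrite zpart_zrange -sumEFin [leRHS]fsbig_seq //.
apply: lee_fsum_nneg_subset => //.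
- by move=> k; rewrite !inE /= => /XN /mem_zrange.
- by move=> k _; rewrite lee_fin.
Qed.

(** Sums replace extrema, which covers an empty T as well: 1 + sum F lies above every F t, and 1 /
    (1 + sum 1/F) below. *)
Lemma fin_bounds (T : finType) (F : T -> R) : (forall t, 0 < F t) ->
  exists A B, [/\ 0 < A, 0 < B & forall t, A <= F t <= B].
Proof.
move=> F0; have S0 (H : T -> R) : (forall t, 0 < H t) -> forall t, H t <= 1 + \sum_t H t.
  move=> H0 t; rewrite (bigD1 t) //= addrCA lerDl addr_ge0 // sumr_ge0 // => s _.
  exact: ltW.
have S1 (H : T -> R) : (forall t, 0 < H t) -> 0 < 1 + \sum_t H t.
  by move=> H0; rewrite ltr_pwDl // sumr_ge0 // => s _; exact: ltW.
have V0 t : 0 < (F t)^-1 by rewrite invr_gt0.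
exists (1 + \sum_t (F t)^-1)^-1, (1 + \sum_t F t); split; rewrite ?invr_gt0; [exact: S1|exact: S1|].
move=> t; rewrite S0 // andbT -[leRHS]invrK lef_pV2 ?posrE //; [exact: (S0 (fun t => (F t)^-1))|exact: S1].
Qed.

End Esum.

Section Window.
Variable R : realType.
Local Notation C := R[i].
Variables (d A0 : R) (G : R -> R) (g : R -> C).
Hypotheses (HG : expdec R d A0 G) (gG : forall x, g x = (G x)%:C%C).

Lemma zsum_real (u : int -> R) : zsum (fun k => (u k)%:C%C) = (zs u)%:C%C :> C.
Proof.
rewrite /zsum /=; congr Complex.
under eq_fun do rewrite big1 //.
exact: lim_cst.
Qed.

Lemma periodize_per (K : nat) (x : R) : periodize K%:R g x = (per R G K x)%:C%C.
Proof. by rewrite -zsum_real; congr zsum; apply/funext => k. Qed.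

Lemma periodize_sample_per (K : nat) (n : int) : periodize_sample K g n = (per R G K n%:~R)%:C%C.
Proof.
rewrite -zsum_real; congr zsum; apply/funext => k; rewrite gG; congr (G _)%:C%C.
by rewrite rmorphB rmorphM.
Qed.

Definition zak_sqr (M : nat) (phi x : R) := zaks R M%:R cos G phi x ^+ 2 + zaks R M%:R sin G phi x ^+ 2.

Lemma per_frame_bounds (M N : nat) (A B : R) (f : int -> C) : (0 < M)%N -> (0 < N)%N ->
  (forall i j, (i < M)%N -> (j < N)%N -> A <= zak_sqr M (2 * pi * j%:R / N%:R) i%:R <= B) ->
  M%:R * A * \sum_(n < N * M) cabs2 (f n%:Z) <=
  \sum_(k < N) \sum_(l < M) cabs2 (\sum_(n < N * M) f n%:Z *
     cconj ((per R G (N * M) (n%:Z - (k * M)%N%:Z)%:~R)%:C%C * cexpi (l%:R / M%:R * n%:R))) <=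
  M%:R * B * \sum_(n < N * M) cabs2 (f n%:Z).
Proof.
move=> M0 N0 HAB; have K0 : (0 < N * M)%N by rewrite muln_gt0 N0.
apply: (finite_gabor_bounds R M N M0 N0 f (fun n : int => (per R G (N * M) n%:~R)%:C%C)).
  move=> k; rewrite rmorphD /=; congr (_%:C%C).
  by rewrite -[RHS](per_periodic _ _ _ _ HG _ _ 1 K0) mul1r.
move=> i j iM jN; have E := symbol_zak R d A0 G HG M N j i%:R M0 N0.
rewrite (_ : symbol _ _ _ _ = Complex (zaks R M%:R cos G (2 * pi * j%:R / N%:R) i%:R)
  (zaks R M%:R sin G (2 * pi * j%:R / N%:R) i%:R)); first exact: HAB.
by rewrite -E; congr symbol; apply/funext => s; rewrite rmorphD rmorphM.
Qed.

Lemma finite_frame_bounds (M K : nat) (A B : R) (f : int -> C) : (0 < M)%N -> (0 < K)%N -> (M %| K)%N ->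
  (forall i j, (i < M)%N -> (j < K %/ M)%N ->
     A <= zak_sqr M (2 * pi * j%:R / (K %/ M)%:R) i%:R <= B) ->
  M%:R * A * \sum_(n < K) cabs2 (f n%:Z) <=
  \sum_(kl : 'I_(K %/ M) * 'I_M) cabs2 (ipCK (fun n : 'I_K => f n%:Z) (@gabor_PKSg R g M K kl)) <=
  M%:R * B * \sum_(n < K) cabs2 (f n%:Z).
Proof.
move=> M0 K0 MK HAB; have N0 : (0 < K %/ M)%N by rewrite divn_gt0 // dvdn_leq.
have := per_frame_bounds M (K %/ M) A B f M0 N0 HAB; rewrite divnK // => H.
rewrite [X in _ <= X <= _](_ : _ = \sum_(k < K %/ M) \sum_(l < M) cabs2 (\sum_(n < K) f n%:Z *
  cconj ((per R G K (n%:Z - (k * M)%N%:Z)%:~R)%:C%C * cexpi (l%:R / M%:R * n%:R)))) //.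
rewrite pair_big_dep /=; apply: eq_bigr => -[k l] _ /=; congr cabs2; apply: eq_bigr => n _.
rewrite /gabor_PKSg /tfCK /= periodize_sample_per; congr (_ * cconj (_%:C%C * _)).
have E (z : int) : z%:~R = (z %% K%:Z)%Z%:~R + (z %/ K%:Z)%Z%:~R * K%:R :> R.
  by rewrite {1}(divz_eq z K%:Z) addrC rmorphD rmorphM.
by rewrite [in RHS]E (per_periodic _ _ _ _ HG).
Qed.

Lemma CK_frame (M K : nat) : (0 < M)%N -> (M %| K)%N ->
  (forall i j, (i < M)%N -> (j < K %/ M)%N -> 0 < zak_sqr M (2 * pi * j%:R / (K %/ M)%:R) i%:R) ->
  is_frame (@CK R K) (@ipCK R K) (@nrm2CK R K) (@gabor_PKSg R g M K).
Proof.
move=> M0 MK H; split=> //.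
have MR : 0 < M%:R :> R by rewrite ltr0n.
(* For K = 0 the space is trivial and the family empty, so any constants serve. *)
have [->|K0] := posnP K.
  exists 1, 1; split=> //; split=> // f _; rewrite /nrm2CK big_ord0 mulr0.
  rewrite esum1 ?lexx // => -[[k kN] l] _; exfalso; by rewrite div0n in kN.
have [A [B [A_0 B_0 HAB]]] := fin_bounds R _
  (fun p : 'I_M * 'I_(K %/ M) => zak_sqr M (2 * pi * p.2%:R / (K %/ M)%:R) p.1%:R)
  (fun p => H p.1 p.2 (ltn_ord _) (ltn_ord _)).
exists (M%:R * A), (M%:R * B); split; [exact: mulr_gt0|split; first exact: mulr_gt0].
move=> f _; pose F (n : int) : C := if insub (absz n) is Some i then f i else 0.
have FE : (fun n : 'I_K => F n) = f by apply/funext => n; rewrite /F absz_nat valK.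
rewrite esum_finType; last by move=> t; exact: cabs2_ge0.
have /andP[H1 H2] := finite_frame_bounds M K A B F M0 K0 MK
  (fun i j iM jN => HAB (Ordinal iM, Ordinal jN)).
rewrite !lee_fin /nrm2CK -FE; split; [exact: H1|exact: H2].
Qed.

End Window.

(** * The frame for l^2(Z) *)

Section Tools.
Variable R : realType.
Local Notation C := R[i].

Lemma cabs2D_le (z w : C) : cabs2 (z + w) <= 2 * cabs2 z + 2 * cabs2 w.
Proof.
case: z w => a b [a' b']; rewrite /cabs2; simpc => /=.
by have := sqr_ge0 (a - a'); have := sqr_ge0 (b - b'); nra.
Qed.

Lemma cabs2N (z : C) : cabs2 (- z) = cabs2 z.
Proof. by case: z => a b; rewrite /cabs2 /= !sqrrN. Qed.

Lemma cabs2_sum_le (N : nat) (F : 'I_N -> C) : cabs2 (\sum_(i < N) F i) <= N%:R * \sum_(i < N) cabs2 (F i).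
Proof.
have S (n : nat) (a : 'I_n -> R) : (\sum_(i < n) a i) ^+ 2 <= n%:R * \sum_(i < n) a i ^+ 2.
  elim: n a => [|n IH] a; first by rewrite big_ord0 expr0n mul0r.
  rewrite !big_ord_recl /= -[X in X%:R]add1n natrD.
  have := IH (fun i => a (lift ord0 i)).
  have q0 : 0 <= \sum_(i < n) a (lift ord0 i) ^+ 2 by apply: sumr_ge0 => i _; exact: sqr_ge0.
  have := ler0n R n; move: (n%:R : R) (a ord0) (\sum_(i < n) a _) (\sum_(i < n) _ ^+ 2) q0 => m x s q q0 m0 H.
  have [m0'|m0'] := eqVneq m 0.
    have s0 : s = 0 by apply/eqP; rewrite -sqrf_eq0 eq_le sqr_ge0 andbT -(mul0r q) -m0'.
    by rewrite s0 m0' !addr0 mul1r lerDl.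
  have mp : 0 < m by rewrite lt_neqAle eq_sym m0'.
  have H2 := sqr_ge0 (m * x - s).
  have H3 : m * (s ^+ 2) <= m * (m * q) by rewrite ler_wpM2l.
  by rewrite -(ler_pM2l mp); nra.
rewrite /cabs2 big_split /= mulrDr.
have E (u : 'I_N -> C) : \sum_(i < N) u i =
    Complex (\sum_(i < N) complex.Re (u i)) (\sum_(i < N) complex.Im (u i)).
  by rewrite -Complex_sum; apply: eq_bigr => i _; case: (u i).
by rewrite E /=; apply: lerD; exact: S.
Qed.

(** The window from -n M to (n + 1) M - 1 contains [-L, L], and its length (2 n + 1) M is a multiple
    of M, as a cycle carrying the Gabor system must have. *)
Lemma window_sum (V : zmodType) (H : int -> V) (L n M : nat) : (0 < M)%N -> (L <= n * M)%N ->
  (forall k : int, (L < `|k|)%N -> H k = 0) ->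
  \sum_(i < (2 * n).+1 * M) H (i%:Z - (n * M)%N%:Z) = \sum_(i < (2 * L).+1) H (i%:Z - L%:Z).
Proof.
move=> M0 Ln H0; pose p := (n * M - L)%N.
rewrite -(big_mkord xpredT (fun i : nat => H (i%:Z - (n * M)%N%:Z))).
have pE : (p + (2 * L).+1 <= (2 * n).+1 * M)%N by rewrite /p; nia.
rewrite (big_cat_nat _ (n := p)) //=; last by rewrite (leq_trans _ pE) ?leq_addr.
rewrite (big_cat_nat _ (m := p) (n := p + (2 * L).+1)) ?leq_addr //=.
rewrite big_nat_cond big1 ?add0r; last first.
  by move=> i /andP[/andP[_ ip] _]; apply: H0; rewrite /p in ip; lia.
rewrite [X in _ + X]big_nat_cond [X in _ + X]big1 ?addr0; last first.
  by move=> i /andP[/andP[ip _] _]; apply: H0; rewrite /p in ip; lia.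
rewrite -[X in \sum_(X <= _ < _) _]add0n big_addn addnC addnK big_mkord.
by apply: eq_bigr => i _; congr H; rewrite /p; lia.
Qed.

Lemma expR_decay (c : R) : 0 < c -> forall K : R, 0 < K -> K * expR (- c * K) <= 4 / (c ^+ 2 * K).
Proof.
move=> c0 K K0; have H := expR_ge1Dx (c * K / 2).
have ck : 0 < c * K by rewrite mulr_gt0.
have H2 : (c * K / 2) ^+ 2 <= expR (c * K / 2) ^+ 2 by rewrite ler_sqr ?nnegrE ?expR_ge0; lra.
have E : expR (- c * K) * expR (c * K / 2) ^+ 2 = 1.
  by rewrite -expRM_natr -expRD (_ : _ + _ = 0) ?expR0 //; field.
have e0 := expR_ge0 (- c * K).
rewrite ler_pdivlMr; last by rewrite mulr_gt0 // exprn_gt0.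
have : expR (- c * K) * (c * K / 2) ^+ 2 <= 1 by rewrite -[leRHS]E ler_wpM2l.
by rewrite !expr2; lra.
Qed.

Variables (d A0 : R) (G : R -> R).
Hypotheses (HG : expdec R d A0 G).

(** For p != 0 one has |y - p K| >= |p| K/4 + K/4 - L: the first part gives a geometric series of
    ratio r = e^(-d K/4), the second a further factor r. As K >= 1, 1 - r is at least 1 - e^(-d/4),
    so Q does not depend on K. *)
Lemma per_close (L : R) : 0 <= L -> exists2 Q, 0 <= Q & forall (K : nat) (y : R), (0 < K)%N ->
  `|y| <= K%:R / 2 + L -> `|per R G K y - G y| <= Q * expR (- (d / 4) * K%:R).
Proof.
move=> L0; have A00 := expdec_ge0 _ _ _ _ HG; have [d0 Gd] := HG.
have d4 : expR (- (d / 4)) < 1 by rewrite expR_lt1; lra.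
exists (3 * (A0 * expR (d * L)) / (1 - expR (- (d / 4)))).
  by apply: divr_ge0; [rewrite !mulr_ge0 // expR_ge0|lra].
move=> K y K0 yK; have KR : 1 <= K%:R :> R by rewrite ler1n.
set r := expR (- (d / 4) * K%:R).
have r1 : r <= expR (- (d / 4)) by rewrite ler_expR; nra.
have r0 : 0 < r by rewrite expR_gt0.
have Hr : 0 <= r < 1 by lra.
pose v (p : int) := if p == 0 then 0 else G (y - p%:~R * K%:R).
have Hv : expb (A0 * expR (d * L) * r) r v.
  move=> p; rewrite /v; case: eqP => [_|/eqP p0].
    by rewrite normr0 !mulr_ge0 // ?expR_ge0 // exprn_ge0 // ltW.
  rewrite (le_trans (Gd _)) // -!mulrA ler_wpM2l // /r -expRM_natr -!expRD ler_expR.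
  have H : `|p|%N%:R * K%:R <= `|y - p%:~R * K%:R| + `|y|.
    have -> : `|p|%N%:R * K%:R = `|p%:~R * K%:R : R|.
      by rewrite normrM [X in _ = _ * X]ger0_norm // -intr_norm -abszE.
    by rewrite -{1}[p%:~R * K%:R](subrK y) (le_trans (ler_normD _ _)) // distrC.
  have p1 : 1 <= `|p|%N%:R :> R by rewrite ler1n absz_gt0.
  have H1 : K%:R <= `|p|%N%:R * K%:R :> R by rewrite ler_peMl.
  rewrite (_ : _ * K%:R * `|p|%N%:R = - (d / 4) * (`|p|%N%:R * K%:R)); last by ring.
  move: H1 H yK; move: (`|p|%N%:R * K%:R) (`|y - _|) => q s H1 H yK.
  have : d * s >= d * (q / 4 + K%:R / 4 - L) by rewrite ler_wpM2l //; lra.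
  lra.
have Hw : expb `|G y| r (fun p : int => if p == 0 then G y else 0).
  move=> p; case: eqP => [->|_]; first by rewrite expr0 mulr1.
  by rewrite normr0 mulr_ge0 // exprn_ge0 // ltW.
have -> : per R G K y - G y = zs v.
  apply/eqP; rewrite subr_eq -[X in _ + X](zs_single R 0) -(zsD _ _ _ _ _ _ Hr Hv Hw); apply/eqP.
  apply: eq_zs => p; rewrite /v /=; case: eqP => [->|_]; first by rewrite mul0r subr0 add0r.
  by rewrite addr0.
apply: le_trans (zs_bound _ _ _ _ Hr Hv) _.
rewrite (_ : 3 * _ / _ = 3 * (A0 * expR (d * L)) / (1 - r) * r); last by ring.
apply: ler_wpM2r; first exact: ltW.
apply: ler_wpM2l; first by rewrite !mulr_ge0 // expR_ge0.
by rewrite lef_pV2 ?posrE; lra.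
Qed.

End Tools.

Section InfiniteFrame.
Variable R : realType.
Local Notation C := R[i].
Variables (d A0 : R) (G : R -> R) (g : R -> C) (M : nat) (A B : R).
Hypotheses (HG : expdec R d A0 G) (gG : forall x, g x = (G x)%:C%C) (M0 : (0 < M)%N).
Hypotheses (Ap : 0 < A) (Bp : 0 < B).
Hypothesis HAB : forall (i : nat) phi, (i < M)%N -> 0 <= phi <= 2 * pi -> A <= zak_sqr R G M phi i%:R <= B.

Let term (f : int -> C) (k : int) (l : nat) (n : int) : C :=
  f n * cconj ((G (n - k * M%:Z)%:~R)%:C%C * cexpi (l%:R / M%:R * n%:~R)).

(** The coefficient of f cut off to [-L, L]. For such f the line can be replaced by a long cycle. *)
Let dpart f k l L : C := \sum_(i < (2 * L).+1) term f k l (i%:Z - L%:Z).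
Let dsqr f L k := \sum_(l < M) cabs2 (dpart f k l L).
Let coef f k l : C := zsum (term f k l).

Let dsqr_ge0 f L k : 0 <= dsqr f L k.
Proof. by apply: sumr_ge0 => l _; exact: cabs2_ge0. Qed.

(** Replacing the window by its periodization costs the error of [per_close] in each of the 2 L + 1
    terms; squaring it turns the rate d/4 into d/2. *)
Let dpart_close f L : exists2 Q, 0 <= Q & forall (n : nat) (k : int) (l : nat), (L <= n * M)%N -> (`|k| <= n)%N ->
  cabs2 (dpart f k l L - \sum_(i < (2 * L).+1) f (i%:Z - L%:Z) *
     cconj ((per R G ((2 * n).+1 * M) (i%:Z - L%:Z - k * M%:Z)%:~R)%:C%C * cexpi (l%:R / M%:R * (i%:Z - L%:Z)%:~R)))
  <= Q * expR (- (d / 2) * ((2 * n).+1 * M)%:R).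
Proof.
have [Q Q0 HQ] := per_close R d A0 G HG L%:R (ler0n _ _).
have s0 : 0 <= \sum_(i < (2 * L).+1) cabs2 (f (i%:Z - L%:Z)) by apply: sumr_ge0 => i _; exact: cabs2_ge0.
exists ((2 * L).+1%:R * (\sum_(i < (2 * L).+1) cabs2 (f (i%:Z - L%:Z))) * Q ^+ 2).
  by apply: mulr_ge0; [exact: mulr_ge0|exact: sqr_ge0].
move=> n k l Ln kn; set K := ((2 * n).+1 * M)%N.
rewrite /dpart /term -sumrB; apply: le_trans (cabs2_sum_le _ _ _) _.
rewrite -!mulrA ler_wpM2l // mulr_suml; apply: ler_sum => i _.
rewrite -mulrBr cabs2M ler_wpM2l ?cabs2_ge0 //.
set z : int := i%:Z - L%:Z - k * M%:Z.
rewrite !cconjM -mulrBl cabs2M cabs2_cconj cabs2_cexpi mulr1.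
rewrite (_ : cabs2 _ = (per R G K z%:~R - G z%:~R) ^+ 2); last first.
  by rewrite /cabs2 /=; ring.
(* For |k| <= n the argument is at most L + n M <= K/2 + L, the range in which [per_close] holds. *)
have zK : `|z%:~R : R| <= K%:R / 2 + L%:R.
  rewrite -intr_norm -abszE.
  have H : (2 * `|z| <= K + 2 * L)%N by have := ltn_ord i; rewrite /z /K; nia.
  have : (2 * `|z|)%:R <= (K + 2 * L)%:R :> R by rewrite ler_nat.
  by rewrite natrD !natrM; lra.
have KR0 : (0 < K)%N by rewrite muln_gt0 M0.
have H := HQ K z%:~R KR0 zK.
rewrite -real_normK ?num_real //.
rewrite (_ : expR (- (d / 2) * _) = expR (- (d / 4) * K%:R) ^+ 2); last first.
  by rewrite -expRM_natr; congr expR; field.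
rewrite mulrA -expr2 -exprMn ler_sqr // nnegrE //.
by apply: mulr_ge0 => //; exact: expR_ge0.
Qed.

(** The frame bounds of a cycle of length (2 n + 1) M, indexed symmetrically: positions are shifted
    by n M and translations by n, and the modulation changes by a factor e^(2 pi j l n) = 1. *)
Let per_sum_bounds f L n : (L <= n * M)%N ->
  M%:R * A * zpart (fun k => cabs2 (f k)) L <=
  zpart (fun k => \sum_(l < M) cabs2 (\sum_(i < (2 * L).+1) f (i%:Z - L%:Z) *
     cconj ((per R G ((2 * n).+1 * M) (i%:Z - L%:Z - k * M%:Z)%:~R)%:C%C * cexpi (l%:R / M%:R * (i%:Z - L%:Z)%:~R)))) n
  <= M%:R * B * zpart (fun k => cabs2 (f k)) L.
Proof.
move=> Ln; have MR : M%:R != 0 :> R by rewrite pnatr_eq0 -lt0n.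
pose F (k : int) : C := if (`|k| <= L)%N then f k else 0.
have F0 k : (L < `|k|)%N -> F k = 0 by rewrite ltnNge /F => /negbTE ->.
have FL (i : 'I_(2 * L).+1) : F (i%:Z - L%:Z) = f (i%:Z - L%:Z).
  by rewrite /F ifT //; have := ltn_ord i; lia.
have HK i j : (i < M)%N -> (j < (2 * n).+1)%N -> A <= zak_sqr R G M (2 * pi * j%:R / (2 * n).+1%:R) i%:R <= B.
  move=> iM jN; apply: HAB => //; have p0 := @pi_gt0 R.
  have jR : j%:R <= (2 * n).+1%:R :> R by rewrite ler_nat ltnW.
  rewrite divr_ge0 ?mulr_ge0 ?(ltW p0) //= ler_pdivrMr ?ltr0n // ler_wpM2l //.
  by rewrite mulr_ge0 // ltW.
have := per_frame_bounds R d A0 G HG M (2 * n).+1 A B (fun k => F (k - (n * M)%N%:Z)) M0 isT HK.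
rewrite (window_sum _ (fun k => cabs2 (F k)) L n M M0 Ln); last by move=> k /F0 ->; rewrite cabs2_0.
rewrite (_ : \sum_(i < (2 * L).+1) _ = zpart (fun k => cabs2 (f k)) L); last first.
  by apply: eq_bigr => i _; rewrite FL.
rewrite [X in _ <= X <= _ -> _](_ : _ = zpart (fun k => \sum_(l < M) cabs2 (\sum_(i < (2 * L).+1) f (i%:Z - L%:Z) *
     cconj ((per R G ((2 * n).+1 * M) (i%:Z - L%:Z - k * M%:Z)%:~R)%:C%C * cexpi (l%:R / M%:R * (i%:Z - L%:Z)%:~R)))) n) //.
rewrite /zpart; apply: eq_bigr => k _; apply: eq_bigr => l _; congr cabs2.
pose H (z : int) : C := F z * cconj ((per R G ((2 * n).+1 * M) (z - (k%:Z - n%:Z) * M%:Z)%:~R)%:C%C *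
   cexpi (l%:R / M%:R * z%:~R)).
transitivity (\sum_(i < (2 * n).+1 * M) H (i%:Z - (n * M)%N%:Z)).
  apply: eq_bigr => i _; rewrite /H; congr (_ * cconj (_%:C%C * _)).
    by congr (per _ _ _ _%:~R); rewrite !PoszM; ring.
  rewrite (_ : _ * i%:R = l%:R / M%:R * (i%:Z - (n * M)%N%:Z)%:~R + (l%:Z * n%:Z)%:~R).
    by rewrite cexpiD cexpi_int mulr1.
  by rewrite PoszM rmorphB !rmorphM /=; field.
rewrite (window_sum _ H L n M M0 Ln); last by move=> z /F0 z0; rewrite /H z0 mul0r.
by apply: eq_bigr => i _; rewrite /H FL.
Qed.

Let zpart_le2 (u v : int -> R) (c : R) n : (forall k : int, (`|k| <= n)%N -> u k <= 2 * v k + c) ->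
  zpart u n <= 2 * zpart v n + (2 * n).+1%:R * c.
Proof.
move=> H; rewrite /zpart mulr_sumr (_ : _%:R * c = \sum_(i < (2 * n).+1) c); last first.
  by rewrite sumr_const card_ord mulr_natl.
rewrite -big_split /=; apply: ler_sum => i _; apply: H.
by have := ltn_ord i; lia.
Qed.

Let dsqr_near f L (e : R) n0 : 0 < e -> exists2 n, (n0 <= n)%N &
  M%:R * A * zpart (fun k => cabs2 (f k)) L <= 2 * zpart (dsqr f L) n + e /\
  zpart (dsqr f L) n <= 2 * (M%:R * B * zpart (fun k => cabs2 (f k)) L) + e.
Proof.
move=> e0; have [d0 _] := HG; have [Q Q0 HQ] := dpart_close f L.
have MR : 0 < M%:R :> R by rewrite ltr0n.
(* There are about K coefficients, each with an error of order e^(-d K/2); by [expR_decay] their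
   total is at most 32 Q / (d^2 K), hence at most e for this n. *)
pose n := (n0 + L + Num.bound (32 * Q / (d ^+ 2 * e)))%N; exists n; first by rewrite /n -addnA leq_addr.
have Ln : (L <= n * M)%N by rewrite /n; nia.
set K := ((2 * n).+1 * M)%N.
have KR : 0 < K%:R :> R by rewrite ltr0n muln_gt0 M0.
have HK : 32 * Q / (d ^+ 2 * e) <= K%:R.
  apply: (@le_trans _ _ (Num.bound (32 * Q / (d ^+ 2 * e)))%:R).
    by apply: ltW; apply: archi_boundP; rewrite divr_ge0 ?mulr_ge0 ?sqr_ge0 // ltW.
  by rewrite ler_nat /K /n; nia.
pose c := 2 * M%:R * (Q * expR (- (d / 2) * K%:R)).
have ce : (2 * n).+1%:R * c <= e.
  have d2 : 0 < d / 2 by lra.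
  have H := expR_decay R (d / 2) d2 K%:R KR.
  have H2 : Q * (K%:R * expR (- (d / 2) * K%:R)) <= Q * (4 / ((d / 2) ^+ 2 * K%:R)) by rewrite ler_wpM2l.
  rewrite (_ : (2 * n).+1%:R * c = 2 * (Q * (K%:R * expR (- (d / 2) * K%:R)))); last first.
    by rewrite /c /K natrM; ring.
  apply: (@le_trans _ _ (2 * (Q * (4 / ((d / 2) ^+ 2 * K%:R))))); first by rewrite ler_wpM2l.
  rewrite (_ : 2 * _ = 32 * Q / (d ^+ 2) / K%:R); last by field; rewrite !gt_eqF.
  rewrite ler_pdivrMr //.
  move: HK; rewrite ler_pdivrMr ?mulr_gt0 ?exprn_gt0 // => HK.
  by rewrite ler_pdivrMr ?exprn_gt0 //; lra.
have /andP[P1 P2] := per_sum_bounds f L n Ln.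
split.
  apply: le_trans P1 _; apply: le_trans (lerD (lexx _) ce); apply: zpart_le2 => k kn.
  rewrite /dsqr mulr_sumr (_ : c = \sum_(l < M) 2 * (Q * expR (- (d / 2) * K%:R))); last first.
    by rewrite sumr_const card_ord /c -[RHS]mulr_natl; ring.
  rewrite -big_split /=; apply: ler_sum => l _.
  have H := HQ n k l Ln kn; apply: le_trans (lerD (lexx _) (ler_wpM2l _ H)) => //.
  set Y := \sum_(i < _) _; rewrite -[X in cabs2 X <= _](subKr (dpart f k l L)).
  by apply: le_trans (cabs2D_le _ _ _) _; rewrite cabs2N.
apply: (@le_trans _ _ (2 * zpart (fun k => \sum_(l < M) cabs2 (\sum_(i < (2 * L).+1) f (i%:Z - L%:Z) *
     cconj ((per R G K (i%:Z - L%:Z - k * M%:Z)%:~R)%:C%C * cexpi (l%:R / M%:R * (i%:Z - L%:Z)%:~R)))) n + e)).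
  apply: le_trans (lerD (lexx _) ce); apply: zpart_le2 => k kn.
  rewrite /dsqr mulr_sumr (_ : c = \sum_(l < M) 2 * (Q * expR (- (d / 2) * K%:R))); last first.
    by rewrite sumr_const card_ord /c -[RHS]mulr_natl; ring.
  rewrite -big_split /=; apply: ler_sum => l _.
  have H := HQ n k l Ln kn; apply: le_trans (lerD (lexx _) (ler_wpM2l _ H)) => //.
  set Y := \sum_(i < _) _; rewrite -[X in cabs2 X <= _](subrK Y) addrC.
  exact: cabs2D_le.
by rewrite lerD2r ler_wpM2l.
Qed.

Let dsqr_upper f L N : zpart (dsqr f L) N <= 2 * (M%:R * B * zpart (fun k => cabs2 (f k)) L).
Proof.
apply/ler_addgt0Pr => e e0; have [n Nn [_ H]] := dsqr_near f L e N e0.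
apply: le_trans H; rewrite -(subnKC Nn); elim: (n - N)%N => [|p IH]; first by rewrite addn0.
by rewrite addnS zpartS (le_trans IH) // lerDl addr_ge0.
Qed.

Let dsqr_lower f L S : (forall n, zpart (dsqr f L) n <= S) ->
  M%:R * A * zpart (fun k => cabs2 (f k)) L <= 2 * S.
Proof.
move=> HS; apply/ler_addgt0Pr => e e0; have [n _ [H _]] := dsqr_near f L e 0 e0.
by apply: le_trans H _; rewrite lerD2r ler_wpM2l.
Qed.

Let window_decay (k n : int) :
  `|G (n - k * M%:Z)%:~R| <= A0 * expR (d * `|- (k * M%:Z)%:~R|) * expR (- d * 1) ^+ `|n|.
Proof.
have [_ Hx] := expdec_expb R _ ltr01 _ _ _ (- (k * M%:Z)%:~R) HG.
have := Hx (- n); rewrite abszN (_ : - _ - (- n)%:~R * 1 = (n - k * M%:Z)%:~R) //.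
by rewrite rmorphB rmorphN; ring.
Qed.

Let cvg_coef f k l b : (forall n, cabs2 (f n) <= b ^+ 2) -> 0 <= b ->
  exists A1 r, [/\ 0 <= r < 1, expb A1 r (fun n => complex.Re (term f k l n)) &
    expb A1 r (fun n => complex.Im (term f k l n))].
Proof.
move=> fb b0; have [Hr Hx] := expdec_expb R _ ltr01 _ _ _ (- (k * M%:Z)%:~R) HG.
exists (b * (A0 * expR (d * `|- (k * M%:Z)%:~R|))), (expR (- d * 1)).
have H n : cabs2 (term f k l n) <= (b * (A0 * expR (d * `|- (k * M%:Z)%:~R|)) * expR (- d * 1) ^+ `|n|) ^+ 2.
  rewrite /term cabs2M cabs2_cconj cabs2M cabs2_cexpi mulr1 -mulrA exprMn.
  apply: ler_pM; rewrite ?cabs2_ge0 //.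
  rewrite (_ : cabs2 _ = G (n - k * M%:Z)%:~R ^+ 2); last by rewrite /cabs2 /= expr0n addr0.
  have H := window_decay k n.
  rewrite -real_normK ?num_real // ler_sqr ?nnegrE //.
  exact: le_trans (normr_ge0 _) H.
split; first by lra.
- move=> n; have := H n; rewrite /cabs2 => H1.
  have bn : 0 <= b * (A0 * expR (d * `|- (k * M%:Z)%:~R|)) * expR (- d * 1) ^+ `|n|.
    by rewrite !mulr_ge0 ?expR_ge0 ?exprn_ge0 ?expR_ge0 //; exact: expdec_ge0 HG.
  rewrite -ler_sqr ?nnegrE // real_normK ?num_real //.
  by apply: le_trans H1; rewrite lerDl sqr_ge0.
- move=> n; have := H n; rewrite /cabs2 => H1.
  have bn : 0 <= b * (A0 * expR (d * `|- (k * M%:Z)%:~R|)) * expR (- d * 1) ^+ `|n|.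
    by rewrite !mulr_ge0 ?expR_ge0 ?exprn_ge0 ?expR_ge0 //; exact: expdec_ge0 HG.
  rewrite -ler_sqr ?nnegrE // real_normK ?num_real //.
  by apply: le_trans H1; rewrite lerDr sqr_ge0.
Qed.

Let dpartE f k l L : dpart f k l L =
  Complex (zpart (fun n => complex.Re (term f k l n)) L) (zpart (fun n => complex.Im (term f k l n)) L).
Proof. by rewrite /zpart -Complex_sum; apply: eq_bigr => i _; case: (term _ _ _ _). Qed.

Let csqr f k := \sum_(l < M) cabs2 (coef f k l).

Let csqr_cvg f b N : (forall n, cabs2 (f n) <= b ^+ 2) -> 0 <= b ->
  zpart (dsqr f L) N @[L --> \oo] --> zpart (csqr f) N.
Proof.
move=> fb b0; rewrite /zpart; apply: cvg_bigsum => i; apply: cvg_bigsum => l.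
set k := _ - _; have [A1 [r [Hr Hre Him]]] := cvg_coef f k l b fb b0.
under eq_fun do rewrite dpartE; rewrite /cabs2 /=.
by apply: cvgD; rewrite !expr2; under eq_fun do rewrite expr2; apply: cvgM; apply: zs_cvg; eassumption.
Qed.

Let zpart_mono (u : int -> R) n p : (forall k, 0 <= u k) -> zpart u n <= zpart u (n + p).
Proof.
move=> u0; elim: p => [|p IH]; first by rewrite addn0.
by rewrite addnS zpartS (le_trans IH) // lerDl addr_ge0.
Qed.

Let term_le_zpart (u : int -> R) (n : int) : (forall k, 0 <= u k) -> u n <= zpart u `|n|%N.
Proof.
move=> u0; have p0 N : 0 <= zpart u N by apply: sumr_ge0.
case: n => [[|n]|n] /=; first by rewrite zpart0.
  by rewrite zpartS; have := p0 n; have := u0 (- n.+1%:Z); lra.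
by rewrite zpartS NegzE; have := p0 n; have := u0 n.+1%:Z; lra.
Qed.

Let csqr_upper f s N : 0 <= s -> (forall L, zpart (fun k => cabs2 (f k)) L <= s) ->
  zpart (csqr f) N <= 2 * (M%:R * B * s).
Proof.
move=> s0 Hs; have fb n : cabs2 (f n) <= Num.sqrt s ^+ 2.
  rewrite sqr_sqrtr //; apply: le_trans (Hs `|n|%N); by apply: (term_le_zpart (fun k => cabs2 (f k))) => k; exact: cabs2_ge0.
apply: (cvgr_to_le (csqr_cvg f _ N fb (sqrtr_ge0 _))); apply: nearW => L.
apply: le_trans (dsqr_upper f L N) _; rewrite !(ler_wpM2l, Hs) //.
by apply: mulr_ge0 => //; exact: ltW.
Qed.

Let tail (V : zmodType) (u : int -> V) (L : nat) (n : int) := if (`|n| <= L)%N then 0 else u n.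

Let zpart_tail0 (u : int -> R) L p : zpart (tail _ u L) (p + L) = zpart u (p + L) - zpart u L.
Proof.
elim: p => [|p IH].
  rewrite subrr; apply: big1 => i _; rewrite /tail ifT //.
  by have := ltn_ord i; lia.
rewrite addSn !zpartS IH /tail !ifF; [by rewrite addrAC|apply/negbTE; lia|apply/negbTE; lia].
Qed.

Let zs_tail0 A1 r (u : int -> R) L : 0 <= r < 1 -> expb A1 r u -> zs (tail _ u L) = zs u - zpart u L.
Proof.
move=> Hr Hu; apply/cvg_lim => //; rewrite -(cvg_shiftn L); under eq_fun do rewrite zpart_tail0.
apply: cvgB; last exact: cvg_cst.
by rewrite (cvg_shiftn L); exact: zs_cvg Hr Hu.
Qed.

Let coef_tail f k l L b : (forall n, cabs2 (f n) <= b ^+ 2) -> 0 <= b ->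
  coef (tail _ f L) k l = coef f k l - dpart f k l L.
Proof.
move=> fb b0; have [A1 [r [Hr Hre Him]]] := cvg_coef f k l b fb b0.
have E T : term (tail _ f L) k l T = tail _ (term f k l) L T.
  by rewrite /term /tail; case: ifP => //; rewrite mul0r.
rewrite dpartE /coef /zsum; simpc; congr Complex.
  transitivity (zs (tail _ (fun n => complex.Re (term f k l n)) L)).
    apply: (eq_zs R (fun n => complex.Re (term (tail _ f L) k l n))) => n.
    by rewrite E /tail; case: ifP.
  exact: zs_tail0 Hr Hre.
transitivity (zs (tail _ (fun n => complex.Im (term f k l n)) L)).
  apply: (eq_zs R (fun n => complex.Im (term (tail _ f L) k l n))) => n.
  by rewrite E /tail; case: ifP.
exact: zs_tail0 Hr Him.
Qed.

(** The lower bound for truncations sums over all translations k, so the truncation length L cannot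
    tend to infinity at a fixed cutoff N in k. Instead f is split at L, and the tail is controlled
    by [csqr_upper]. *)
Let csqr_lower f s c : 0 <= s -> (forall L, zpart (fun k => cabs2 (f k)) L <= s) ->
  (forall e, 0 < e -> exists L, s - e <= zpart (fun k => cabs2 (f k)) L) ->
  (forall N, zpart (csqr f) N <= c) -> M%:R * A * s <= 4 * c.
Proof.
move=> s0 Hs He Hc; have fb n : cabs2 (f n) <= Num.sqrt s ^+ 2.
  rewrite sqr_sqrtr //; apply: le_trans (Hs `|n|%N); by apply: (term_le_zpart (fun k => cabs2 (f k))) => k; exact: cabs2_ge0.
have MR : 0 < M%:R :> R by rewrite ltr0n.
have MA : 0 < M%:R * A by exact: mulr_gt0.
have MB : 0 < M%:R * B by exact: mulr_gt0.
(* The estimates give M A z <= 4 c + 8 M B (s - z) with s - z <= e1, so replacing z by s costs at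
   most (M A + 8 M B) e1 = e. *)
apply/ler_addgt0Pr => e e0; pose e1 := e / (M%:R * A + 8 * (M%:R * B)).
have D0 : 0 < M%:R * A + 8 * (M%:R * B) by lra.
have e10 : 0 < e1 by rewrite divr_gt0.
have [L HL] := He e1 e10; set z := zpart _ L in HL.
have tb N : zpart (fun k => cabs2 (tail _ f L k)) N <= s - z.
  have tE : (fun k => cabs2 (tail _ f L k)) = tail _ (fun k => cabs2 (f k)) L.
    by apply/funext => k; rewrite /tail; case: ifP => // _; rewrite cabs2_0.
  apply: (@le_trans _ _ (zpart (tail _ (fun k => cabs2 (f k)) L) (N + L))).
    by rewrite tE; apply: zpart_mono => k; rewrite -tE cabs2_ge0.
  by rewrite zpart_tail0 lerB.
have sz : 0 <= s - z by rewrite subr_ge0 Hs.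
have HT N : zpart (csqr (tail _ f L)) N <= _ := csqr_upper _ _ N sz tb.
have H N : zpart (dsqr f L) N <= 2 * c + 2 * (2 * (M%:R * B * (s - z))).
  apply: (@le_trans _ _ (2 * zpart (csqr f) N + 2 * zpart (csqr (tail _ f L)) N)); last first.
    by apply: lerD; rewrite ler_wpM2l // HT.
  rewrite /zpart !mulr_sumr -big_split /=; apply: ler_sum => i _.
  rewrite /dsqr /csqr !mulr_sumr -big_split /=; apply: ler_sum => l _.
  set k := _ - _; rewrite -[leLHS]cabs2N -[in leRHS](cabs2N _ (coef f k l)).
  rewrite [leLHS](_ : _ = cabs2 (- coef f k l + coef (tail _ f L) k l)); first exact: cabs2D_le.
  by rewrite (coef_tail _ _ _ _ _ fb (sqrtr_ge0 _)) addKr.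
have HF := dsqr_lower f L _ H; rewrite -/z in HF.
have E : e = (M%:R * A + 8 * (M%:R * B)) * e1 by rewrite /e1 mulrC divfK // gt_eqF.
have := ler_wpM2l (ltW MA) HL; have := ler_wpM2l (ltW MB) HL.
rewrite E; lra.
Qed.

Lemma l2Z_frame : is_frame (@l2Z R) (@ipl2Z R) (@nrm2l2Z R) (@gabor_Sg R g M).
Proof.
have MR : 0 < M%:R :> R by rewrite ltr0n.
split.
  move=> [k l]; rewrite /l2Z /=; have Hf n : cabs2 ((fun=> 1 : C) n) <= 1 ^+ 2 by rewrite /cabs2 /= expr0n !expr1n addr0.
  have [Hr Hx] := expdec_expb R _ ltr01 _ _ _ (- (k * M%:Z)%:~R) HG.
  set A1 := A0 * _ in Hx; set r := expR _ in Hr Hx.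
  have Hr' : 0 <= r < 1 by lra.
  have Hu : expb (A1 * A1) r (fun n => cabs2 (gabor_Sg g (k, l) n)).
    move=> n; rewrite /gabor_Sg /tfZ /sample /= cabs2M cabs2_cexpi mulr1 gG.
    rewrite (_ : cabs2 _ = G (n - k * M%:Z)%:~R ^+ 2); last by rewrite /cabs2 /= expr0n addr0.
    have H : `|G (n - k * M%:Z)%:~R| <= A1 * r ^+ `|n| by exact: window_decay.
    have A10 : 0 <= A1 by have := expb_ge0 _ _ _ _ Hx.
    have rn : 0 <= r ^+ `|n| <= 1 by rewrite exprn_ge0 ?exprn_ile1 //; lra.
    rewrite ger0_norm ?sqr_ge0 // -real_normK ?num_real //.
    apply: (@le_trans _ _ ((A1 * r ^+ `|n|) ^+ 2)).
      by rewrite ler_sqr ?nnegrE // (le_trans _ H).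
    have H1 : 0 <= A1 * A1 by exact: mulr_ge0.
    by rewrite exprMn !expr2; apply: ler_wpM2l => //; rewrite ler_piMr //; lra.
  apply: le_lt_trans (esum_le_zpart _ _ (3 * (A1 * A1) / (1 - r)) _ _) (ltry _) => [n|N].
    exact: cabs2_ge0.
  by apply: le_trans (ler_norm _) _; exact: zpart_bound.
(* The factors come from |a + b|^2 <= 2 |a|^2 + 2 |b|^2: once, for periodization, in the upper
   bound; twice, for periodization and truncation, in the lower. *)
exists (M%:R * A / 4), (2 * (M%:R * B)); split; first by rewrite divr_gt0 ?mulr_gt0.
split; first by rewrite !mulr_gt0.
move=> f; rewrite /l2Z /nrm2l2Z => /= fin.
have f0 k : 0 <= cabs2 (f k) by exact: cabs2_ge0.
have E : (\esum_(i in [set: int * 'I_M]) (cabs2 (ipl2Z f (gabor_Sg g i)))%:E =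
    \esum_(k in [set: int]) (csqr f k)%:E)%E.
  rewrite esum_pair_finType; last by move=> t; exact: cabs2_ge0.
  apply: eq_esum => k _; congr (_%:E); apply: eq_bigr => l _; congr cabs2.
  by congr zsum; apply/funext => n; rewrite /gabor_Sg /tfZ /sample /= gG.
rewrite E; set S := (\esum_(n in _) (cabs2 (f n))%:E)%E in fin *.
have S0 : (0 <= S)%E by apply: esum_ge0 => n _; rewrite lee_fin.
have SE : S = (fine S)%:E by rewrite fineK // ge0_fin_numE.
have s0 : 0 <= fine S by rewrite fine_ge0.
have Hs L : zpart (fun k => cabs2 (f k)) L <= fine S.
  by rewrite -lee_fin -SE; exact: zpart_le_esum.
have He e : 0 < e -> exists L, fine S - e <= zpart (fun k => cabs2 (f k)) L.
  move=> e0; apply: contrapT => /forallNP H.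
  have : (S <= (fine S - e)%:E)%E.
    by apply: esum_le_zpart => // L; rewrite leNgt; apply/negP => /ltW; exact: H.
  by rewrite {1}SE lee_fin; lra.
have c0 k : 0 <= csqr f k by apply: sumr_ge0 => l _; exact: cabs2_ge0.
have up : (\esum_(k in [set: int]) (csqr f k)%:E <= (2 * (M%:R * B) * fine S)%:E)%E.
  by apply: esum_le_zpart => // N; rewrite -mulrA; exact: csqr_upper.
split=> //; set T := (\esum_(k in _) _)%E in up *.
have T0 : (0 <= T)%E by apply: esum_ge0 => n _; rewrite lee_fin.
have TE : T = (fine T)%:E by rewrite fineK // ge0_fin_numE // (le_lt_trans up) // ltry.
have Hc N : zpart (csqr f) N <= fine T by rewrite -lee_fin -TE; exact: zpart_le_esum.
have := csqr_lower f (fine S) (fine T) s0 Hs He Hc.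
by rewrite TE lee_fin; lra.
Qed.

End InfiniteFrame.

(** * Parseval's identity on an interval *)

Section Density.
Variable R : realType.
Notation mu := (@lebesgue_measure R).
Variable T : R.
Hypothesis T0 : 0 < T.
(* The interval is open so that indicators of rays are pointwise limits of
   trigonometric polynomials, which cannot separate 0 from T. *)
Let I : set R := `]0, T[%classic.
Let w : R := 2 * pi / T.

Implicit Types (f g h G : R -> R) (c e B t : R).

Let mI : measurable I. Proof. exact: measurable_itv. Qed.

Let I_fin c : mu.-integrable I (EFin \o (fun=> c : R)).
Proof.
have H : mu.-integrable `[0, T] (EFin \o (fun=> c : R)).
  by apply: (integrable_bounded_itv R _ _ `|c|) => //; exact: measurable_cst.
by apply: integrableS H => //; exact: subset_itv_oo_cc.
Qed.

Definition l2fun (f : R -> R) := measurable_fun I f /\ mu.-integrable I (EFin \o (fun t => f t ^+ 2)).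

Lemma l2fun_le f g : measurable_fun I f -> (forall t, I t -> `|f t| <= `|g t|) -> l2fun g -> l2fun f.
Proof.
move=> mf fg [mg gi]; split=> //; apply: (integrable_le R _ _ _ mI _ _ gi).
  exact: measurable_funX.
by move=> t It; rewrite normrX -[leRHS]real_normK ?num_real // ler_sqr ?nnegrE ?fg.
Qed.

Lemma l2funD f g : l2fun f -> l2fun g -> l2fun (fun t => f t + g t).
Proof.
move=> [mf fi] [mg gi]; split; first exact: measurable_funD.
apply: (integrable_le R _ _ (fun t => 2 * f t ^+ 2 + 2 * g t ^+ 2) mI).
- by apply: measurable_funX; exact: measurable_funD.
- move=> t _; rewrite ger0_norm ?sqr_ge0 //.
  by have := sqr_ge0 (f t - g t); nra.
- by apply: integrable_add => //; apply: integrable_scale.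
Qed.

Lemma l2funZ c f : l2fun f -> l2fun (fun t => c * f t).
Proof.
move=> [mf fi]; split; first exact: measurable_funM.
rewrite (_ : (fun t => _) = (fun t => c ^+ 2 * f t ^+ 2)); first exact: integrable_scale.
by apply/funext => t; rewrite exprMn.
Qed.

Lemma l2funB f g : l2fun f -> l2fun g -> l2fun (fun t => f t - g t).
Proof.
move=> Hf Hg; rewrite (_ : (fun t => _) = (fun t => f t + (-1) * g t)).
  by apply: l2funD => //; exact: l2funZ.
by apply/funext => t; rewrite mulN1r.
Qed.

Lemma l2fun_bounded f B : measurable_fun I f -> (forall t, I t -> `|f t| <= B) -> l2fun f.
Proof.
move=> mf fB; apply: (l2fun_le _ (fun=> B)) => //.
  by move=> t It; rewrite (le_trans (fB t It)) // ler_norm.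
Qed.

Lemma l2fun_mul f g : l2fun f -> l2fun g -> mu.-integrable I (EFin \o (fun t => f t * g t)).
Proof.
move=> [mf fi] [mg gi].
apply: (integrable_le R _ _ (fun t => f t ^+ 2 + g t ^+ 2) mI); last exact: integrable_add.
  exact: measurable_funM.
move=> t _; rewrite ler_norml.
by have := sqr_ge0 (f t - g t); have := sqr_ge0 (f t + g t); have := sqr_ge0 (f t); have := sqr_ge0 (g t); nra.
Qed.

Lemma l2fun_trig h : trig w h -> l2fun h.
Proof.
move=> th; have [B HB] := trig_bounded _ _ _ th; apply: (l2fun_bounded _ B) => // .
by apply: measurable_continuous => //; exact: trig_continuous th.
Qed.

Definition dist2 (f g : R -> R) : R := \int[mu]_(t in I) ((f t - g t) ^+ 2).

Lemma dist2_triangle f g h : l2fun f -> l2fun g -> l2fun h ->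
  dist2 f h <= 2 * dist2 f g + 2 * dist2 g h.
Proof.
move=> Hf Hg Hh; have [_ fg] := l2funB _ _ Hf Hg; have [_ gh] := l2funB _ _ Hg Hh.
have [_ fh] := l2funB _ _ Hf Hh.
rewrite /dist2 -!RintegralZl // -RintegralD //; [|exact: integrable_scale|exact: integrable_scale].
apply: le_Rintegral => //; first by apply: integrable_add => //; exact: integrable_scale.
move=> t _; have := sqr_ge0 (f t - g t - (g t - h t)); nra.
Qed.

Definition dense_trig (f : R -> R) := l2fun f /\
  forall e, 0 < e -> exists2 h, trig w h & dist2 f h < e.

Lemma dense_trig_lim f : l2fun f -> (forall e, 0 < e -> exists2 g, dense_trig g & dist2 f g < e) ->
  dense_trig f.
Proof.
move=> Hf H; split=> // e e0; have e4 : 0 < e / 4 by lra.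
have [g [Hg Dg] fg] := H _ e4; have [h th gh] := Dg _ e4; exists h => //.
have := dist2_triangle _ _ _ Hf Hg (l2fun_trig _ th); lra.
Qed.

Lemma dense_trig_trig h : trig w h -> dense_trig h.
Proof.
move=> th; split; first exact: l2fun_trig.
move=> e e0; exists h => //; rewrite /dist2.
by under eq_Rintegral do rewrite subrr expr0n; rewrite Rintegral_cst // mul0r.
Qed.

Lemma dense_trigD f g : dense_trig f -> dense_trig g -> dense_trig (fun t => f t + g t).
Proof.
move=> [Hf Df] [Hg Dg]; split; first exact: l2funD.
move=> e e0; have e4 : 0 < e / 4 by lra.
have [h th fh] := Df _ e4; have [k tk gk] := Dg _ e4.
exists (fun t => h t + k t); first exact: trig_add.
apply: (@le_lt_trans _ _ (2 * dist2 f h + 2 * dist2 g k)); last by lra.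
have Lh := l2fun_trig _ th; have Lk := l2fun_trig _ tk.
have [_ i1] := l2funB _ _ Hf Lh; have [_ i2] := l2funB _ _ Hg Lk.
have [_ i3] := l2funB _ _ (l2funD _ _ Hf Hg) (l2funD _ _ Lh Lk).
rewrite /dist2 -!RintegralZl // -RintegralD //; [|exact: integrable_scale|exact: integrable_scale].
apply: le_Rintegral => //; first by apply: integrable_add => //; exact: integrable_scale.
move=> t _; have := sqr_ge0 (f t - h t - (g t - k t)); nra.
Qed.

Lemma dense_trigZ c f : dense_trig f -> dense_trig (fun t => c * f t).
Proof.
move=> [Hf Df]; split; first exact: l2funZ.
move=> e e0; have c1 : 0 < 1 + c ^+ 2 by rewrite ltr_pwDl // sqr_ge0.
have [h th fh] := Df _ (divr_gt0 e0 c1); exists (fun t => c * h t); first exact: trig_scale.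
have [_ i1] := l2funB _ _ Hf (l2fun_trig _ th).
have d0 : 0 <= dist2 f h by apply: Rintegral_ge0 => t _; exact: sqr_ge0.
rewrite /dist2 (_ : \int[mu]_(t in I) _ = c ^+ 2 * dist2 f h); last first.
  by rewrite /dist2 -RintegralZl //; apply: eq_Rintegral => t _; ring.
by move: fh; rewrite ltr_pdivlMr //; nra.
Qed.

(** The squared differences are at most 4 G^2 and tend to 0 pointwise, so the convergence holds in
    the mean square. *)
Lemma dense_trig_dominated (f_ : nat -> R -> R) f G : (forall n, dense_trig (f_ n)) ->
  measurable_fun I f -> l2fun G -> (forall n t, I t -> `|f_ n t| <= G t) ->
  (forall t, I t -> f_ n t @[n --> \oo] --> f t) -> (forall t, I t -> `|f t| <= G t) ->
  dense_trig f.
Proof.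
move=> Df mf HG fG cv fG'.
have Hf : l2fun f by apply: (l2fun_le _ G) => // t It; rewrite (le_trans (fG' t It)) // ler_norm.
apply: dense_trig_lim => // e e0.
have [||||_ cvd] := Rintegral_dominated_cvg_pt R I (fun n t => (f t - f_ n t) ^+ 2) (fun=> 0)
    (fun t => 4 * G t ^+ 2) mI.
- by move=> n; apply: measurable_funX; apply: measurable_funB => //; have [[]] := Df n.
- move=> t It; have {}cv := cv t It.
  rewrite -[X in _ --> X](_ : (f t - f t) ^+ 2 = 0); last by rewrite subrr expr0n.
  by under eq_fun do rewrite expr2; rewrite expr2; apply: cvgM; apply: cvgB => //; exact: cvg_cst.
- by apply: integrable_scale => //; have [] := HG.
- move=> n t It; rewrite ger0_norm ?sqr_ge0 //.
  have := fG n t It; have := fG' t It; rewrite !ler_norml => /andP[? ?] /andP[? ?]; nra.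
move: cvd; rewrite Rintegral_cst // mul0r => /cvgrPdist_lt /(_ e e0) [n _ /(_ n (leqnn n))].
rewrite /= sub0r normrN => H; exists (f_ n) => //.
exact: le_lt_trans (ler_norm _) H.
Qed.

Let mI0 (A : set R) : measurable A -> measurable_fun I (\1_A : R -> R).
Proof. by move=> mA; exact: measurable_indic. Qed.

Let indic_le1 (A : set R) t : `|\1_A t : R| <= 1.
Proof. by rewrite indicE; case: (_ \in _); rewrite ?normr1 ?normr0. Qed.

Let l2fun1 : l2fun (fun=> 1).
Proof. by apply: (l2fun_bounded _ 1) => [|t _]; [exact: measurable_cst|rewrite normr1]. Qed.

Lemma dense_trig_eq f g : (forall t, I t -> f t = g t) -> dense_trig f -> measurable_fun I g -> dense_trig g.
Proof.
move=> fg [Hf Df] mg; split; first by apply: (l2fun_le _ f) => // t It; rewrite fg.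
move=> e e0; have [h th H] := Df e e0; exists h => //.
rewrite (_ : dist2 g h = dist2 f h) //.
by apply: eq_Rintegral => t; rewrite inE => It; rewrite fg.
Qed.

Lemma dense_trig_arc (a d : R) : dense_trig (\1_(arc w a d)).
Proof.
apply: (dense_trig_dominated (arc_approx w a d) _ (fun=> 1)) => //.
- by move=> n; apply: dense_trig_trig; exact: trig_arc_approx.
- by apply: mI0; exact: measurable_arc.
- move=> n t _; have /andP[H0 H1] := arc_approx_itv R w a d n t; by rewrite ger0_norm.
- by move=> t _; exact: arc_approx_cvg.
Qed.

(** Inside ]0, T[ the ray is ]x, T[, which is the arc with centre (x + T)/2 and radius (T - x)/2. *)
Lemma dense_trig_ray (x : R) : dense_trig (\1_(`]x, +oo[%classic)).
Proof.
have mr : measurable_fun I (\1_(`]x, +oo[%classic) : R -> R) by apply: mI0; exact: measurable_itv.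
have [x0|x0] := leP x 0.
  apply: (dense_trig_eq (fun=> 1)) => //; last exact: dense_trig_trig (trig_cst _ _ _).
  move=> t; rewrite /I /= in_itv /= => /andP[t0 tT].
  by rewrite indicE mem_set //= in_itv /= andbT; exact: le_lt_trans t0.
have [xT|xT] := leP T x.
  apply: (dense_trig_eq (fun=> 0)) => //; last exact: dense_trig_trig (trig_cst _ _ _).
  move=> t; rewrite /I /= in_itv /= => /andP[t0 tT].
  by rewrite indicE memNset //= in_itv /= andbT => xt; move: (lt_trans xt tT); rewrite ltNge xT.
apply: (dense_trig_eq (\1_(arc w ((x + T) / 2) ((T - x) / 2)))) => //; last exact: dense_trig_arc.
move=> t; rewrite /I /= in_itv /= => /andP[t0 tT].
have w0 : 0 < w by rewrite divr_gt0 // mulr_gt0 // pi_gt0.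
have wT : w * T = 2 * pi by rewrite /w divfK // gt_eqF.
have p0 := @pi_gt0 R.
have wd : 0 <= w * ((T - x) / 2) <= pi.
  have H1 : 0 < w * x by exact: mulr_gt0.
  have H2 : 0 < w * (T - x) by apply: mulr_gt0 => //; lra.
  by rewrite mulrBr wT in H2; lra.
have wx : 0 < w * x by exact: mulr_gt0.
rewrite !indicE; congr ((nat_of_bool _)%:R).
rewrite /arc; apply/idP/idP => /set_mem /= H; apply/mem_set => /=; move: H; rewrite in_itv /= andbT.
  move=> H; rewrite ltNge; apply/negP => tx; move: H; apply/negP; rewrite -leNgt.
  have wtx : w * t <= w * x by rewrite ler_wpM2l // ltW.
  have wt0 : 0 < w * t by exact: mulr_gt0.
  have E1 : w * ((x + T) / 2 - t) = w * x / 2 + pi - w * t.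
    by rewrite mulrBr mulrA mulrDr wT; lra.
  have E2 : w * ((T - x) / 2) = pi - w * x / 2 by rewrite mulrA mulrBr wT; lra.
  rewrite E2 in wd *; rewrite -[cos (w * (t - _))]cosN -mulrN opprB E1.
  (* When the angle from t to the centre exceeds pi, the cosine is compared at 2 pi minus this
     angle; either way the angle is at least that of the radius. *)
  have [le|gt] := leP (w * x / 2 + pi - w * t) pi.
    by rewrite leNgt ltr_cos ?in_itv /=; lra.
  rewrite (_ : cos (_ - w * t) = cos (2 * pi - (w * x / 2 + pi - w * t))); last first.
    rewrite [RHS]cosB (_ : 2 * pi = pi *+ 2); last by rewrite mulr_natl.
    by rewrite cos2pi sin2pi mul1r mul0r addr0.
  by rewrite leNgt ltr_cos ?in_itv /=; lra.
move=> xt; have wxt : w * x < w * t by rewrite ltr_pM2l.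
have wtT : w * t < w * T by rewrite ltr_pM2l.
rewrite -[ltRHS]cos_norm normrM (gtr0_norm w0).
have H : w * `|t - (x + T) / 2| < w * ((T - x) / 2).
  by rewrite ltr_pM2l // ltr_norml; lra.
have H0 : 0 <= w * `|t - (x + T) / 2| by rewrite mulr_ge0 // ltW.
by rewrite ltr_cos // in_itv /=; lra.
Qed.

(** Rays are stable under intersection and generate the Borel sets; the class is closed under
    complements by linearity and under disjoint countable unions by domination. *)
Lemma dense_trig_indic (A : set R) : measurable A -> dense_trig (\1_A).
Proof.
move=> mA; pose P (A : set R) := dense_trig (\1_A).
have := @dynkin_induction _ (measurableTypeR R) (@RGenOInfty.G R) P.
have E : @measurable _ (measurableTypeR R) = <<s @RGenOInfty.G R >> by exact: RGenOInfty.measurableE.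
apply=> //; last by rewrite -E.
- move=> _ _ [x ->] [y ->]; exists (Num.max x y); apply/seteqP; split=> t /=.
    by rewrite !in_itv /= !andbT gt_max => -[-> ->].
  by rewrite !in_itv /= !andbT gt_max => /andP.
- rewrite /P indicT; exact: dense_trig_trig (trig_cst _ _ _).
- by move=> _ [x ->]; exact: dense_trig_ray.
- move=> S mS HS; rewrite /P.
  apply: (dense_trig_eq (fun t => 1 + (-1) * \1_S t)); last by apply: mI0; exact: measurableC.
    by move=> t _; rewrite !indicE in_setC; case: (t \in S) => /=; lra.
  apply: dense_trigD; first exact: dense_trig_trig (trig_cst _ _ _).
  exact: dense_trigZ.
- move=> F mF tF HF; pose S n := \big[setU/set0]_(k < n) F k.
  have mS n : measurable (S n) by apply: bigsetU_measurable => i _; exact: mF.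
  have DS n : dense_trig (\1_(S n)).
    elim: n => [|n IH].
      rewrite /S big_ord0 indic0; exact: dense_trig_trig (trig_cst _ _ _).
    apply: (dense_trig_eq (fun t => \1_(S n) t + \1_(F n) t)); last exact: (mI0 _ (mS _)).
      move=> t _; rewrite /S big_ord_recr /= -/(S n) !indicE in_setU.
      have : ~ (S n t /\ F n t).
        move=> [Snt Fnt]; move: Snt; rewrite /S -bigcup_mkord => -[k /= kn Fkt].
        have /trivIsetP /(_ k n Logic.I Logic.I) := tF; rewrite neq_ltn kn => /(_ isT) /seteqP[/(_ t) H _].
        exact: H.
      case: (boolP (t \in S n)) => [/set_mem H1|_]; case: (boolP (t \in F n)) => [/set_mem H2|_];
        rewrite /= ?addr0 ?add0r //.
      by case.
    by apply: dense_trigD => //; exact: HF.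
  apply: (dense_trig_dominated (fun n => \1_(S n)) _ (fun=> 1)) => //.
    by apply: mI0; apply: bigcup_measurable => k _; exact: mF.
  move=> t _; rewrite !indicE; case: (boolP (t \in \bigcup_k F k)) => [/set_mem [k _ Fkt]|Nt].
    apply: cvg_near_cst; exists k.+1 => // n /= kn; rewrite indicE mem_set // /S -bigcup_mkord.
    by exists k.
  apply: cvg_near_cst; apply: nearW => n; rewrite indicE memNset // /S -bigcup_mkord => -[k /= _ Fkt].
  by move/negP: Nt; apply; apply/mem_set; exists k.
Qed.

Lemma dense_trig_sum (J : Type) (s : seq J) (F : J -> R -> R) : (forall j, dense_trig (F j)) ->
  dense_trig (fun t => \sum_(j <- s) F j t).
Proof.
move=> HF; elim: s => [|j s IH].
  rewrite (_ : (fun t => _) = (fun=> 0)); first exact: dense_trig_trig (trig_cst _ _ _).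
  by apply/funext => t; rewrite big_nil.
rewrite (_ : (fun t => _) = (fun t => F j t + \sum_(j <- s) F j t)); first exact: dense_trigD.
by apply/funext => t; rewrite big_cons.
Qed.

Import HBNNSimple.

Lemma dense_trig_ge0 f : l2fun f -> (forall t, I t -> 0 <= f t) -> dense_trig f.
Proof.
move=> Hf f0; have [mf _] := Hf.
have mfE : measurable_fun I (EFin \o f) by exact/measurable_EFinP.
pose g n := nnsfun_approx mI mfE n.
have cvE t : I t -> (g n t)%:E @[n --> \oo] --> (f t)%:E.
  by apply: (cvg_nnsfun_approx mI mfE) => s Is; rewrite lee_fin f0.
have cv t : I t -> g n t @[n --> \oo] --> f t.
  by move=> It; have := cvE t It => /fine_cvgP[_].
have gf n t : I t -> 0 <= g n t <= f t.
  move=> It; apply/andP; split; first exact: fun_ge0.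
  rewrite -(cvg_lim _ (cv t It)) //; apply: nondecreasing_cvgn_le; last by apply: cvgP; exact: cv.
  by move=> a b ab; have := @nd_nnsfun_approx _ _ _ _ mI _ mfE a b ab => /lefP /(_ t).
apply: (dense_trig_dominated (fun n => g n) _ f) => //.
- move=> n; rewrite (_ : (g n : R -> R) = fun t => \sum_(y <- finmap.enum_fset (fset_set (range (g n)))) y * \1_(g n @^-1` [set y]) t).
    apply: dense_trig_sum => y; apply: dense_trigZ; apply: dense_trig_indic.
    exact: measurable_funPTI.
  by apply/funext => t; rewrite fimfunE fsbig_finite.
- by move=> n t It; have /andP[g0 gt] := gf n t It; rewrite ger0_norm.
- by move=> t It; rewrite ger0_norm ?f0.
Qed.

Lemma dense_trig_l2 f : l2fun f -> dense_trig f.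
Proof.
move=> Hf; have [mf _] := Hf.
have mN : measurable_fun I (fun t => (-1) * f t) by exact: measurable_funM.
have m0 : measurable_fun I (fun=> 0 : R) by exact: measurable_cst.
apply: (dense_trig_eq (fun t => Num.max (f t) 0 + (-1) * Num.max ((-1) * f t) 0)) => //.
  by move=> t _; rewrite !maxEle; case: ifP; case: ifP; lra.
apply: dense_trigD; last apply: dense_trigZ.
  apply: dense_trig_ge0; last by move=> t _; rewrite le_max lexx orbT.
  apply: (l2fun_le _ f) => //; first exact: measurable_maxr.
  by move=> t _; rewrite maxEle; case: ifP => //; rewrite normr0.
apply: dense_trig_ge0; last by move=> t _; rewrite le_max lexx orbT.
apply: (l2fun_le _ f) => //; first exact: measurable_maxr.
by move=> t _; rewrite maxEle; case: ifP; rewrite ?normr0 // normrM normrN1 mul1r.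
Qed.

End Density.

Section Parseval.
Variable R : realType.
Local Notation C := R[i].
Notation mu := (@lebesgue_measure R).
Variable T : R.
Hypothesis T0 : 0 < T.
Let I : set R := `]0, T[%classic.
Let w : R := 2 * pi / T.
Implicit Types (F H : R -> C) (a : int -> C) (k : int) (t : R).

Let mI : measurable I. Proof. exact: measurable_itv. Qed.

Let e k t : C := cexpi (k%:~R / T * t).

Definition cl2fun F := l2fun R T (fun t => complex.Re (F t)) /\ l2fun R T (fun t => complex.Im (F t)).

Lemma Re_mul (z v : C) : complex.Re (z * v) = complex.Re z * complex.Re v - complex.Im z * complex.Im v.
Proof. by case: z v => [? ?] [? ?]. Qed.

Lemma Im_mul (z v : C) : complex.Im (z * v) = complex.Re z * complex.Im v + complex.Im z * complex.Re v.
Proof. by case: z v => [? ?] [? ?]; simpc. Qed.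

Lemma Re_add (z v : C) : complex.Re (z + v) = complex.Re z + complex.Re v.
Proof. by case: z v => [? ?] [? ?]. Qed.

Lemma Im_add (z v : C) : complex.Im (z + v) = complex.Im z + complex.Im v.
Proof. by case: z v => [? ?] [? ?]. Qed.

Lemma cl2funD F H : cl2fun F -> cl2fun H -> cl2fun (fun t => F t + H t).
Proof.
move=> [F1 F2] [H1 H2]; split; under eq_fun do rewrite ?Re_add ?Im_add; exact: l2funD.
Qed.

Lemma cl2funZ (c : C) F : cl2fun F -> cl2fun (fun t => c * F t).
Proof.
move=> [F1 F2]; split.
  under eq_fun do rewrite Re_mul; apply: l2funB => //; exact: l2funZ.
under eq_fun do rewrite Im_mul; apply: l2funD => //; exact: l2funZ.
Qed.

Lemma cl2fun_sum (J : Type) (s : seq J) (G : J -> R -> C) : (forall j, cl2fun (G j)) ->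
  cl2fun (fun t => \sum_(j <- s) G j t).
Proof.
move=> HG; elim: s => [|j s IH].
  have -> : (fun t => \sum_(j <- [::]) G j t) = (fun=> 0) by apply/funext => t; rewrite big_nil.
  by split; apply: (l2fun_bounded _ _ _ 0) => [|t _]; rewrite ?normr0 //; exact: measurable_cst.
have -> : (fun t => \sum_(j <- j :: s) G j t) = (fun t => G j t + \sum_(j <- s) G j t).
  by apply/funext => t; rewrite big_cons.
exact: cl2funD.
Qed.

Let expE k t : e k t = Complex (cos (k%:~R * w * t)) (sin (k%:~R * w * t)).
Proof.
rewrite /e /cexpi (_ : 2 * pi * (k%:~R / T * t) = k%:~R * w * t) //.
by rewrite /w; field; exact: lt0r_neq0.
Qed.

Lemma cl2fun_exp k : cl2fun (e k).
Proof.
split.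
  have -> : (fun t => complex.Re (e k t)) = (fun t => cos (k%:~R * w * t)).
    by apply/funext => t; rewrite expE.
  apply: (l2fun_bounded _ _ _ 1) => [|t _]; last exact: cos_max.
  by apply: measurable_continuous => //; exact: continuous_cos_lin.
have -> : (fun t => complex.Im (e k t)) = (fun t => sin (k%:~R * w * t)).
  by apply/funext => t; rewrite expE.
apply: (l2fun_bounded _ _ _ 1) => [|t _]; last exact: sin_max.
by apply: measurable_continuous => //; exact: continuous_sin_lin.
Qed.

Lemma cl2fun_cintegrable F H : cl2fun F -> cl2fun H -> cintegrable I (fun t => F t * cconj (H t)).
Proof.
move=> [F1 F2] [H1 H2]; split.
  under eq_fun do rewrite Re_mul /= mulrN opprK.
  by apply: (integrable_add R _ _ _ mI); exact: l2fun_mul.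
under eq_fun do rewrite Im_mul /= mulrN addrC.
by apply: (integrable_sub R _ _ _ mI); exact: l2fun_mul.
Qed.

Lemma cintegrable_cabs2 F : cl2fun F -> mu.-integrable I (EFin \o (fun t => cabs2 (F t))).
Proof. by move=> [[_ F1] [_ F2]]; exact: (integrable_add R _ _ _ mI F1 F2). Qed.

Lemma cintD F H : cintegrable I F -> cintegrable I H ->
  cintegrable I (fun t => F t + H t) /\ cint I (fun t => F t + H t) = cint I F + cint I H.
Proof.
move=> [F1 F2] [H1 H2]; split.
  by split; under eq_fun do rewrite ?Re_add ?Im_add; exact: (integrable_add R _ _ _ mI).
rewrite /cint; simpc; congr Complex; rewrite -RintegralD //;
  by apply: eq_Rintegral => t _; rewrite ?Re_add ?Im_add.
Qed.

Lemma cintZ (c : C) F : cintegrable I F ->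
  cintegrable I (fun t => c * F t) /\ cint I (fun t => c * F t) = c * cint I F.
Proof.
move=> [F1 F2]; have F1' x := integrable_scale R I x _ mI F1; have F2' x := integrable_scale R I x _ mI F2.
split.
  split; first by under eq_fun do rewrite Re_mul; exact: (integrable_sub R _ _ _ mI).
  by under eq_fun do rewrite Im_mul; exact: (integrable_add R _ _ _ mI).
case: c => x y; rewrite /cint; simpc; congr Complex.
  rewrite -!RintegralZl // -RintegralB //; by apply: eq_Rintegral => t _; rewrite Re_mul.
rewrite -!RintegralZl // -RintegralD //; by apply: eq_Rintegral => t _; rewrite Im_mul.
Qed.

Lemma cint_sum (J : Type) (s : seq J) (G : J -> R -> C) : (forall j, cintegrable I (G j)) ->
  cint I (fun t => \sum_(j <- s) G j t) = \sum_(j <- s) cint I (G j).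
Proof.
move=> HG; suff [] : cintegrable I (fun t => \sum_(j <- s) G j t) /\
  cint I (fun t => \sum_(j <- s) G j t) = \sum_(j <- s) cint I (G j) by [].
elim: s => [|j s [IH1 IH2]].
  have -> : (fun t => \sum_(j <- [::]) G j t) = (fun=> 0) by apply/funext => t; rewrite big_nil.
  split; last by rewrite big_nil /cint /= !Rintegral_cst // mul0r.
  by split; exact: integrable0.
have -> : (fun t => \sum_(j <- j :: s) G j t) = (fun t => G j t + \sum_(j <- s) G j t).
  by apply/funext => t; rewrite big_cons.
by rewrite big_cons -IH2; exact: cintD.
Qed.

Lemma exp_conj k l t : e k t * cconj (e l t) = e (k - l) t.
Proof. by rewrite /e cconj_cexpi -cexpiD rmorphB /=; congr cexpi; ring. Qed.

Lemma cint_exp k : cint I (e k) = if k == 0 then T%:C%C else 0.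
Proof.
case: eqP => [->|/eqP k0].
  have muI : mu I = T%:E by rewrite /I lebesgue_measure_itv /= lte_fin T0 oppr0 adde0.
  have -> : e 0 = fun=> Complex 1 0 by apply/funext => t; rewrite /e mul0r mul0r cexpi0.
  by rewrite /cint /= !Rintegral_cst // mul0r mul1r; congr Complex; exact: (congr1 fine muI).
have w0 : w != 0 by rewrite /w mulf_neq0 ?invr_neq0 ?lt0r_neq0 // mulr_gt0 // pi_gt0.
pose c := k%:~R * w; have c0 : c != 0 by rewrite mulf_neq0 // intr_eq0.
have cT : Complex (cos (c * T)) (sin (c * T)) = 1.
  rewrite -(cexpi_int R k) -[in RHS](divfK (lt0r_neq0 T0) k%:~R) -/(e k T) expE.
  by [].
have [cT1 sT0] : cos (c * T) = 1 /\ sin (c * T) = 0 by case: cT.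
have dlin (x : R) : is_derive x 1 (fun x : R => c * x) c by apply: is_derive_eq; rewrite scaler1.
have ftc (G f : R -> R) : (forall x : R, is_derive x 1 G (f x)) -> continuous f -> G T = G 0 ->
    \int[mu]_(t in I) f t = 0.
  move=> dG cf GT.
  have cG (x : R) : {for x, continuous G}.
    apply: differentiable_continuous; apply/derivable1_diffP; exact: ex_derive.
  have mf : measurable_fun I (EFin \o f) by apply/measurable_EFinP; exact: measurable_continuous.
  rewrite /Rintegral -(integral_itv_bndoo true false mf) (@continuous_FTC2 _ f G) //.
  - by rewrite GT -EFinB subrr.
  - exact: continuous_subspaceT.
  - split.
    + by move=> x _; have /@ex_derive := dG x.
    + by apply: cvg_at_right_filter; exact: cG.
    + by apply: cvg_at_left_filter; exact: cG.
  - by move=> x _; rewrite derive1E; have /@derive_val := dG x.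
rewrite /cint; congr Complex.
  under eq_Rintegral do rewrite expE /=.
  apply: (ftc (fun t => sin (c * t) * c^-1)); last by rewrite sT0 mulr0 sin0.
    by move=> x; have dl := dlin x; apply: is_derive_eq; rewrite /GRing.scale /=; field.
  exact: continuous_cos_lin.
under eq_Rintegral do rewrite expE /=.
apply: (ftc (fun t => - cos (c * t) * c^-1)); last by rewrite cT1 mulr0 cos0.
  by move=> x; have dl := dlin x; apply: is_derive_eq; rewrite /GRing.scale /=; field.
exact: continuous_sin_lin.
Qed.

Definition ctrig a (N : nat) t : C := \sum_(i < (2 * N).+1) a (i%:Z - N%:Z) * e (i%:Z - N%:Z) t.

Definition fcoef F k : C := cint I (fun t => F t * cconj (e k t)).

Definition cnorm2 F : R := \int[mu]_(t in I) cabs2 (F t).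

Lemma cl2fun_ctrig a N : cl2fun (ctrig a N).
Proof. by apply: cl2fun_sum => i; apply: cl2funZ; exact: cl2fun_exp. Qed.

Lemma cint_ctrig F a N : cl2fun F ->
  cint I (fun t => F t * cconj (ctrig a N t)) =
  \sum_(i < (2 * N).+1) cconj (a (i%:Z - N%:Z)) * fcoef F (i%:Z - N%:Z).
Proof.
move=> HF; have Hi k := cintZ (cconj (a k)) _ (cl2fun_cintegrable _ _ HF (cl2fun_exp k)).
transitivity (cint I (fun t => \sum_(i < (2 * N).+1)
   cconj (a (i%:Z - N%:Z)) * (F t * cconj (e (i%:Z - N%:Z) t)))).
  congr cint; apply/funext => t; rewrite /ctrig cconj_sum mulr_sumr; apply: eq_bigr => i _.
  by rewrite cconjM mulrCA.
rewrite cint_sum; last by move=> i; have [] := Hi (i%:Z - N%:Z).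
by apply: eq_bigr => i _; have [_] := Hi (i%:Z - N%:Z).
Qed.

Lemma fcoef_ctrig a (N : nat) k : (`|k| <= N)%N -> fcoef (ctrig a N) k = T%:C%C * a k.
Proof.
move=> kN; have Hi l := cintZ (a l) _ (cl2fun_cintegrable _ _ (cl2fun_exp l) (cl2fun_exp k)).
transitivity (cint I (fun t => \sum_(i < (2 * N).+1) a (i%:Z - N%:Z) * (e (i%:Z - N%:Z) t * cconj (e k t)))).
  congr cint; apply/funext => t; rewrite /ctrig mulr_suml; apply: eq_bigr => i _.
  by rewrite mulrA.
rewrite cint_sum; last by move=> i; have [] := Hi (i%:Z - N%:Z).
have kb : (absz (k + N%:Z)%R < (2 * N).+1)%N by lia.
rewrite (bigD1 (Ordinal kb)) //= big1 ?addr0.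
  have -> : (absz (k + N%:Z)%R)%:Z - N%:Z = k by lia.
  have [_ ->] := Hi k; rewrite (_ : (fun t => _) = e 0); last by apply/funext => t; rewrite exp_conj subrr.
  by rewrite cint_exp eqxx mulrC.
move=> i ik; have [_ ->] := Hi (i%:Z - N%:Z).
rewrite (_ : (fun t => _) = e (i%:Z - N%:Z - k)); last by apply/funext => t; rewrite exp_conj.
rewrite cint_exp ifF ?mulr0 //; apply/negP => /eqP H; move/negP: ik; apply; apply/eqP/val_inj => /=; lia.
Qed.

Lemma cnorm2_sub F a N : cl2fun F -> cnorm2 (fun t => F t - ctrig a N t) =
  cnorm2 F + \sum_(i < (2 * N).+1) (T * cabs2 (a (i%:Z - N%:Z)) -
     2 * complex.Re (cconj (a (i%:Z - N%:Z)) * fcoef F (i%:Z - N%:Z))).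
Proof.
move=> HF; set S := ctrig a N; have HS : cl2fun S by exact: cl2fun_ctrig.
have ReS (u : 'I_(2 * N).+1 -> C) : complex.Re (\sum_i u i) = \sum_i complex.Re (u i).
  by elim/big_ind2 : _ => // x1 x2 y1 y2 <- <-; rewrite Re_add.
have [FS _] := cl2fun_cintegrable _ _ HF HS; have [SS _] := cl2fun_cintegrable _ _ HS HS.
have E1 : \int[mu]_(t in I) complex.Re (F t * cconj (S t)) =
    \sum_(i < (2 * N).+1) complex.Re (cconj (a (i%:Z - N%:Z)) * fcoef F (i%:Z - N%:Z)).
  by have := congr1 (@complex.Re R) (cint_ctrig F a N HF); rewrite ReS.
have E2 : \int[mu]_(t in I) complex.Re (S t * cconj (S t)) =
    \sum_(i < (2 * N).+1) T * cabs2 (a (i%:Z - N%:Z)).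
  have := congr1 (@complex.Re R) (cint_ctrig S a N HS); rewrite ReS => H; rewrite [LHS]H.
  apply: eq_bigr => i _; rewrite fcoef_ctrig; last by have := ltn_ord i; lia.
  by case: (a _) => x y; rewrite /cabs2; simpc => /=; ring.
rewrite /cnorm2 sumrB -E2 -mulr_sumr -E1.
have F2 := cintegrable_cabs2 _ HF.
have FS2 := integrable_scale R I 2 _ mI FS.
rewrite -RintegralZl // -RintegralB // -RintegralD //; last exact: (integrable_sub R _ _ _ mI).
apply: eq_Rintegral => t _; case: (F t) (S t) => x y [x' y']; rewrite /cabs2; simpc => /=; ring.
Qed.

(** Completing the square in each coefficient: the best choice is a k = [fcoef F k] / T. *)
Lemma cnorm2_sub_ge F a N : cl2fun F ->
  cnorm2 F - T^-1 * zpart (fun k => cabs2 (fcoef F k)) N <= cnorm2 (fun t => F t - ctrig a N t).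
Proof.
move=> HF; rewrite cnorm2_sub // lerD2l /zpart mulr_sumr -sumrN; apply: ler_sum => i _.
case: (a _) (fcoef _ _) => x y [p q]; rewrite /cabs2; simpc => /=.
rewrite -subr_ge0 (_ : _ - _ = T * ((x - p / T) ^+ 2 + (y - q / T) ^+ 2)); last first.
  by field; exact: lt0r_neq0.
by rewrite mulr_ge0 ?addr_ge0 ?sqr_ge0 // ltW.
Qed.

Lemma bessel F N : cl2fun F -> zpart (fun k => cabs2 (fcoef F k)) N <= T * cnorm2 F.
Proof.
move=> HF; pose a k := (T^-1)%:C%C * fcoef F k.
have : 0 <= cnorm2 (fun t => F t - ctrig a N t) by apply: Rintegral_ge0 => t _; exact: cabs2_ge0.
rewrite cnorm2_sub // (_ : \sum_(i < _) _ = - (T^-1 * zpart (fun k => cabs2 (fcoef F k)) N)).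
  by rewrite subr_ge0 mulrC ler_pdivrMr // mulrC.
rewrite /zpart mulr_sumr -sumrN; apply: eq_bigr => i _; rewrite /a.
by case: (fcoef _ _) => x y; rewrite /cabs2; simpc => /=; field; exact: lt0r_neq0.
Qed.

(** At a fixed degree N these functions form a vector space that grows with N, so sums of different
    degrees are formed in the larger one. *)
Let cspan (N : nat) (h : R -> C) := exists a, h = ctrig a N.

Let cspanD N h1 h2 : cspan N h1 -> cspan N h2 -> cspan N (fun t => h1 t + h2 t).
Proof.
move=> [a ->] [b ->]; exists (fun k => a k + b k); apply/funext => t.
by rewrite /ctrig -big_split; apply: eq_bigr => i _; rewrite /= mulrDl.
Qed.

Let cspanZ N (c : C) h : cspan N h -> cspan N (fun t => c * h t).
Proof.
move=> [a ->]; exists (fun k => c * a k); apply/funext => t.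
by rewrite /ctrig mulr_sumr; apply: eq_bigr => i _; rewrite mulrA.
Qed.

Let cspan_mono (L N : nat) h : (L <= N)%N -> cspan L h -> cspan N h.
Proof.
move=> LN [a ->]; exists (fun k => if (`|k| <= L)%N then a k else 0); apply/funext => t.
pose H k : C := (if (`|k| <= L)%N then a k else 0) * e k t.
have := window_sum _ H L N 1 isT; rewrite !muln1 => /(_ LN) E.
rewrite /ctrig -/(H _) E; last by move=> k; rewrite ltnNge /H => /negbTE ->; rewrite mul0r.
by apply: eq_bigr => i _; rewrite /H ifT //; have := ltn_ord i; lia.
Qed.

Let cspan_exp (N : nat) k : (`|k| <= N)%N -> cspan N (e k).
Proof.
move=> kN; exists (fun l => if l == k then 1 else 0); apply/funext => t.
have kb : (absz (k + N%:Z)%R < (2 * N).+1)%N by lia.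
rewrite /ctrig (bigD1 (Ordinal kb)) //= big1 ?addr0.
  have -> : (absz (k + N%:Z)%R)%:Z - N%:Z = k by lia.
  by rewrite eqxx mul1r.
move=> i ik; rewrite ifF ?mul0r //; apply/negP => /eqP H; move/negP: ik; apply; apply/eqP/val_inj => /=; lia.
Qed.

Let trig_cspan h : trig w h -> exists N, cspan N (fun t => (h t)%:C%C).
Proof.
elim=> {h} [k|k|f g _ [N1 H1] _ [N2 H2]|c f _ [N H]].
- exists (absz k); have ek := cspan_exp _ k (leqnn _).
  have eN : cspan (absz k) (e (- k)) by apply: cspan_exp; rewrite abszN.
  have := cspanD _ _ _ (cspanZ _ (2^-1)%:C%C _ ek) (cspanZ _ (2^-1)%:C%C _ eN).
  by congr cspan; apply/funext => t; rewrite !expE rmorphN !mulNr cosN sinN; simpc; congr Complex; field.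
- exists (absz k); have ek := cspan_exp _ k (leqnn _).
  have eN : cspan (absz k) (e (- k)) by apply: cspan_exp; rewrite abszN.
  have := cspanD _ _ _ (cspanZ _ (Complex 0 (- 2^-1)) _ ek) (cspanZ _ (Complex 0 (2^-1)) _ eN).
  by congr cspan; apply/funext => t; rewrite !expE rmorphN !mulNr cosN sinN; simpc; congr Complex; field.
- exists (maxn N1 N2).
  have := cspanD _ _ _ (cspan_mono _ _ _ (leq_maxl N1 N2) H1) (cspan_mono _ _ _ (leq_maxr N1 N2) H2).
  by congr cspan; apply/funext => t; rewrite rmorphD.
- exists N; have := cspanZ _ c%:C%C _ H.
  by congr cspan; apply/funext => t; rewrite rmorphM.
Qed.

(** One inequality is Bessel's. For the other, F is close to some trigonometric polynomial, whereas
    by [cnorm2_sub_ge] its distance from all those of degree N is at least the defect in Bessel's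
    inequality. *)
Lemma parseval F : cl2fun F ->
  (\esum_(k in [set: int]) (cabs2 (fcoef F k))%:E = (T * cnorm2 F)%:E)%E.
Proof.
move=> HF; have pos k : 0 <= cabs2 (fcoef F k) by exact: cabs2_ge0.
have up : (\esum_(k in [set: int]) (cabs2 (fcoef F k))%:E <= (T * cnorm2 F)%:E)%E.
  by apply: esum_le_zpart => // N; exact: bessel.
apply/eqP; rewrite eq_le up /=.
set S := (\esum_(k in _) _)%E in up *.
have S0 : (0 <= S)%E by apply: esum_ge0 => n _; rewrite lee_fin.
have SE : S = (fine S)%:E by rewrite fineK // ge0_fin_numE // (le_lt_trans up) // ltry.
rewrite SE lee_fin; apply/ler_addgt0Pr => eps e0.
have [HF1 HF2] := HF.
(* Real and imaginary parts are approximated separately, and the squared distance is finally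
   multiplied by T. *)
have e1 : 0 < eps / (2 * T) by rewrite divr_gt0 // mulr_gt0.
have [_ D1] := dense_trig_l2 R T T0 _ HF1; have [_ D2] := dense_trig_l2 R T T0 _ HF2.
have [h1 t1 d1] := D1 _ e1; have [h2 t2 d2] := D2 _ e1.
have [N1 s1] := trig_cspan _ t1; have [N2 s2] := trig_cspan _ t2.
have [a Ha] := cspanD _ _ _ (cspan_mono _ _ _ (leq_maxl N1 N2) s1)
  (cspanZ _ (Complex 0 1) _ (cspan_mono _ _ _ (leq_maxr N1 N2) s2)).
have := cnorm2_sub_ge F a (maxn N1 N2) HF; rewrite -Ha.
have [_ i1] := l2funB _ _ _ _ HF1 (l2fun_trig _ _ _ t1).
have [_ i2] := l2funB _ _ _ _ HF2 (l2fun_trig _ _ _ t2).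
have -> : cnorm2 (fun t => F t - ((h1 t)%:C%C + Complex 0 1 * (h2 t)%:C%C)) =
    dist2 R T (fun t => complex.Re (F t)) h1 + dist2 R T (fun t => complex.Im (F t)) h2.
  rewrite /dist2 -RintegralD //; apply: eq_Rintegral => t _.
  by case: (F t) => x y; rewrite /cabs2; simpc.
have zS : zpart (fun k => cabs2 (fcoef F k)) (maxn N1 N2) <= fine S.
  by rewrite -lee_fin -SE; exact: zpart_le_esum.
set z := zpart _ _ in zS *; move=> H.
have : T * (cnorm2 F - T^-1 * z) <= T * (eps / (2 * T) + eps / (2 * T)).
  by rewrite ler_wpM2l ?(ltW T0) // (le_trans H) // ltW // ltrD.
rewrite mulrBr mulrA mulfV ?lt0r_neq0 // mul1r.
rewrite (_ : T * (_ + _) = eps); last by field; exact: lt0r_neq0.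
lra.
Qed.

End Parseval.

(** * The frame for the torus *)

Section Splitting.
Variable R : realType.
Notation mu := (@lebesgue_measure R).
Variable T : R.
Hypothesis T0 : 0 < T.

Let shift_itv (a : R) : affR R 1 (- a) @^-1` `]0, T[%classic = `]a, a + T[%classic.
Proof. by apply/seteqP; split=> t /=; rewrite !in_itv /= /affR mul1r; lra. Qed.

Lemma measurable_shift (a : R) (u : R -> R) : measurable_fun `]a, a + T[ u ->
  measurable_fun `]0, T[ (fun t => u (t + a)).
Proof.
move=> mu_; apply: (measurable_comp (F := `]a, a + T[%classic) _ _ mu_).
- exact: measurable_itv.
- by move=> _ [t /= + <-]; rewrite !in_itv /=; lra.
- by apply: measurable_funD; [exact: measurable_id|exact: measurable_cst].
Qed.

Lemma Rintegral_shift (a : R) (u : R -> R) : mu.-integrable `]a, a + T[ (EFin \o u) ->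
  mu.-integrable `]0, T[ (EFin \o (fun t => u (t + a))) /\
  \int[mu]_(t in `]a, a + T[) u t = \int[mu]_(t in `]0, T[) u (t + a).
Proof.
move=> iu; have mu_ := integrable_measurable _ _ _ iu.
have uE : (fun t => u (t + a)) \o affR R 1 (- a) = u.
  by apply/funext => t; rewrite /affR /= mul1r subrK.
have [] := Rintegral_translate R (- a) `]0, T[%classic (fun t => u (t + a)).
- exact: measurable_itv.
- exact: measurable_shift.
- by rewrite shift_itv uE.
rewrite shift_itv => i1 ->; split=> //; apply: eq_Rintegral => t _.
by rewrite /affR mul1r subrK.
Qed.

Lemma Rintegral_split (N : nat) (u : R -> R) : mu.-integrable `[0, N%:R * T] (EFin \o u) ->
  (forall r : nat, (r < N)%N -> mu.-integrable `]0, T[ (EFin \o (fun t => u (t + r%:R * T)))) /\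
  \int[mu]_(t in `[0, N%:R * T]) u t = \sum_(r < N) \int[mu]_(t in `]0, T[) u (t + r%:R * T).
Proof.
have T1 := T0; elim: N => [|N IH] iu.
  by rewrite big_ord0 mul0r set_itv1 Rintegral_set1.
have NS : N.+1%:R * T = N%:R * T + T by rewrite -natr1 mulrDl mul1r.
have NT : 0 <= N%:R * T by rewrite mulr_ge0 // ltW.
rewrite NS in iu *.
have iN : mu.-integrable `[0, N%:R * T] (EFin \o u).
  apply: integrableS iu => //; apply: subset_itvl; rewrite bnd_simp; lra.
have ioc : mu.-integrable `]N%:R * T, N%:R * T + T] (EFin \o u).
  apply: integrableS iu => //; apply: subset_itvr; rewrite bnd_simp; lra.
have iS : mu.-integrable `]N%:R * T, N%:R * T + T[ (EFin \o u).
  by apply: integrableS ioc => //; apply: subset_itvl; rewrite bnd_simp.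
have [IH1 IH2] := IH iN; have [S1 S2] := Rintegral_shift _ _ iS; split.
  by move=> r; rewrite ltnS leq_eqVlt => /orP[/eqP -> //|]; exact: IH1.
rewrite big_ord_recr /= -IH2 -S2 (Rintegral_itv_bndo_bndc iS).
rewrite -(@Rintegral_itvB _ _ _ _ (N%:R * T) iu) ?bnd_simp //; last by lra.
by rewrite addrC subrK.
Qed.

Lemma measurable_split (N r : nat) (u : R -> R) : measurable_fun `[0, N%:R * T] u -> (r < N)%N ->
  measurable_fun `]0, T[ (fun t => u (t + r%:R * T)).
Proof.
move=> mu_ rN; have T1 := T0; apply: measurable_shift; apply: measurable_funS mu_; first exact: measurable_itv.
move=> t /=; rewrite !in_itv /= => /andP[t1 t2].
have : r.+1%:R * T <= N%:R * T by rewrite ler_wpM2r ?ler_nat // ltW.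
have : 0 <= r%:R * T by rewrite mulr_ge0 // ltW.
by rewrite -natr1 mulrDl mul1r; lra.
Qed.

End Splitting.

Section TorusFrame.
Variable R : realType.
Local Notation C := R[i].
Notation mu := (@lebesgue_measure R).
Variables (d A0 : R) (G : R -> R) (g : R -> C) (M N : nat).
Hypotheses (HG : expdec R d A0 G) (gG : forall x, g x = (G x)%:C%C) (M0 : (0 < M)%N) (N0 : (0 < N)%N).
Hypotheses (cper : continuous (per R G (N * M))).
Let T : R := M%:R.
Let I : set R := `]0, T[%classic.
Let K : nat := (N * M)%N.
Let p := per R G K.

Let T0 : 0 < T. Proof. by rewrite ltr0n. Qed.
Let K0 : (0 < K)%N. Proof. by rewrite muln_gt0 N0. Qed.
Let mI : measurable I. Proof. exact: measurable_itv. Qed.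

Let p_bounded : exists B, forall x, `|p x| <= B.
Proof.
have KR : 0 < K%:R :> R by rewrite ltr0n.
have [B HB] := zaks_bounded R _ KR d A0 G (@cos R) 0 0 K%:R HG (@cos_max R).
exists B => x; have [n /andP[n0 n1]] := reduce_mod R _ KR 0 x.
have := HB (x - n%:~R * K%:R); rewrite n0 /= => /(_ (ltW _)) H.
have -> : p x = zaks R K%:R cos G 0 (x - n%:~R * K%:R).
  rewrite /p -(per_periodic R d A0 G HG K x (- n) K0) rmorphN /= mulNr.
  by apply: eq_zs => k; rewrite mulr0 cos0 mulr1.
by apply: H; rewrite add0r in n1.
Qed.

(** The modulations by l / M have period M, so the inner product on [0, K] with the atom (k, l) is
    the l-th Fourier coefficient of this sum over the N pieces of length M; see [ip_fold]. *)
Let fold (f : R -> C) (k : nat) (t : R) : C :=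
  \sum_(r < N) f (t + r%:R * T) * cconj (p (t + (r%:Z - k%:Z)%:~R * T))%:C%C.

Let mp (a : R) : measurable_fun setT (fun t : R => p (t + a)).
Proof.
apply: measurable_continuous => // t; have ca : (s + a : R) @[s --> t] --> t + a by apply: cvgD; [exact: cvg_id|exact: cvg_cst].
exact: (cvg_comp _ _ ca (cper _)).
Qed.

Let cl2fun_piece f (r : nat) : L2T K%:R f -> (r < N)%N -> cl2fun R T (fun t => f (t + r%:R * T)).
Proof.
rewrite /L2T /= /K natrM => -[[m1 m2] i12] rN.
have [I12 _] := Rintegral_split R T T0 N _ i12.
have {}I12 := I12 r rN; have n1 := measurable_split R T T0 N r _ m1 rN; have n2 := measurable_split R T T0 N r _ m2 rN.
split; split=> //; apply: (integrable_le R _ _ _ mI _ _ I12).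
- exact: measurable_funX.
- by move=> t _; rewrite ger0_norm ?sqr_ge0 // /cabs2 lerDl sqr_ge0.
- exact: measurable_funX.
- by move=> t _; rewrite ger0_norm ?sqr_ge0 // /cabs2 lerDr sqr_ge0.
Qed.

Let cl2fun_mulr (F : R -> C) (q : R -> R) B : cl2fun R T F -> measurable_fun I q -> (forall t, `|q t| <= B) ->
  cl2fun R T (fun t => F t * cconj (q t)%:C%C).
Proof.
move=> [F1 F2] mq qB.
have H (u : R -> R) : l2fun R T u -> l2fun R T (fun t => u t * q t).
  move=> Hu; have [mu_ _] := Hu; apply: (l2fun_le _ _ _ (fun t => B * u t)); last exact: l2funZ.
    exact: measurable_funM.
  move=> t _; rewrite mulrC !normrM ler_wpM2r //; apply: le_trans (qB t) (ler_norm _).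
split; [have := H _ F1|have := H _ F2]; congr l2fun; apply/funext => t.
  by rewrite Re_mul /= oppr0 mulr0 subr0.
by rewrite Im_mul /= oppr0 mulr0 add0r.
Qed.

Let cl2fun_fold f k : L2T K%:R f -> cl2fun R T (fold f k).
Proof.
move=> Hf; have [B HB] := p_bounded; apply: cl2fun_sum => r.
apply: (cl2fun_mulr _ _ B) => [|| t]; [exact: cl2fun_piece| |exact: HB].
by apply: measurable_funTS; exact: mp.
Qed.

Let gaborE (k : nat) (l : int) (t : R) :
  tfT K%:R (l%:~R / T) (k * M)%N%:R (periodize K%:R g) t =
  (p (t - k%:R * T))%:C%C * cexpi (l%:~R / T * t).
Proof.
rewrite /tfT (periodize_per _ _ _ gG) /rmod natrM; congr (_%:C%C * _).
set n := Num.floor _; rewrite -[RHS](per_periodic R d A0 G HG K _ (- n) K0) rmorphN /= mulNr.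
by rewrite [K%:R * _]mulrC.
Qed.

Let gab (k : nat) (l : int) (t : R) : C := tfT K%:R (l%:~R / T) (k * M)%N%:R (periodize K%:R g) t.

Let gab_bounded k l : exists B, [/\ 0 <= B, measurable_fun setT (fun t => complex.Re (gab k l t)),
  measurable_fun setT (fun t => complex.Im (gab k l t)) &
  forall t, `|complex.Re (gab k l t)| <= B /\ `|complex.Im (gab k l t)| <= B].
Proof.
have [B HB] := p_bounded; have B0 : 0 <= B by apply: le_trans (HB 0).
have E (s : R -> R) (t : R) : (p (t - k%:R * T)) * s (2 * pi * (l%:~R / T * t)) =
  p (t + - (k%:R * T)) * s (2 * pi * (l%:~R / T) * t) by rewrite mulrA.
have bnd (x y : R) : `|x| <= B -> `|y| <= 1 -> `|x * y| <= B.
  by move=> x1 y1; rewrite normrM -[leRHS]mulr1; apply: ler_pM.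
have REq t : complex.Re (gab k l t) = p (t + - (k%:R * T)) * cos (2 * pi * (l%:~R / T) * t).
  by rewrite /gab gaborE Re_mul /= mul0r subr0; exact: (E cos).
have IEq t : complex.Im (gab k l t) = p (t + - (k%:R * T)) * sin (2 * pi * (l%:~R / T) * t).
  by rewrite /gab gaborE Im_mul /= mul0r addr0; exact: (E sin).
exists B; split=> //.
- under eq_fun do rewrite REq; apply: measurable_funM; first exact: mp.
  by apply: measurable_continuous => //; exact: continuous_cos_lin.
- under eq_fun do rewrite IEq; apply: measurable_funM; first exact: mp.
  by apply: measurable_continuous => //; exact: continuous_sin_lin.
- by move=> t; rewrite REq IEq; split; apply: bnd => //; [exact: cos_max|exact: sin_max].
Qed.

Let L2T_gab k l : L2T K%:R (gab k l).
Proof.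
have [B [B0 m1 m2 HB]] := gab_bounded k l; split.
  by split; apply: measurable_funTS.
apply: (integrable_bounded_itv R _ _ (2 * B ^+ 2)).
  by apply: measurable_funD; apply: measurable_funX.
move=> t _; rewrite ger0_norm; last exact: cabs2_ge0.
have [] := HB t; rewrite /cabs2 !ler_norml => /andP[? ?] /andP[? ?]; nra.
Qed.

Let L2T_integrable f : L2T K%:R f ->
  mu.-integrable `[0, K%:R] (EFin \o (fun t => complex.Re (f t))) /\
  mu.-integrable `[0, K%:R] (EFin \o (fun t => complex.Im (f t))).
Proof.
move=> [[m1 m2] i12].
have i1 : mu.-integrable `[0, K%:R] (EFin \o (fun=> 1 : R)).
  by apply: (integrable_bounded_itv R _ _ 1) => [|t _]; [exact: measurable_cst|rewrite normr1].
have i3 := integrable_add R _ _ _ (measurable_itv _) i1 i12.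
split; apply: (integrable_le R _ _ _ (measurable_itv _) _ _ i3) => //.
- move=> t _; rewrite ler_norml /cabs2; have := sqr_ge0 (complex.Im (f t)).
  by move: (complex.Re (f t)) => x; have := sqr_ge0 (x - 1); have := sqr_ge0 (x + 1); nra.
- move=> t _; rewrite ler_norml /cabs2; have := sqr_ge0 (complex.Re (f t)).
  by move: (complex.Im (f t)) => x; have := sqr_ge0 (x - 1); have := sqr_ge0 (x + 1); nra.
Qed.

Let ip_fold f (k : nat) (l : int) : L2T K%:R f ->
  ipL2T K%:R f (gab k l) = fcoef R T (fold f k) l.
Proof.
move=> Hf; have [f1 f2] := L2T_integrable _ Hf; have [B [B0 m1 m2 HB]] := gab_bounded k l.
pose u t := f t * cconj (gab k l t).
have mK : measurable (`[0, K%:R]%classic : set R) by exact: measurable_itv.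
have iM (x y : R -> R) : mu.-integrable `[0, K%:R] (EFin \o x) -> measurable_fun setT y ->
    (forall t, `|y t| <= B) -> mu.-integrable `[0, K%:R] (EFin \o (fun t => x t * y t)).
  move=> ix my yB; apply: (integrable_mul_bounded R _ _ _ B) => //; exact: measurable_funTS.
have b1 t : `|complex.Re (gab k l t)| <= B by have [] := HB t.
have b2 t : `|complex.Im (gab k l t)| <= B by have [] := HB t.
have iu1 : mu.-integrable `[0, N%:R * T] (EFin \o (fun t => complex.Re (u t))).
  rewrite -natrM; have := integrable_add R _ _ _ mK (iM _ _ f1 m1 b1) (iM _ _ f2 m2 b2).
  by congr (integrable _ _); apply/funext => t /=; rewrite /u Re_mul /= mulrN opprK.
have iu2 : mu.-integrable `[0, N%:R * T] (EFin \o (fun t => complex.Im (u t))).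
  rewrite -natrM; have := integrable_sub R _ _ _ mK (iM _ _ f2 m1 b1) (iM _ _ f1 m2 b2).
  by congr (integrable _ _); apply/funext => t /=; rewrite /u Im_mul /= mulrN addrC.
have [j1 s1] := Rintegral_split R T T0 N _ iu1; have [j2 s2] := Rintegral_split R T T0 N _ iu2.
rewrite /ipL2T /cint -/(u _) natrM s1 s2 -Complex_sum.
transitivity (\sum_(r < N) cint I (fun t => u (t + r%:R * T))); first by [].
rewrite -cint_sum; last by move=> r; split; [exact: j1|exact: j2].
rewrite /fcoef; congr cint; apply/funext => t; rewrite /fold mulr_suml; apply: eq_bigr => r _.
rewrite /u /gab gaborE !cconjM !mulrA; congr (_ * cconj (p _)%:C%C * cconj _).
  by rewrite rmorphB /=; ring.
rewrite mulrDr (_ : l%:~R / T * (r%:R * T) = (l * r%:Z)%:~R); first by rewrite cexpiD cexpi_int mulr1.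
by rewrite rmorphM /=; field; exact: lt0r_neq0.
Qed.

(** Parseval in l turns the frame sum into M times the integral over ]0, M[ of sum_k |fold f k t|^2.
    At each fixed t this is a cyclic system in the values f(t + r M), with the Zak transform at t as
    symbol. *)
Lemma L2T_frame (A B : R) : 0 < A -> 0 < B ->
  (forall j t, (j < N)%N -> 0 <= t <= T -> A <= zak_sqr R G M (2 * pi * j%:R / N%:R) t <= B) ->
  is_frame (@L2T R K%:R) (@ipL2T R K%:R) (@nrm2L2T R K%:R) (@gabor_PKg R g M K).
Proof.
move=> A_0 B_0 HAB; split; first by move=> [k l]; exact: L2T_gab.
exists (T * A), (T * B); split; [exact: mulr_gt0|split; first exact: mulr_gt0].
move=> f Hf; have fold2 k := cl2fun_fold f k Hf.
have E : (\esum_(i in [set: 'I_(K %/ M) * int]) (cabs2 (ipL2T K%:R f (gabor_PKg g i)))%:E =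
    (T * \int[mu]_(t in I) (\sum_(k < N) cabs2 (fold f k t)))%:E)%E.
  transitivity (\esum_(k in [set: 'I_(K %/ M)]) \esum_(l in [set: int]) (cabs2 (fcoef R T (fold f k) l))%:E)%E.
    rewrite esum_esum; last by move=> *; rewrite lee_fin cabs2_ge0.
    have -> : [set: 'I_(K %/ M)] `*`` (fun=> [set: int]) = [set: 'I_(K %/ M) * int] by apply/seteqP; split.
    by apply: eq_esum => -[k l] _ /=; rewrite -ip_fold.
  transitivity (\esum_(k in [set: 'I_(K %/ M)]) (T * cnorm2 R T (fold f k))%:E)%E.
    by apply: eq_esum => k _; exact: parseval.
  rewrite esum_finType; last first.
    by move=> k; rewrite mulr_ge0 ?(ltW T0) //; apply: Rintegral_ge0 => t _; exact: cabs2_ge0.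
  congr (_%:E); rewrite -mulr_sumr; congr (_ * _).
  rewrite -(big_mkord xpredT (fun k => cnorm2 R T (fold f k))) mulnK // big_mkord.
  by have [_ ->] := Rintegral_bigsum R I 'I_N (index_enum _) _ mI (fun k => cintegrable_cabs2 _ _ _ (fold2 k)).
rewrite E.
have Hn : nrm2L2T K%:R f = \int[mu]_(t in I) (\sum_(r < N) cabs2 (f (t + r%:R * T))) /\
    mu.-integrable I (EFin \o (fun t => \sum_(r < N) cabs2 (f (t + r%:R * T)))).
  have [_ i12] := Hf; rewrite /K natrM in i12.
  have [I1 I2] := Rintegral_split R T T0 N _ i12.
  have [J1 J2] := Rintegral_bigsum R I 'I_N (index_enum _) (fun r t => cabs2 (f (t + r%:R * T))) mI (fun r => I1 r (ltn_ord r)).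
  by split=> //; rewrite J2 /nrm2L2T /K natrM.
have [-> Hi] := Hn.
have [Hi2 _] := Rintegral_bigsum R I 'I_N (index_enum _) _ mI (fun k => cintegrable_cabs2 _ _ _ (fold2 k)).
have Hpt t : I t -> A * (\sum_(r < N) cabs2 (f (t + r%:R * T))) <= \sum_(k < N) cabs2 (fold f k t) <=
    B * (\sum_(r < N) cabs2 (f (t + r%:R * T))).
  move=> It; apply: (cyclic_frame R N N0 (fun r => f (t + r%:R * T)) (fun s => (p (t + s%:~R * T))%:C%C)).
    move=> s; congr (_%:C%C); rewrite -[RHS](per_periodic R d A0 G HG K _ 1 K0) /K.
    by congr per; rewrite rmorphD natrM /=; ring.
  move=> j jN; have E1 := symbol_zak R d A0 G HG M N j t M0 N0.
  rewrite (_ : symbol _ _ _ _ = Complex (zaks R M%:R cos G (2 * pi * j%:R / N%:R) t)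
    (zaks R M%:R sin G (2 * pi * j%:R / N%:R) t)); last exact: E1.
  by apply: HAB => //; move: It; rewrite /I /= in_itv /= => /andP[/ltW -> /ltW].
rewrite !lee_fin -!mulrA !ler_pM2l ?T0 // -!RintegralZl //; split; apply: le_Rintegral => //.
- exact: integrable_scale.
- by move=> t It; have /andP[] := Hpt t It.
- exact: integrable_scale.
- by move=> t It; have /andP[] := Hpt t It.
Qed.

End TorusFrame.

Section Positivity.
Variable R : realType.

Lemma family_bounds (J : finType) (F : J -> R -> R) (a b : R) : a <= b -> (forall j, continuous (F j)) ->
  (forall j t, a <= t <= b -> 0 < F j t) ->
  exists A B, [/\ 0 < A, 0 < B & forall j t, a <= t <= b -> A <= F j t <= B].
Proof.
move=> ab cF F0.
have /choice [q Hq] : forall j, exists p : R * R,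
    [/\ 0 < p.1, 0 < p.2 & forall t, a <= t <= b -> p.1 <= F j t <= p.2].
  by move=> j; have [A [B H]] := pos_bounds R _ _ _ ab (cF j) (F0 j); exists (A, B).
have q1 j : 0 < (q j).1 by have [] := Hq j.
have q2 j : 0 < (q j).2 by have [] := Hq j.
have [A [A2 [A0 _ HA]]] := fin_bounds R J (fun j => (q j).1) q1.
have [B2 [B [_ B0 HB]]] := fin_bounds R J (fun j => (q j).2) q2.
exists A, B; split=> // j t tab; have [_ _ /(_ t tab) /andP[H1 H2]] := Hq j.
have /andP[A1 _] := HA j; have /andP[_ B1] := HB j.
by rewrite (le_trans A1 H1) (le_trans H2 B1).
Qed.

(** If the cosine were -1, doubling the angle would make 2 j / N an integer n. As N is odd, n is
    even, so j / N is an integer and the cosine is 1. *)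
Lemma cos_odd_neqN1 (j N : nat) : odd N -> cos (2 * pi * j%:R / N%:R : R) != -1.
Proof.
move=> oN; have N0 : (0 < N)%N by case: N oN.
have NR : N%:R != 0 :> R by rewrite pnatr_eq0 -lt0n.
apply/eqP => c1.
have [n Hn] : exists n : int, 2 * j%:R / N%:R = n%:~R :> R.
  apply: cos2pi_eq1; rewrite (_ : 2 * pi * _ = (2 * pi * j%:R / N%:R) *+ 2).
    by rewrite cos_mulr2n c1 sqrrN expr1n; lra.
  by rewrite -[RHS]mulr_natl; ring.
have E : 2 * j%:Z = n * N%:Z.
  by apply: (@intr_inj R); rewrite !rmorphM /= -Hn divfK.
have [k nE] : exists k, n = 2 * k.
  have NE : N%:Z = 1 + 2 * (N./2)%:Z by have := odd_double_half N; rewrite oN; lia.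
  (* With N = 1 + 2 h, the equation 2 j = n N reads n = 2 (j - n h). *)
  by exists (j%:Z - n * (N./2)%:Z); move: E; rewrite NE; lia.
have kE : j%:Z = k * N%:Z.
  by apply: (@mulfI _ (2 : int)) => //; rewrite E nE mulrA.
have : cos (2 * pi * j%:R / N%:R) = complex.Re (cexpi (k%:~R : R)).
  have -> : j%:R = k%:~R * N%:R :> R by rewrite -[LHS](_ : j%:Z%:~R = _) // kE rmorphM.
  by rewrite /cexpi /=; congr cos; field.
by rewrite cexpi_int c1 /=; lra.
Qed.

End Positivity.

(** * Bounds for the Zak transform of the window *)

Section Kernel.
Variable R : realType.
Variables (ds : seq R) (h : R -> R) (c : R) (M : nat).
Hypotheses (Hh : tpker R ds h) (ds2 : (1 < size ds)%N) (c0 : 0 < c) (M0 : (0 < M)%N).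
Let G x := c * h x.

Let MR : 0 < M%:R :> R. Proof. by rewrite ltr0n. Qed.

Lemma expdec_scale : exists d A, expdec R d A G.
Proof.
have [d [A [d0 Hd]]] := tpker_dec _ _ _ Hh; exists d, (c * A); split=> // x.
by rewrite /G normrM gtr0_norm // -mulrA ler_wpM2l // ltW.
Qed.

Lemma zaks_scale (T phi x : R) (s : R -> R) : 0 < T -> (forall t, `|s t| <= 1) ->
  zaks R T s G phi x = c * zaks R T s h phi x.
Proof.
move=> T0 s1; have [d [A Hd]] := tpker_dec _ _ _ Hh.
have [Hr _] := expdec_expb R _ T0 _ _ _ x Hd; have Hr' : 0 <= expR (- d * T) < 1 by lra.
rewrite -(zsZ _ _ _ _ c Hr' (zaks_expb R T T0 _ _ _ s phi x Hd s1)).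
by apply: eq_zs => k; rewrite mulrA.
Qed.

Lemma zak_sqr_scale (phi x : R) : zak_sqr R G M phi x =
  c ^+ 2 * (zaks R M%:R cos h phi x ^+ 2 + zaks R M%:R sin h phi x ^+ 2).
Proof.
by rewrite /zak_sqr !zaks_scale //; [ring|exact: sin_max|exact: cos_max].
Qed.

Lemma zak_sqr_gt0 (phi x : R) : cos phi != -1 -> 0 < zak_sqr R G M phi x.
Proof. by move=> H; rewrite zak_sqr_scale mulr_gt0 ?exprn_gt0 //; exact: zak_nonzero Hh H. Qed.

Lemma zak_sqr_even_gt0 (phi : R) (i : nat) : (forall t, h (- t) = h t) -> odd M ->
  0 < zak_sqr R G M phi i%:R.
Proof.
move=> he oM; have [c1|c1] := eqVneq (cos phi) (-1); last exact: zak_sqr_gt0.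
rewrite zak_sqr_scale mulr_gt0 ?exprn_gt0 // ltr_pwDl ?sqr_ge0 // exprn_even_gt0 //=.
apply: (zak_even_nonzero R _ MR ds) => // n; apply/eqP => H.
(* A zero at i would give 2 i = M (1 + 2 n), an odd number. *)
have : (2 * i%:Z)%:~R = (M%:Z + 2 * n * M%:Z)%:~R :> R.
  by rewrite rmorphD !rmorphM /=; move: H; rewrite /=; lra.
move/(@intr_inj R) => E; have := odd_double_half M; rewrite oM; lia.
Qed.

Lemma zak_sqr_continuous (phi : R) : continuous (zak_sqr R G M phi).
Proof.
have -> : zak_sqr R G M phi = fun x => c ^+ 2 *
    (zaks R M%:R cos h phi x ^+ 2 + zaks R M%:R sin h phi x ^+ 2).
  by apply/funext => x; rewrite zak_sqr_scale.
move=> x; apply: cvgMr; have cz s := zaks_continuous R _ MR ds h s phi Hh ds2.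
by apply: cvgD; rewrite expr2; apply: cvgM; apply: cz; [exact: cos_max|exact: cos_max|exact: sin_max|exact: sin_max].
Qed.

Lemma zak_sqr_continuous_phase (x : R) : continuous (fun phi => zak_sqr R G M phi x).
Proof.
have [d [A HG]] := expdec_scale; move=> phi.
have C1 := zaks_continuous_phase R d A G HG M%:R x cos MR (@continuous_cos R) (@cos_max R).
have C2 := zaks_continuous_phase R d A G HG M%:R x sin MR (@continuous_sin R) (@sin_max R).
by apply: cvgD; rewrite expr2; apply: cvgM; [exact: C1|exact: C1|exact: C2|exact: C2].
Qed.

(** Periodization is the Zak transform with period K at phase 0, so its continuity is that of
    [zaks_continuous]. *)
Lemma per_continuous (K : nat) : (0 < K)%N -> continuous (per R G K).
Proof.
move=> K0; have KR : 0 < K%:R :> R by rewrite ltr0n.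
have -> : per R G K = fun x => c * zaks R K%:R cos h 0 x.
  apply/funext => x; rewrite -zaks_scale //; last exact: cos_max.
  by apply: eq_zs => k; rewrite mulr0 cos0 mulr1.
by move=> x; apply: cvgMr; exact: (zaks_continuous R _ KR ds h cos 0 Hh ds2 (@cos_max R)).
Qed.

End Kernel.

Theorem theorem8 (R : realType) (g : R -> R[i]) (m : nat)
    (Hm : (2 <= m)%N) (Htp : totally_positive_finite_type g m)
    (Hcont : continuous (fun x : R => complex.Re (g x)) /\ continuous (fun x : R => complex.Im (g x)))
    (M K : nat) (HM : (0 < M)%N) (HMK : (M %| K)%N) :
  (* (i) *)
  (odd (K %/ M) ->
     is_frame (@L2T R K%:R) (@ipL2T R K%:R) (@nrm2L2T R K%:R) (@gabor_PKg R g M K)) /\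
  (* (ii) *)
  (odd (K %/ M) ->
     is_frame (@CK R K) (@ipCK R K) (@nrm2CK R K) (@gabor_PKSg R g M K)) /\
  (* (iii) *)
  ((forall x, g (- x) = g x) -> odd M ->
     is_frame (@l2Z R) (@ipl2Z R) (@nrm2l2Z R) (@gabor_Sg R g M)) /\
  (* (iv) *)
  ((forall x, g (- x) = g x) -> odd M ->
     is_frame (@CK R K) (@ipCK R K) (@nrm2CK R K) (@gabor_PKSg R g M K)).
Proof.
have [cr ci] := Hcont.
have [ds [h [c [Hh ds2 c0 gE]]]] := totally_positive_tpker R g m Hm Htp cr ci.
have [d [A0 HG]] := expdec_scale R ds h c Hh c0.
have h_even : (forall x, g (- x) = g x) -> forall t, h (- t) = h t.
  move=> ge t; have := congr1 (@complex.Re R) (ge t); rewrite !gE /=.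
  by apply: mulfI; rewrite gt_eqF.
have p0 := @pi_gt0 R; have MR : 0 < M%:R :> R by rewrite ltr0n.
split.
  have /dvdnP [N KE] := HMK; rewrite {HMK}KE => oN'.
  have oN : odd N by move: oN'; rewrite mulnK.
  have N0 : (0 < N)%N by case: N oN {oN'}.
  have [A [B [A_gt0 B_gt0 HAB]]] := family_bounds R 'I_N
    (fun j => zak_sqr R (fun x => c * h x) M (2 * pi * j%:R / N%:R)) 0 M%:R (ltW MR)
    (fun j => zak_sqr_continuous R ds h c M Hh ds2 HM _)
    (fun j t _ => zak_sqr_gt0 R ds h c M Hh c0 HM _ t (cos_odd_neqN1 R j N oN)).
  have NM0 : (0 < N * M)%N by rewrite muln_gt0 N0.
  apply: (L2T_frame R d A0 _ g M N HG gE HM N0 (per_continuous R ds h c Hh ds2 _ NM0) A B) => //.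
  by move=> j t jN; exact: (HAB (Ordinal jN)).
split.
  move=> oN; apply: (CK_frame R d A0 _ g HG gE) => // i j _ _.
  by apply: (zak_sqr_gt0 R ds) => //; exact: cos_odd_neqN1.
split=> ge oM.
  (* The cycles approximating the integers have more and more phases, so the bounds are taken over
     the whole interval [0, 2 pi]; the points are the residues below M. *)
  have [|i|i phi _|A [B [A_gt0 B_gt0 HAB]]] := family_bounds R 'I_M
    (fun i phi => zak_sqr R (fun x => c * h x) M phi i%:R) 0 (2 * pi).
  - by rewrite mulr_ge0 // ltW.
  - exact: (zak_sqr_continuous_phase R ds).
  - by apply: (zak_sqr_even_gt0 R ds) => //; exact: h_even.
  apply: (l2Z_frame R d A0 _ g M A B HG gE) => //.
  by move=> i phi iM; exact: (HAB (Ordinal iM)).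
apply: (CK_frame R d A0 _ g HG gE) => // i j _ _.
by apply: (zak_sqr_even_gt0 R ds) => //; exact: h_even.
Qed.
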